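(* Let $s\in(0,1)$ and $p>1$. Let $\Omega\subset\mathbb{R}^d$, $d\ge2$, be a bounded Lipschitz domain, and let $K_1\subset K$ be any set such that $K\subset\Omega$, where $K$ is a compact set of codimension $k$ of class $C^{0,1}$, $1<k<d$, $k\in\mathbb{N}$. Assume that $sp=k$, that $\delta_K(x)<R$ for all $x\in\Omega$, for some $R>0$, and that $\alpha=d+(k-d)\frac{\tau}{p}$. Then the fractional Hardy-type inequality (with a constant $C>0$) $$\left(\int_\Omega \frac{|u(x)|^\tau}{\delta_{K_1}^\alpha(x)\,\ln^\beta\!\left(\frac{2R}{\delta_{K_1}(x)}\right)}\,dx\right)^{\frac1\tau}\le C\left(\int_\Omega\int_\Omega\frac{|u(x)-u(y)|^p}{|x-y|^{d+sp}}\,dx\,dy+\int_\Omega|u(x)|^p\,dx\right)^{\frac1p}\quad\text{for all }u\in W^{s,p}_0(\Omega\setminus K)$$ holds in each of the following cases: (1) if $\tau=p$, then $\beta=p$; (2) if $\tau\in\left(p,\frac{dp+1}{1-(k-d)}\right]$, then $\beta=\tau-1$; (3) if $\tau\in\left(\frac{dp+1}{1-(k-d)},p_s^*\right]$, then $\beta=dp+(k-d)\tau$.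
   Context: Notation: for a set $A$, $\delta_A(x)=\inf_{y\in A}|x-y|$; $\ln^\beta(t)=(\ln t)^\beta$; $p_s^*=\frac{dp}{d-sp}$ for $sp<d$. $[u]^p_{W^{s,p}(\Omega)}=\int_\Omega\int_\Omega\frac{|u(x)-u(y)|^p}{|x-y|^{d+sp}}\,dx\,dy$; $W^{s,p}(\Omega)$ is the space of $u\in L^p(\Omega)$ with $[u]_{W^{s,p}(\Omega)}<\infty$, with norm $\|u\|_{W^{s,p}(\Omega)}=\left([u]^p_{W^{s,p}(\Omega)}+\|u\|^p_{L^p(\Omega)}\right)^{1/p}$. $W^{s,p}_0(\Omega\setminus K)$ is the closure, with respect to $\|\cdot\|_{W^{s,p}(\Omega)}$, of the set of $u\in W^{s,p}(\Omega)\cap C(\Omega)$ that vanish in a neighbourhood of $K$. Class $C^{0,1}$ (for $1<k<d$): a compact surface $K$ of codimension $k$ in $\mathbb{R}^d$ is of class $C^{0,1}$ if there is $C>0$ such that for every $x\in K$ there exist a ball $B=B_r(x)\subset\mathbb{R}^d$, $r>0$, and an isomorphism $T:Q\to B$, with $Q=B_1^k(0)\times(0,1)^{d-k}$ and $B_1^k(0)$ the unit ball of $\mathbb{R}^k$ centered at $0$, such that $T\in C^{0,1}(\overline Q)$, $T^{-1}\in C^{0,1}(\overline B)$ (Lipschitz), $\|T\|_{C^{0,1}(\overline Q)}+\|T^{-1}\|_{C^{0,1}(\overline B)}\le C$, and, writing $\xi=(\xi_k,\xi_{d-k})\in Q$ with $\xi_k\in B_1^k(0)$, $\xi_{d-k}\in(0,1)^{d-k}$,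 one has $T^{-1}(B\cap K)=\{\xi\in Q:\xi_k=0\}$. It is also assumed that for any $y=T((\xi_k,\xi_{d-k}))\in(\Omega\setminus K)\cap B$ one has $C_1|\xi_k|\le\delta_K(y)\le C_2|\xi_k|$ for some $C_1,C_2>0$ very close to $1$.
   Formalization: The formal theorem also assumes that K_1 is nonempty and that the supremum of δ_{K_1} over Ω is less than 2R; δ_K < R alone lets ln(2R/δ_{K_1}) vanish or turn negative in Ω, where the printed inequality fails or is undefined. *)

(* Defs.v *)
From HB Require Import structures.
From mathcomp Require Import all_boot all_order all_algebra.
From mathcomp Require Import all_classical all_reals all_analysis.

Set Implicit Arguments.
Unset Strict Implicit.
Unset Printing Implicit Defensive.

Import Order.TTheory GRing.Theory Num.Theory.
Import numFieldNormedType.Exports.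

Local Open Scope classical_set_scope.
Local Open Scope ring_scope.

(* R^d is 'rV[R]_d. The library norm and balls of 'rV[R]_d are those of the
   sup norm; its topology (open, closed, compact, closure, continuity) is the
   usual one, but every length below is Euclidean, through [enorm]. *)

Section EuclideanSpace.
Context {R : realType} {d : nat}.
Implicit Types (x y : 'rV[R]_d) (A : set 'rV[R]_d).

Definition edot x y : R := \sum_i x ord0 i * y ord0 i.

Definition enorm x : R := Num.sqrt (edot x x).

Definition eball x (r : R) : set 'rV[R]_d := [set y | enorm (y - x) < r].

(* [inf] is the real infimum: junk value 0 when A is empty. *)
Definition dist_to A x : R := inf [set enorm (x - y) | y in A].

End EuclideanSpace.

(* The Borel sigma-algebra of R^n, generated by the coordinate maps. *)
Section BorelRowVectors.
Context {R : realType} (n : nat).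

Let coord (i : 'I_n) (x : 'rV[R]_n) : measurableTypeR R := x ord0 i.

Definition borel_rV : set (set 'rV[R]_n) := g_sigma_preimage coord.

Let borel_rV0 : borel_rV set0.
Proof. exact: sigma_algebra0. Qed.

Let borel_rVC A : borel_rV A -> borel_rV (~` A).
Proof. exact: sigma_algebraC. Qed.

Let borel_rV_bigcup (F : (set 'rV[R]_n)^nat) :
  (forall i, borel_rV (F i)) -> borel_rV (\bigcup_i F i).
Proof. exact: sigma_algebra_bigcup. Qed.

HB.instance Definition _ := @isMeasurable.Build default_measure_display
  'rV[R]_n borel_rV borel_rV0 borel_rVC borel_rV_bigcup.

Lemma measurable_coord (i : 'I_n) : measurable_fun [set: 'rV[R]_n] (coord i).
Proof.
move=> _ Y mY; rewrite setTI; apply: sub_sigma_algebra => /=.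
rewrite -bigcup_seq/=; exists i => /=; first by rewrite mem_index_enum.
by exists Y => //; rewrite setTI.
Qed.

Lemma measurable_fun_rV d (T : measurableType d) (f : T -> 'rV[R]_n) :
  (forall i, measurable_fun [set: T] (coord i \o f)) ->
  measurable_fun [set: T] f.
Proof.
move=> mf _ A mA; rewrite setTI.
suff : borel_rV `<=` [set B | measurable (f @^-1` B)] by apply.
apply: smallest_sub => /=.
  split => /=.
  - by rewrite preimage_set0.
  - by move=> B mB; rewrite setTD -preimage_setC; exact: measurableC.
  - by move=> F mF; rewrite preimage_bigcup; exact: bigcup_measurable.
move=> B; rewrite -bigcup_seq => -[i _ [Y mY <-]].
rewrite setTI.
by have := mf i measurableT Y mY; rewrite setTI.
Qed.

End BorelRowVectors.

Section LebesgueMeasure.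
Context {R : realType}.

(* The type 'rV_(1 + n) is convertible to 'rV_n.+1. *)
Definition cons_rV (n : nat) (z : 'rV[R]_n * measurableTypeR R) :
  'rV[R]_n.+1 := row_mx (z.2 : R)%:M z.1.

Lemma cons_rV0 n (z : 'rV[R]_n * measurableTypeR R) :
  cons_rV z ord0 ord0 = z.2.
Proof.
rewrite /cons_rV (_ : ord0 = @lshift 1 n ord0); last exact/val_inj.
by rewrite (row_mxEl (z.2 : R)%:M) mxE eqxx mulr1n.
Qed.

Lemma cons_rVS n (z : 'rV[R]_n * measurableTypeR R) (i : 'I_n) :
  cons_rV z ord0 (lift ord0 i) = z.1 ord0 i.
Proof.
rewrite /cons_rV (_ : lift ord0 i = @rshift 1 n i); last exact/val_inj.
by rewrite (row_mxEr (z.2 : R)%:M).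
Qed.

Lemma measurable_cons_rV n : measurable_fun setT (@cons_rV n).
Proof.
apply: measurable_fun_rV => i; rewrite /comp.
have [->|[j ->]] : i = ord0 \/ exists j, i = lift ord0 j.
  by case: (unliftP ord0 i) => [j ->|->]; [right; exists j|left].
  apply: (eq_measurable_fun snd) => [z _|]; last exact: measurable_snd.
  by rewrite cons_rV0.
apply: (eq_measurable_fun (fun z : 'rV[R]_n * measurableTypeR R =>
    z.1 ord0 j : measurableTypeR R)) => [z _|]; first by rewrite cons_rVS.
exact: (measurableT_comp (measurable_coord j)).
Qed.

Fixpoint lebesgue_rV (n : nat) : {measure set 'rV[R]_n -> \bar R} :=
  match n with
  | 0 => dirac (0 : 'rV[R]_0)
  | n'.+1 => measure_function_pushforward__canonical__measure_function_Measure
      (lebesgue_rV n' \x @lebesgue_measure R)%E (@measurable_cons_rV n')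
  end.

Lemma lebesgue_rV_box n (A : 'I_n -> set (measurableTypeR R)) :
  (forall i, measurable (A i)) ->
  lebesgue_rV n [set x : 'rV[R]_n | forall i, A i (x ord0 i)] =
  (\prod_i lebesgue_measure (A i))%E.
Proof.
elim: n A => [|n IHn] A mA.
  by rewrite big_ord0 /= diracE mem_set//= => -[].
rewrite big_ord_recl /= /pushforward.
have -> : @cons_rV n @^-1` [set x : 'rV[R]_n.+1 | forall i, A i (x ord0 i)] =
    [set x : 'rV[R]_n | forall i, A (lift ord0 i) (x ord0 i)] `*` A ord0.
  apply/seteqP; split => -[x t] /=.
    move=> xA; split=> [i|]; first by have := xA (lift ord0 i); rewrite cons_rVS.
    by have := xA ord0; rewrite cons_rV0.
  move=> [xA tA] i.
  case: (unliftP ord0 i) => [j ->|->]; first by rewrite cons_rVS; exact: xA.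
  by rewrite cons_rV0.
rewrite product_measure1E//; first by rewrite muleC; congr (_ * _)%E;
  exact: (IHn (fun i => A (lift ord0 i))).
rewrite (_ : mkset _ = \bigcap_(i in [set: 'I_n])
  (fun x : 'rV[R]_n => x ord0 i : measurableTypeR R) @^-1` A (lift ord0 i)).
  apply: fin_bigcap_measurable => // i _; rewrite -[_ @^-1` _]setTI.
  by apply: measurable_coord.
by apply/seteqP; split => x /= xA i; [move=> _; exact: xA|exact: (xA i I)].
Qed.

End LebesgueMeasure.

Section Geometry.
Context {R : realType} {d : nat}.
Implicit Types (Om K D : set 'rV[R]_d) (f : 'rV[R]_d -> 'rV[R]_d).

(* Bounded, open, connected, nonempty, and near each boundary point Om is, in
   the direction of a unit vector e, the strict epigraph of a Lipschitz function
   on the hyperplane orthogonal to e. That function is written as a Lipschitz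
   phi on R^d of which only the values on the hyperplane are used (a Lipschitz
   function on the hyperplane always extends). *)
Definition bounded_lipschitz_domain Om : Prop :=
  [/\ Om !=set0, open Om, connected Om, bounded_set Om &
   forall x, (closure Om `\` Om) x ->
    exists r : R, exists e : 'rV[R]_d, exists phi : 'rV[R]_d -> R,
      exists L : R,
    [/\ 0 < r, enorm e = 1,
        forall y z, `|phi y - phi z| <= L * enorm (y - z) &
        forall y, eball x r y ->
          (Om y <-> phi (y - edot y e *: e) < edot y e)]].

(* The sup norm of |f| plus the best Lipschitz constant, in [0, +oo] for D
   nonempty; pairs x = y contribute 0 / 0 = 0. *)
Definition c01_norm D f : \bar R :=
  (ereal_sup [set (enorm (f x))%:E | x in D] +
   ereal_sup [set (enorm (f z.1 - f z.2) / enorm (z.1 - z.2))%:E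
             | z in D `*` D])%E.

(* For xi = (xi_k, xi_(d-k)) in R^k x R^(d-k), with xi_k the first k
   coordinates: the Euclidean norm |xi_k|. *)
Definition norm_fst (k : nat) (xi : 'rV[R]_d) : R :=
  Num.sqrt (\sum_(i < d | (i < k)%N) xi ord0 i ^+ 2).

(* Q = B_1^k(0) x (0, 1)^(d-k) *)
Definition cylinder (k : nat) : set 'rV[R]_d :=
  [set xi | norm_fst k xi < 1 /\
            forall i : 'I_d, (k <= i)%N -> 0 < xi ord0 i < 1].

(* K is a surface of codimension k of class C^{0,1}, including the
   comparability of |xi_k| with the distance to K at points of Om \ K.
   T and S = T^-1 are total functions, constrained on closure Q and on the
   closure of B only. *)
Definition class_C01 (k : nat) Om K : Prop :=
  exists2 C : R, 0 < C &
  forall x, K x -> exists r : R, exists T S : 'rV[R]_d -> 'rV[R]_d,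
    let Q := cylinder k in
    let B := eball x r in
    [/\ 0 < r,
        [/\ forall xi, Q xi -> B (T xi), forall y, B y -> Q (S y),
            {in Q, cancel T S} & {in B, cancel S T}],
        (c01_norm (closure Q) T + c01_norm (closure B) S <= C%:E)%E,
        S @` (B `&` K) = [set xi | Q xi /\
                          forall i : 'I_d, (i < k)%N -> xi ord0 i = 0] &
        exists C1 : R, exists C2 : R,
        [/\ 0 < C1, 0 < C2 &
         forall xi, Q xi -> (Om `\` K) (T xi) ->
           C1 * norm_fst k xi <= dist_to K (T xi) <= C2 * norm_fst k xi]].

End Geometry.

Section FractionalSobolev.
Context {R : realType} {d : nat}.
Variables (s p : R) (Om : set 'rV[R]_d).
Local Notation mu := (@lebesgue_rV R d).

(* The p-th power of the Gagliardo seminorm; the integrand is 0 / 0 = 0 on the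
   diagonal. *)
Definition gagliardo (u : 'rV[R]_d -> R) : \bar R :=
  (\int[mu]_(x in Om) \int[mu]_(y in Om)
    (`|u x - u y| `^ p / enorm (x - y) `^ (d%:R + s * p))%:E)%E.

Definition Lp_power (u : 'rV[R]_d -> R) : \bar R :=
  (\int[mu]_(x in Om) (`|u x| `^ p)%:E)%E.

Definition sobolev_norm (u : 'rV[R]_d -> R) : \bar R :=
  poweR (gagliardo u + Lp_power u)%E p^-1.

(* Functions are not quotiented by equality almost everywhere; only their values
   on Om matter. *)
Definition sobolev : set ('rV[R]_d -> R) :=
  [set u | [/\ measurable_fun Om u, (Lp_power u < +oo)%E &
               (gagliardo u < +oo)%E]].

Definition vanishing_near (K : set 'rV[R]_d) : set ('rV[R]_d -> R) :=
  [set v | [/\ sobolev v, {within Om, continuous v} &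
           exists U, [/\ open U, K `<=` U & forall x, (U `&` Om) x -> v x = 0]]].

(* W^{s,p}_0(Om \ K) *)
Definition sobolev0 (K : set 'rV[R]_d) : set ('rV[R]_d -> R) :=
  [set u | sobolev u /\ forall eps : R, 0 < eps ->
    exists2 v, vanishing_near K v &
      (sobolev_norm (fun x => u x - v x)%R < eps%:E)%E].

End FractionalSobolev.

(* Main.v *)
Require Import Defs.
From HB Require Import structures.
From mathcomp Require Import all_boot all_order all_algebra.
From mathcomp Require Import all_classical all_reals all_analysis.
From mathcomp Require Import measurable_realfun ring lra.

(* By homogeneity u has W^{s,p}(Om) norm at most 1. Since sp = k, the kernel of
   the seminorm is |x - y|^-(d + k). A chart of K cuts a neighbourhood of K into nested cells:
   those of generation j have diameter comparable to 2^-j and measure comparable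
   to 2^-jd, lie within distance O(2^-j) of K, and have 2^(d - k) children. Let
   V be the mean of |u|^p on a cell. Passing from a cell to a child changes V by
   the oscillation of u at scale 2^-j, and the weighted oscillations are summable
   over all scales by the Gagliardo seminorm. For tau = p the resulting recursion
   is a discrete Hardy inequality, which gives the logarithm to the power p. For
   tau > p the map V |-> V^(tau/p) makes the recursion a contraction, and the
   logarithm is only needed to be bounded below. Inside a cell |u|^tau is
   controlled by V, by the oscillation and by the Sobolev power |u|^(dp/(d - k)).
   Off K the weight is bounded and the fractional Sobolev inequality suffices.
   All distances to K1 are at least the distance to K, so a point at distance t
   from K1 lies in a cell of a generation j with 2^-j comparable to t. *)

Set Implicit Arguments.
Unset Strict Implicit.
Unset Printing Implicit Defensive.

Import Order.TTheory GRing.Theory Num.Theory.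
Import numFieldNormedType.Exports.

Local Open Scope classical_set_scope.
Local Open Scope ring_scope.

(** * Euclidean norm and Lebesgue measure *)

Section EuclideanNorm.
Context {R : realType} {d : nat}.
Implicit Types (x y z : 'rV[R]_d) (A : set 'rV[R]_d).

(** Write n = 2^(d - k) for the number of children. The value of [alpha] is dictated by scaling:
    2^(j alpha) times the measure of a cell is about n^(-j tau/p), so the weighted integral of
    V^(tau/p) over generation j is about the sum of (V/n^j)^(tau/p) over its cells. At tau = p the n
    children each inherit 1/n of this quantity from their parent, and nothing decays. The step rests
    on (a + b)^p <= (1 - t)^(1 - p) a^p + t^(1 - p) b^p, whose loss over all generations is
    affordable only for t of order 1/j; this puts a factor j^(p - 1) on the oscillation, which the
    logarithm absorbs. For tau > p the children inherit only n^(1 - tau/p) < 1 in all, which leaves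
    room for a fixed t. This second recursion is not linear in the energy and needs an absolute
    bound on it, whence the normalisation of u; homogeneity is restored at the very end. *)

Lemma edotC x y : edot x y = edot y x.
Proof. by apply: eq_bigr => i _; rewrite mulrC. Qed.

Lemma edotDl x y z : edot (x + y) z = edot x z + edot y z.
Proof. by rewrite -big_split; apply: eq_bigr => i _; rewrite !mxE mulrDl. Qed.

Lemma edotZl a x y : edot (a *: x) y = a * edot x y.
Proof. by rewrite mulr_sumr; apply: eq_bigr => i _; rewrite !mxE mulrA. Qed.

Lemma edotNl x y : edot (- x) y = - edot x y.
Proof. by rewrite -scaleN1r edotZl mulN1r. Qed.

Lemma edotBl x y z : edot (x - y) z = edot x z - edot y z.
Proof. by rewrite edotDl edotNl. Qed.

Lemma edot_ge0 x : 0 <= edot x x.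
Proof. by apply: sumr_ge0 => i _; rewrite -expr2 sqr_ge0. Qed.

Lemma enorm_ge0 x : 0 <= enorm x.
Proof. exact: sqrtr_ge0. Qed.

Lemma sqr_enorm x : enorm x ^+ 2 = edot x x.
Proof. by rewrite sqr_sqrtr// edot_ge0. Qed.

Lemma coord_le_enorm x i : `|x ord0 i| <= enorm x.
Proof.
rewrite -sqrtr_sqr ler_sqrt ?edot_ge0//.
rewrite /edot (bigD1 i)//= -expr2 lerDl; apply: sumr_ge0 => j _.
by rewrite -expr2 sqr_ge0.
Qed.

Lemma enorm0_eq0 x : enorm x = 0 -> x = 0.
Proof.
move=> x0; apply/rowP => i; apply/eqP; rewrite mxE -normr_le0.
by rewrite -x0; exact: coord_le_enorm.
Qed.

Lemma enorm0 : enorm (0 : 'rV[R]_d) = 0.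
Proof. by rewrite /enorm /edot big1 ?sqrtr0// => i _; rewrite mxE mul0r. Qed.

Lemma enormN x : enorm (- x) = enorm x.
Proof. by rewrite /enorm edotNl edotC edotNl opprK. Qed.

Lemma enormB x y : enorm (x - y) = enorm (y - x).
Proof. by rewrite -enormN opprB. Qed.

Lemma enormZ a x : enorm (a *: x) = `|a| * enorm x.
Proof.
rewrite /enorm edotZl edotC edotZl mulrA -expr2 sqrtrM ?sqr_ge0//.
by rewrite sqrtr_sqr.
Qed.

Lemma edot_le_enorm x y : edot x y <= enorm x * enorm y.
Proof.
have [y0|y0] := eqVneq (enorm y) 0.
  rewrite y0 mulr0 (enorm0_eq0 y0) edotC /edot big1// => i _.
  by rewrite mxE mul0r.
have yp : 0 < enorm y by rewrite lt_neqAle eq_sym y0 enorm_ge0.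
have xp := enorm_ge0 x.
have := edot_ge0 (x - (edot x y / enorm y ^+ 2) *: y).
rewrite edotBl edotZl ![edot _ (_ - _)]edotC !edotBl !edotZl (edotC y x).
rewrite -!sqr_enorm.
set b := edot x y; set c := enorm y in yp y0 *; set a := enorm x in xp *.
rewrite [X in _ <= X](_ : _ = ((a * c) ^+ 2 - b ^+ 2) / c ^+ 2); last by field.
rewrite pmulr_lge0 ?invr_gt0 ?exprn_gt0// subr_ge0 => h.
rewrite (le_trans (ler_norm _))// -(@ler_pXn2r _ 2) ?nnegrE ?mulr_ge0 ?(ltW yp)//.
by rewrite real_normK ?num_real.
Qed.

Lemma ler_enormD x y : enorm (x + y) <= enorm x + enorm y.
Proof.
rewrite -(@ler_pXn2r _ 2) ?nnegrE ?addr_ge0 ?enorm_ge0//.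
rewrite sqr_enorm edotDl ![edot _ (_ + _)]edotC !edotDl -!sqr_enorm (edotC y x).
by have := edot_le_enorm x y; set b := edot x y; lra.
Qed.

Lemma ler_enorm_trans z x y : enorm (x - y) <= enorm (x - z) + enorm (z - y).
Proof. by rewrite (le_trans _ (ler_enormD _ _))// addrA subrK. Qed.

Lemma enorm_le_coord x c : (forall i, `|x ord0 i| <= c) -> enorm x <= d%:R * c.
Proof.
move=> xc; have [d0|d0] := posnP d.
  suff -> : x = 0 by rewrite enorm0 d0 mul0r.
  by apply/rowP => i; have := ltn_ord i; rewrite {2}d0.
have c0 : 0 <= c by apply: le_trans (xc (Ordinal d0)); exact: normr_ge0.
rewrite -(@ler_pXn2r _ 2) ?nnegrE ?mulr_ge0 ?enorm_ge0// sqr_enorm.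
apply: (@le_trans _ _ (\sum_(i < d) c ^+ 2)).
  apply: ler_sum => i _; rewrite -expr2 -real_normK ?num_real//.
  by rewrite lerXn2r ?nnegrE.
rewrite sumr_const card_ord -[leLHS]mulr_natl exprMn ler_pM ?sqr_ge0//.
by rewrite -natrX ler_nat -mulnn leq_pmulr.
Qed.

End EuclideanNorm.

Section BorelSets.
Context {R : realType} {d : nat}.
Implicit Types (x y z : 'rV[R]_d) (A U : set 'rV[R]_d).

Definition box x (e : R) : set 'rV[R]_d :=
  [set y | forall i, ball (x ord0 i) e (y ord0 i)].

Lemma eball_sub_box x r : eball x r `<=` box x r.
Proof.
move=> y yr i; rewrite /ball/= -normrN opprB.
by have := coord_le_enorm (y - x) i; rewrite !mxE => /le_lt_trans; apply.
Qed.

Lemma box_sub_eball x r : 0 < r -> box x (r / d.+1%:R) `<=` eball x r.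
Proof.
move=> r0 y yb; rewrite /eball/=.
apply: (@le_lt_trans _ _ (d%:R * (r / d.+1%:R))).
  apply: enorm_le_coord => i; rewrite !mxE distrC ltW//; exact: yb.
by rewrite mulrC mulrAC ltr_pdivrMr// ltr_pM2l// ltr_nat.
Qed.

Lemma eball_subset x y r e : enorm (y - x) + e <= r -> eball y e `<=` eball x r.
Proof.
move=> h z; rewrite /eball/= => ze.
by rewrite (le_lt_trans (ler_enorm_trans y _ _))// addrC (lt_le_trans _ h)// ltrD2l.
Qed.

Lemma open_eballP A : open A <->
  forall x, A x -> exists2 r, 0 < r & eball x r `<=` A.
Proof.
rewrite openE; split=> [+ x Ax|h x Ax].
  move=> /(_ x Ax) /nbhs_ballP[e /= e0 eA]; exists e => // y /eball_sub_box yb.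
  by apply: eA; split=> // i j; rewrite ord1; exact: yb.
have [r r0 rA] := h _ Ax.
apply/nbhs_ballP; exists (r / d.+1%:R) => /=; first exact: divr_gt0.
by move=> y [_ yb]; apply: rA; apply: box_sub_eball => // i; exact: yb.
Qed.

Lemma open_eball x r : open (eball x r).
Proof.
apply/open_eballP => y yr; exists (r - enorm (y - x)); first by rewrite subr_gt0.
by apply: eball_subset; rewrite subrKC.
Qed.

Lemma eball_center x r : 0 < r -> eball x r x.
Proof. by move=> r0; rewrite /eball/= subrr enorm0. Qed.

Lemma measurable_rV_forall (P : 'I_d -> set (measurableTypeR R)) :
  (forall i, measurable (P i)) ->
  measurable [set x : 'rV[R]_d | forall i, P i (x ord0 i)].
Proof.
move=> mP; rewrite (_ : mkset _ = \bigcap_(i in [set: 'I_d])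
  (fun x : 'rV[R]_d => x ord0 i : measurableTypeR R) @^-1` P i).
  apply: fin_bigcap_measurable => // i _; rewrite -[_ @^-1` _]setTI.
  by apply: measurable_coord.
by apply/seteqP; split => x /= xA i; [move=> _; exact: xA|exact: (xA i I)].
Qed.

Lemma measurable_box x e : measurable (box x e).
Proof.
apply: (measurable_rV_forall (P := fun i => ball (x ord0 i) e)) => i.
exact: measurable_ball.
Qed.

(** The sigma-algebra is generated by the coordinates, so an open set has to be exhibited as a
    countable union: of the boxes with rational centre and radius 1/(n + 1) that it contains,
    enumerated through [unpickle]. *)
Lemma measurable_open U : open U -> measurable U.
Proof.
move=> /open_eballP oU.
pose qv (q : 'rV[rat]_d) : 'rV[R]_d := map_mx ratr q.
pose F (m : nat) : set 'rV[R]_d :=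
  if unpickle m is Some (q, n) then
    if `[< box (qv q) (n.+1%:R^-1) `<=` U >] then box (qv q) (n.+1%:R^-1)
    else set0
  else set0.
suff -> : U = \bigcup_m F m.
  apply: bigcup_measurable => m _; rewrite /F.
  case: unpickle => [[q n]|//]; case: ifPn => // _; exact: measurable_box.
apply/seteqP; split=> [x Ux|x [m _]]; last first.
  rewrite /F; case: unpickle => [[q n]|//].
  by case: ifPn => // /asboolP; apply.
have [r r0 rU] := oU _ Ux.
pose e := r / d.+1%:R / 2.
have e0 : 0 < e by rewrite !divr_gt0.
pose n := Num.truncn e^-1.
have ne : n.+1%:R^-1 < e.
  by rewrite invf_plt ?posrE// truncnS_gt.
have /choice[q hq] : forall i : 'I_d, exists q : rat,
    ball (ratr q : R) n.+1%:R^-1 (x ord0 i).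
  move=> i; have : x ord0 i - n.+1%:R^-1 < x ord0 i.
    by rewrite ltrBlDr ltrDl invr_gt0.
  case/rat_in_itvoo => q; rewrite in_itv/= => /andP[q1 q2].
  exists q; rewrite /ball/= ltr_norml; apply/andP; split; last first.
    by rewrite (@lt_trans _ _ 0)// ?subr_lt0// ?invr_gt0.
  by rewrite ltrBrDl.
pose Q : 'rV[rat]_d := \row_i q i.
exists (pickle (Q, n)) => //; rewrite /F pickleK.
have Qx : box (qv Q) n.+1%:R^-1 x by move=> i; rewrite !mxE; exact: hq.
rewrite ifT//; apply/asboolP => y yQ; apply: rU; apply: box_sub_eball => // i.
have := ball_triangle (ball_sym (Qx i)) (yQ i); apply: le_ball.
by rewrite (le_trans (lerD (ltW ne) (ltW ne)))// /e -splitr.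
Qed.

Lemma measurable_eball x r : measurable (eball x r).
Proof. by apply: measurable_open; exact: open_eball. Qed.

Lemma measurable_cont_real (f : 'rV[R]_d -> R) :
  (forall a, open [set x | a < f x]) ->
  measurable_fun [set: 'rV[R]_d] (f : 'rV[R]_d -> measurableTypeR R).
Proof.
move=> fo; apply: (measurability _ (RGenOInfty.measurableE R)).
move=> /= _ [_ [r ->] <-]; rewrite setTI.
apply: measurable_open; rewrite (_ : _ @^-1` _ = [set x | r < f x]) ?fo//.
by apply/seteqP; split => x /=; rewrite in_itv/= andbT.
Qed.

Lemma measurable_enorm_sub y :
  measurable_fun [set: 'rV[R]_d] (fun x => enorm (x - y)).
Proof.
apply: measurable_cont_real => a; apply/open_eballP => x /= ax.
exists (enorm (x - y) - a); first by rewrite subr_gt0.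
move=> z; rewrite /eball/= (enormB z x) => zr.
by have := ler_enorm_trans z x y; lra.
Qed.

End BorelSets.

(* An alias of [lebesgue_rV], to which the sigma-finiteness needed by the theorem
   of Fubini and Tonelli is attached. *)
Definition leb (R : realType) (d : nat) : set 'rV[R]_d -> \bar R :=
  lebesgue_rV d.

HB.instance Definition _ (R : realType) (d : nat) := Measure.on (@leb R d).

Section LebesgueBalls.
Context {R : realType} {d : nat}.
Implicit Types (x : 'rV[R]_d) (r e : R).

Lemma leb_box x e : 0 <= e -> leb (box x e) = ((2 * e) ^+ d)%:E.
Proof.
move=> e0; rewrite /leb (lebesgue_rV_box (A := fun i => ball (x ord0 i) e)); last first.
  by move=> i; exact: measurable_ball.
rewrite (eq_bigr (fun=> (2 * e)%:E)) ?prodEFin ?prodr_const ?card_ord//.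
by move=> i _; rewrite lebesgue_measure_ball// mulr_natl.
Qed.

Lemma leb_eball_le x r : 0 <= r -> (leb (eball x r) <= ((2 * r) ^+ d)%:E)%E.
Proof.
move=> r0; rewrite -(leb_box x r0); apply: le_measure; rewrite ?inE.
- exact: measurable_eball.
- exact: measurable_box.
- exact: eball_sub_box.
Qed.

Lemma leb_eball_ge x r : 0 < r ->
  (((2 / d.+1%:R) ^+ d * r ^+ d)%:E <= leb (eball x r))%E.
Proof.
move=> r0; rewrite -exprMn mulrAC -mulrA -(leb_box x); last by rewrite divr_ge0// ltW.
apply: le_measure; rewrite ?inE.
- exact: measurable_box.
- exact: measurable_eball.
- exact: box_sub_eball.
Qed.

Lemma leb_sigma_finite : sigma_finite setT (@leb R d).
Proof.
exists (fun n => eball 0 n%:R); last first.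
  move=> n; split; first exact: measurable_eball.
  by rewrite (le_lt_trans (leb_eball_le _ _))// ltry.
apply/esym/seteqP; split=> // x _.
exists (Num.truncn (enorm x)).+1 => //; rewrite /eball/= subr0; exact: truncnS_gt.
Qed.

HB.instance Definition _ :=
  @Measure_isSigmaFinite.Build _ _ _ (@leb R d) leb_sigma_finite.

End LebesgueBalls.

(** * Powers and sequences *)

Section PowerInequalities.
Context {R : realType}.
Implicit Types (a b c p q t x y : R).

(** Convexity of the p-th power at a + b = (1 - t) (a / (1 - t)) + t (b / t). The parameter t stays
    free: it tends to 0 along the generations when tau = p and is fixed when tau > p. *)
Lemma powRDsplit p t a b : 1 <= p -> 0 < t < 1 -> 0 <= a -> 0 <= b ->
  (a + b) `^ p <= (1 - t) `^ (1 - p) * a `^ p + t `^ (1 - p) * b `^ p.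
Proof.
move=> p1 /andP[t0 t1] a0 b0.
have u0 : 0 < 1 - t by rewrite subr_gt0.
have key w c : 0 < w -> 0 <= c -> w * (c / w) `^ p = w `^ (1 - p) * c `^ p.
  move=> w0 c0; rewrite powRM ?invr_ge0 ?(ltW w0)//.
  rewrite powRB; last by rewrite (gt_eqF w0)/= implybT.
  rewrite powRr1 ?(ltW w0)// -powRN -(powR_inv1 (ltW w0)) -powRrM mulN1r powRN.
  by ring.
rewrite -(key _ _ t0 b0) -(key _ _ u0 a0).
have := @convex_powR R p p1 (Itv01 (ltW t0) (ltW t1)) (b / t) (a / (1 - t)).
rewrite !inE/= !in_itv/= !andbT !divr_ge0 ?(ltW u0) ?(ltW t0)//.
move=> /(_ isT isT); rewrite convRE [X in X `^ _ <= _ -> _]convRE/= /unstable.onem.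
rewrite (_ : t * (b / t) = b); last by rewrite mulrC divfK// gt_eqF.
rewrite (_ : (1 - t) * (a / (1 - t)) = a); last by rewrite mulrC divfK// gt_eqF.
by rewrite addrC [leRHS]addrC.
Qed.

Lemma eq_ler x y : x = y -> x <= y.
Proof. by move=> ->. Qed.

Lemma powR_le_maxD p q r x : 0 <= x -> 0 < p -> p <= q <= r ->
  x `^ q <= x `^ p + x `^ r.
Proof.
move=> x0 p0 /andP[pq qr]; have [x1|x1] := leP 1 x.
  by rewrite (le_trans (ler_powR x1 qr))// lerDr powR_ge0.
have [->|x00] := eqVneq x 0.
  by rewrite powR0 ?addr_ge0 ?powR_ge0// gt_eqF// (lt_le_trans p0).
rewrite (le_trans (@ger_powR _ x _ _ _ pq)) ?lerDl ?powR_ge0//.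
by rewrite (ltW x1) lt_neqAle eq_sym x00 x0.
Qed.

(** From e^y >= 1 + y and ln (1 + x) >= x / (1 + x) one gets (1 + x)^q >= 1 + q x / (1 + x), which
    is then inverted. With q = p - 1 and x = 1 / (2 (j + 1)) the loss term is (p - 1) / (4 p) / (j +
    1), the source of the constant in [discrete_hardy]. *)
Lemma powR_le_1Dx q x : 0 < q -> 0 < x <= 2^-1 ->
  (1 + x) `^ (- q) <= 1 - q / (2 * (1 + q)) * x.
Proof.
move=> q0 /andP[x0 x12].
have h1 : 1 + q * (x / (1 + x)) <= (1 + x) `^ q.
  rewrite /powR gt_eqF ?addr_gt0//; apply: le_trans (expR_ge1Dx _).
  rewrite lerD2l ler_wpM2l ?(ltW q0)//.
  have -> : x / (1 + x) = 1 - (1 + x)^-1 by field; rewrite gt_eqF// addr_gt0.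
  have : ln (1 + x)^-1 <= (1 + x)^-1 - 1.
    rewrite -[in leLHS](subrKC 1 (1 + x)^-1); apply: le_ln1Dx.
    by rewrite ltrBrDr addrC subrr invr_gt0 addr_gt0.
  by rewrite lnV ?posrE ?addr_gt0//; lra.
have y0 : 0 < 1 - q / (2 * (1 + q)) * x.
  rewrite subr_gt0 mulrAC ltr_pdivrMr ?mulr_gt0 ?addr_gt0//; nra.
rewrite powRN invf_ple ?posrE ?powR_gt0//; last by rewrite addr_gt0.
apply: le_trans h1.
rewrite -[leLHS]mul1r ler_pdivrMr// -subr_ge0.
rewrite (_ : _ - 1 =
   q * x * (2 * (1 + q) - (1 + x) - q * x) / (2 * (1 + q) * (1 + x))); last first.
  by field; rewrite !gt_eqF ?addr_gt0.
apply: divr_ge0; last by rewrite !mulr_ge0// addr_ge0// ltW.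
by apply: mulr_ge0; [rewrite mulr_ge0 ?ltW|nra].
Qed.

End PowerInequalities.

Section RealSequences.
Context {R : realType}.
Implicit Types (a o g y : nat -> R).

(* Multiplying the recursion for t = 1 / (2 (j + 2)) by (j + 2)^(1 - p) turns it
   into a telescoping inequality for a_j (j + 1)^(1 - p). *)
Lemma discrete_hardy (p C : R) a o : 1 < p -> 0 <= C ->
  (forall j, 0 <= a j) -> (forall j, 0 <= o j) ->
  (forall j (t : R), 0 < t < 1 ->
    a j.+1 <= (1 - t) `^ (1 - p) * a j + C * t `^ (1 - p) * o j) ->
  forall n, (p - 1) / (4 * p) * (\sum_(j < n) j.+1%:R `^ (- p) * a j) <=
    a 0%N + C * 2^-1 `^ (1 - p) * \sum_(j < n) o j.
Proof.
move=> p1 C0 a0 o0 H n.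
suff : a n * n.+1%:R `^ (1 - p) +
    (p - 1) / (4 * p) * (\sum_(j < n) j.+1%:R `^ (- p) * a j) <=
    a 0%N + C * 2^-1 `^ (1 - p) * \sum_(j < n) o j.
  by apply: le_trans; rewrite lerDr mulr_ge0 ?powR_ge0.
elim: n => [|n IH].
  by rewrite !big_ord0 !mulr0 !addr0 powR1 mulr1.
rewrite !big_ord_recr/= !mulrDr.
suff : a n.+1 * n.+2%:R `^ (1 - p) + (p - 1) / (4 * p) * (n.+1%:R `^ (- p) * a n)
    <= a n * n.+1%:R `^ (1 - p) + C * 2^-1 `^ (1 - p) * o n.
  move: IH; lra.
have m0 : 0 < n.+1%:R :> R by rewrite ltr0n.
have m1 : 0 < n.+2%:R :> R by rewrite ltr0n.
pose t : R := 2^-1 / n.+2%:R.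
have t01 : 0 < t < 1.
  rewrite /t divr_gt0//= ltr_pdivrMr// mul1r (@lt_le_trans _ _ 1)//.
    by rewrite invf_lt1// ltr1n.
  by rewrite ler1n.
have h := ler_wpM2r (powR_ge0 n.+2%:R (1 - p)) (H n t t01).
apply: (le_trans (lerD h (lexx _))).
have [t0 t1] := andP t01.
(* This t gives (1 - t) (n + 2) = n + 3/2, which still exceeds n + 1 by 1/2; that surplus produces
   the Hardy term. *)
have E1 : (1 - t) `^ (1 - p) * n.+2%:R `^ (1 - p) =
    n.+1%:R `^ (1 - p) * (1 + 2^-1 / n.+1%:R) `^ (1 - p).
  have u1 : 0 <= 1 - t by rewrite subr_ge0 ltW.
  have u2 : 0 <= 1 + 2^-1 / n.+1%:R :> R by rewrite addr_ge0// divr_ge0.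
  rewrite -(powRM _ u1 (ltW m1)) -(powRM _ (ltW m0) u2).
  congr (_ `^ _); rewrite /t -[n.+2%:R]natr1; field.
  by rewrite nat1r natr1 !gt_eqF.
have E2 : t `^ (1 - p) * n.+2%:R `^ (1 - p) = 2^-1 `^ (1 - p).
  by rewrite -powRM ?(ltW t0)// /t divfK// gt_eqF.
rewrite (_ : (_ + _) * n.+2%:R `^ (1 - p) =
    (1 - t) `^ (1 - p) * n.+2%:R `^ (1 - p) * a n +
    C * (t `^ (1 - p) * n.+2%:R `^ (1 - p)) * o n); last by ring.
rewrite E1 E2.
have := @powR_le_1Dx R (p - 1) (2^-1 / n.+1%:R).
rewrite opprB => /(_ _ _)-/(_ _ _) k.
have {}k : (1 + 2^-1 / n.+1%:R) `^ (1 - p) <= 1 - (p - 1) / (4 * p) / n.+1%:R.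
  apply: le_trans (k _ _) _; first by rewrite subr_gt0.
    by rewrite divr_gt0//= ler_pdivrMr// ler_peMr// ler1n.
  by apply: eq_ler; field; rewrite ?gt_eqF//; lra.
have -> : n.+1%:R `^ (- p) = n.+1%:R `^ (1 - p) / n.+1%:R :> R.
  rewrite -[X in _ / X]powRr1// -powRB; last by rewrite (gt_eqF m0) implybT.
  by congr (_ `^ _); ring.
have w0 : 0 <= n.+1%:R `^ (1 - p) * a n by rewrite mulr_ge0 ?powR_ge0.
have := ler_wpM2l w0 k.
set N := n.+1%:R `^ (1 - p); set Y := (1 + _) `^ _; set c := (p - 1) / _.
by set m := n.+1%:R^-1; set D := C * _ * _; lra.
Qed.

Lemma contraction_sum (k : R) y o :
  (forall j, 0 <= y j) -> (forall j, y j.+1 <= k * y j + o j) ->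
  forall n, (1 - k) * (\sum_(j < n) y j) <= y 0%N + \sum_(j < n) o j.
Proof.
move=> y0 H n.
suff : y n + (1 - k) * (\sum_(j < n) y j) <= y 0%N + \sum_(j < n) o j.
  by apply: le_trans; rewrite lerDr.
elim: n => [|n IH]; first by rewrite !big_ord0 mulr0.
by rewrite !big_ord_recr/= mulrDr; have := H n; lra.
Qed.

Lemma geometric_sum_le (r : R) n : 1 < r ->
  \sum_(i < n.+1) r ^+ i <= r / (r - 1) * r ^+ n.
Proof.
move=> r1; have r10 : 0 < r - 1 by rewrite subr_gt0.
elim: n => [|n IH].
  rewrite big_ord_recr big_ord0/= add0r expr0 mulr1 ler_pdivlMr// mul1r.
  by rewrite gerBl//.
rewrite big_ord_recr/= (le_trans (lerD IH (lexx _)))//.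
by apply: eq_ler; rewrite exprS; field; rewrite gt_eqF.
Qed.

(** A geometric sum is dominated by its last term, here the largest 2^i below T, so the constant is
    independent of n. It serves twice: with T = c / |x - y| it rebuilds the kernel from its dyadic
    truncations, and with T = |u x - u y| the numerator from the levels that the jump crosses. *)
Lemma dyadic_sum_le (q T : R) n : 0 < q -> 0 <= T ->
  \sum_(i < n | 2 ^+ i <= T) (2 `^ q) ^+ i <= 2 `^ q / (2 `^ q - 1) * T `^ q.
Proof.
move=> q0 T0; set r := 2 `^ q.
have r1 : 1 < r.
  by rewrite /r -[ltLHS](powRr0 2) /powR gt_eqF// ltr_expR ltr_pM2r// ln_gt0// ltr1n.
have c0 : 0 < r / (r - 1) by rewrite divr_gt0 ?subr_gt0// (lt_trans _ r1).
elim: n => [|n IH]; first by rewrite big_ord0 mulr_ge0 ?powR_ge0// ltW.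
have [Tn|Tn] := leP (2 ^+ n) T; last first.
  by rewrite big_mkcond big_ord_recr/= -big_mkcond/= ifN ?addr0// -ltNge.
apply: (@le_trans _ _ (r / (r - 1) * r ^+ n)).
  apply: le_trans (geometric_sum_le n r1).
  rewrite big_mkcond/= ler_sum// => i _; case: ifP => // _.
  by rewrite exprn_ge0// powR_ge0.
rewrite ler_wpM2l ?(ltW c0)// /r -powR_mulrn ?powR_ge0// powRAC powR_mulrn//.
by rewrite ge0_ler_powR ?nnegrE ?exprn_ge0// ltW.
Qed.

(** Every g_i is at most B, and since s < 1 a bound M with C B M^s <= M propagates along the
    recursion; (C B)^(1 / (1 - s)) is the fixed point. Once the x_i are bounded by M, summing
    x_(i+1) <= C M^s g_i concludes. *)
Lemma sublinear_recursion_sum (C B s X : R) : 0 <= C -> 0 <= B -> 0 <= X ->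
  0 <= s < 1 -> exists2 M : R, 0 < M &
  forall x g : nat -> R, (forall i, 0 <= x i) -> (forall i, 0 <= g i) ->
    x 0%N <= X -> (forall n, \sum_(i < n) g i <= B) ->
    (forall i, x i.+1 <= C * x i `^ s * g i) ->
  forall n, \sum_(i < n) x i <= M.
Proof.
move=> C0 B0 X0 /andP[s0 s1].
pose M := 1 + X + (C * B) `^ (1 - s)^-1.
have CB0 : 0 <= C * B by rewrite mulr_ge0.
have M1 : 1 <= M by rewrite /M -addrA lerDl addr_ge0 ?powR_ge0.
have M0 : 0 < M by rewrite (lt_le_trans _ M1).
have CBM : C * B * M `^ s <= M.
  apply: (@le_trans _ _ (M `^ (1 - s) * M `^ s)).
    rewrite ler_wpM2r ?powR_ge0//.
    have {1}-> : C * B = ((C * B) `^ (1 - s)^-1) `^ (1 - s).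
      by rewrite -powRrM mulVf ?powRr1// gt_eqF// subr_gt0.
    rewrite ge0_ler_powR ?nnegrE ?powR_ge0 ?subr_ge0 ?(ltW s1) ?(ltW M0)//.
    by rewrite /M lerDr addr_ge0.
  by rewrite -powRD ?subrK ?powRr1 ?(ltW M0)// gt_eqF ?implybT.
exists (X + C * M `^ s * B + 1).
  by rewrite ltr_wpDl// addr_ge0// !mulr_ge0// powR_ge0.
move=> x g x0 g0 xX gB H n.
have gi i : g i <= B.
  apply: le_trans (gB i.+1); rewrite big_ord_recr/= lerDr sumr_ge0//.
have xM i : x i <= M.
  elim: i => [|i IH].
    by rewrite (le_trans xX)// /M -addrA addrCA lerDl addr_ge0 ?powR_ge0.
  apply: le_trans (H i) _; apply: le_trans CBM.
  rewrite mulrAC ler_pM ?mulr_ge0 ?powR_ge0//; first by rewrite ler_wpM2l.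
  by rewrite ge0_ler_powR ?nnegrE// ltW.
case: n => [|n].
  by rewrite big_ord0 !addr_ge0// !mulr_ge0// powR_ge0.
rewrite big_ord_recl -addrA lerD//.
apply: (@le_trans _ _ (C * M `^ s * B)); last by rewrite lerDl.
rewrite (le_trans _ (ler_wpM2l _ (gB n))) ?mulr_ge0 ?powR_ge0// mulr_sumr ler_sum//.
move=> i _; apply: le_trans (H i) _; rewrite ler_wpM2r// ler_wpM2l//.
by rewrite ge0_ler_powR ?nnegrE// ltW.
Qed.

End RealSequences.

(** * Fractional Sobolev inequality *)

Section NonnegativeIntegrals.
Context {R : realType} {d : nat}.
Local Notation X := 'rV[R]_d.
Local Notation mu := (@leb R d).
Local Open Scope ereal_scope.

Lemma measurable_enorm2 :
  measurable_fun [set: X * X] (fun z => enorm (z.1 - z.2)).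
Proof.
rewrite (_ : (fun z : X * X => enorm (z.1 - z.2)) =
    (fun z => (\sum_i (z.1 ord0 i - z.2 ord0 i) ^+ 2) `^ 2^-1)%R); last first.
  apply/funext => z; rewrite powR12_sqrt ?sumr_ge0// => [|i _]; last exact: sqr_ge0.
  by congr Num.sqrt; apply: eq_bigr => i _; rewrite !mxE expr2.
apply: (measurableT_comp (measurable_powR _)).
apply: measurable_sum => i; apply: measurable_funX; apply: measurable_funB.
- exact: (measurableT_comp (measurable_coord i)).
- exact: (measurableT_comp (measurable_coord i)).
Qed.

Variables (Om : set X) (mOm : measurable Om).

Lemma measurable_inner_integral (h : X * X -> R) :
  measurable_fun [set: X * X] h -> (forall z, 0 <= h z)%R ->
  measurable_fun [set: X] (fun x => \int[mu]_(y in Om) (h (x, y))%:E).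
Proof.
move=> mh h0.
rewrite (_ : (fun _ => _) =
    fubini_F mu (fun z : X * X => (h z * \1_Om z.2)%:E)); last first.
  apply/funext => x; rewrite /fubini_F [LHS]integral_mkcond epatch_indic.
  by apply: eq_integral => y _; rewrite /= EFinM.
apply: measurable_fun_fubini_tonelli_F => [|z]; last by rewrite lee_fin mulr_ge0.
apply/measurable_EFinP/measurable_funM => //.
apply: (@measurableT_comp _ _ _ _ _ _ (\1_Om : X -> R) _ snd) => //.
Qed.

(** The passage from a pointwise bound on a sum of kernels to the seminorm; the sums are over dyadic
    scales or over levels of u, with a constant independent of their length. *)
Lemma sum_double_integral_le (n : nat) (h : nat -> X * X -> R) (H : X * X -> R)
    (C : R) :
  (forall i, measurable_fun [set: X * X] (h i)) -> (forall i z, 0 <= h i z)%R ->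
  measurable_fun [set: X * X] H -> (forall z, 0 <= H z)%R -> (0 <= C)%R ->
  (forall z, Om z.1 -> Om z.2 -> \sum_(i < n) h i z <= C * H z)%R ->
  \sum_(i < n) \int[mu]_(x in Om) \int[mu]_(y in Om) (h i (x, y))%:E <=
  C%:E * \int[mu]_(x in Om) \int[mu]_(y in Om) (H (x, y))%:E.
Proof.
move=> mh h0 mH H0 C0 hH.
have mD (f : X -> \bar R) : measurable_fun [set: X] f -> measurable_fun Om f.
  exact: measurable_funS.
have sec (f : X * X -> R) x : measurable_fun [set: X * X] f ->
    measurable_fun Om (fun y => (f (x, y))%:E).
  move=> mf; apply: mD; apply/measurable_EFinP.
  exact: (measurableT_comp mf (measurable_pair1 _)).
have I0 (f : X * X -> R) x : (forall z, 0 <= f z)%R ->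
    0 <= \int[mu]_(y in Om) (f (x, y))%:E.
  by move=> f0; apply: integral_ge0 => y _; rewrite lee_fin.
rewrite -ge0_integral_sum//=; last first.
- by move=> i x _; exact: I0.
- by move=> i; apply: mD; exact: measurable_inner_integral.
rewrite -ge0_integralZl_EFin//; last 2 first.
- by move=> x _; exact: I0.
- by apply: mD; exact: measurable_inner_integral.
apply: ge0_le_integral => //.
- by move=> x _; apply: sume_ge0 => i _; exact: I0.
- by apply: emeasurable_sum => i; apply: mD; exact: measurable_inner_integral.
- by apply: measurable_funeM; apply: mD; exact: measurable_inner_integral.
move=> x Ox; rewrite -ge0_integral_sum//=; last first.
- by move=> i y _; rewrite lee_fin.
- by move=> i; exact: sec.
rewrite -ge0_integralZl_EFin//; last 2 first.
- by move=> y _; rewrite lee_fin.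
- exact: sec.
apply: ge0_le_integral => //.
- by move=> y _; apply: sume_ge0 => i _; rewrite lee_fin.
- by apply: emeasurable_sum => i; exact: sec.
- by apply: measurable_funeM; exact: sec.
by move=> y Oy; rewrite sumEFin -EFinM lee_fin; exact: (hH (x, y)).
Qed.

Lemma nneseries_le_ub (f : nat -> \bar R) (M : \bar R) : (forall i, 0 <= f i) ->
  (forall n, \sum_(i < n) f i <= M) -> \sum_(i <oo) f i <= M.
Proof.
move=> f0 fM; apply: lime_le; first by apply: is_cvg_nneseries => i _ _; exact: f0.
by near=> n; rewrite big_mkord.
Unshelve. all: by end_near. Qed.

Lemma nneseries_ge_term (f : nat -> \bar R) i : (forall i, 0 <= f i) ->
  f i <= \sum_(i <oo) f i.
Proof.
move=> f0; apply: le_trans (@nneseries_lim_ge _ _ predT 0 i.+1 _); last by [].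
by rewrite big_nat_recr//= leeDr// sume_ge0.
Qed.

Lemma integral_Zindic (A : set X) (c : R) : measurable A -> A `<=` Om ->
  (0 <= c)%R -> \int[mu]_(x in Om) (c * \1_A x)%:E = c%:E * mu A.
Proof.
move=> mA AO c0; under eq_integral do rewrite EFinM.
rewrite ge0_integralZl_EFin//; last first.
  by apply/measurable_EFinP; exact: measurable_indic.
by rewrite integral_indic// setIidl.
Qed.

End NonnegativeIntegrals.

Section FractionalSobolevInequality.
Context {R : realType} {d : nat}.
Local Notation X := 'rV[R]_d.
Local Notation mu := (@leb R d).
Implicit Types (u : X -> R) (z : X * X).

Definition gagliardo_kernel (p D : R) u z : R :=
  `|u z.1 - u z.2| `^ p / enorm (z.1 - z.2) `^ D.

(** Measurability is required on the whole space so that Tonelli's theorem applies on the full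
    product; a function known on Om only is first extended by 0. D is the exponent of the kernel, d
    + k in the applications. *)
Definition sobolev_unit_ball (p D : R) (Om : set X) : set (X -> R) :=
  [set u : X -> R | [/\ measurable_fun [set: X] u,
    (\int[mu]_(x in Om) (`|u x| `^ p)%:E <= 1)%E &
    (\int[mu]_(x in Om) \int[mu]_(y in Om)
       (gagliardo_kernel p D u (x, y))%:E <= 1)%E]].

Lemma gagliardo_kernel_ge0 p D u z : 0 <= gagliardo_kernel p D u z.
Proof. by rewrite divr_ge0 ?powR_ge0. Qed.

Lemma measurable_abs_powR dT (Y : measurableType dT)
    (f : Y -> R) (q : R) : measurable_fun [set: Y] f ->
  measurable_fun [set: Y] (fun x => `|f x| `^ q).
Proof.
move=> mf; apply: (measurableT_comp (measurable_powR _)).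
exact: (measurableT_comp (@normr_measurable R setT)).
Qed.

Lemma measurable_diff u : measurable_fun [set: X] u ->
  measurable_fun [set: X * X] (fun z => u z.1 - u z.2).
Proof. by move=> mu; apply: measurable_funB; exact: measurableT_comp. Qed.

Lemma measurable_gagliardo_kernel p D u : measurable_fun [set: X] u ->
  measurable_fun [set: X * X] (gagliardo_kernel p D u).
Proof.
move=> mf; rewrite /gagliardo_kernel.
under eq_fun do rewrite -powRN.
apply: measurable_funM; first by apply: measurable_abs_powR; exact: measurable_diff.
by apply: (measurableT_comp (measurable_powR _)); exact: measurable_enorm2.
Qed.

Definition near_diag (c : R) (j : nat) : set (X * X) :=
  [set z | enorm (z.1 - z.2) * 2 ^+ j <= c].

Lemma measurable_near_diag c j : measurable (near_diag c j).
Proof.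
have m : measurable_fun [set: X * X] (fun z => enorm (z.1 - z.2) * 2 ^+ j).
  by apply: measurable_funM => //; exact: measurable_enorm2.
have := m measurableT `]-oo, c]%classic (measurable_itv _).
rewrite setTI; congr (measurable _).
Qed.

(** For x != y the scales that count are those with 2^j <= c / |x - y|, and the sum of 2^(jD) over
    them is at most a constant times |x - y|^(-D). All truncated energies together thus cost a
    single seminorm. *)
Lemma sum_near_diag_le (p D c : R) (Om : set X) : measurable Om -> 0 < p ->
  0 < D -> 0 < c -> exists2 M : R, 0 < M &
  forall u, sobolev_unit_ball p D Om u -> forall n,
    (\sum_(j < n) \int[mu]_(x in Om) \int[mu]_(y in Om)
      ((2 `^ D) ^+ j * (`|u x - u y| `^ p * \1_(near_diag c j) (x, y)))%:E
     <= M%:E)%E.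
Proof.
move=> mOm p0 D0 c0.
have r1 : 1 < 2 `^ D :> R.
  by rewrite -[ltLHS](powRr0 2) /powR gt_eqF// ltr_expR ltr_pM2r// ln_gt0// ltr1n.
pose K : R := 2 `^ D / (2 `^ D - 1) * c `^ D.
have K0 : 0 < K.
  by rewrite mulr_gt0 ?powR_gt0// divr_gt0 ?powR_gt0// subr_gt0.
exists K => // u [mf _ G1] n.
have := @sum_double_integral_le R d Om mOm n
  (fun j z => (2 `^ D) ^+ j * (`|u z.1 - u z.2| `^ p * \1_(near_diag c j) z))
  (gagliardo_kernel p D u) K.
move=> /(_ _ _ (measurable_gagliardo_kernel p D mf)).
move=> /(_ _ _ (gagliardo_kernel_ge0 p D u) (ltW K0)) h.
apply: le_trans (h _ _ _) _.
- move=> j; apply: measurable_funM => //; apply: measurable_funM.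
    by apply: measurable_abs_powR; exact: measurable_diff.
  by apply: measurable_indic; exact: measurable_near_diag.
- by move=> j z; rewrite !mulr_ge0 ?exprn_ge0 ?powR_ge0.
- move=> [x y] _ _ /=; rewrite /gagliardo_kernel/=.
  have [xy|xy] := eqVneq (enorm (x - y)) 0.
    have -> : x = y by apply/subr0_eq/enorm0_eq0.
    rewrite subrr normr0 powR0 ?gt_eqF// mul0r mulr0 big1// => i _.
    by rewrite mul0r mulr0.
  have e0 : 0 < enorm (x - y) by rewrite lt_neqAle eq_sym xy enorm_ge0.
  rewrite [leRHS](_ : _ = 2 `^ D / (2 `^ D - 1) * (c / enorm (x - y)) `^ D *
      `|u x - u y| `^ p); last first.
    rewrite powRM ?invr_ge0 ?(ltW c0) ?(ltW e0)//.
    rewrite -[(enorm _)^-1](powR_inv1 (ltW e0)) -powRrM mulN1r powRN.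
    by rewrite /K; ring.
  apply: le_trans (ler_wpM2r (powR_ge0 _ p) (dyadic_sum_le n D0 _)); last first.
    by rewrite divr_ge0 ?ltW.
  rewrite [X in _ <= X * _]big_mkcond/= mulr_suml ler_sum// => i _.
  rewrite indicE.
  have -> : ((x, y) \in near_diag c i) = (2 ^+ i <= c / enorm (x - y)).
    by rewrite ler_pdivlMr// mulrC; apply/idP/idP; rewrite inE.
  by case: ifPn => _; rewrite ?mulr1// !(mulr0, mul0r).
rewrite -[leRHS]mule1; apply: lee_wpmul2l => //; first by rewrite lee_fin ltW.
Qed.

(** The radius r with c r^d = 2 a is chosen so that Om fills at least 2 a of the ball; hence at
    least a of it lies outside E, and there the kernel is at least r^(-(d + k)). The condition 2 a
    <= c r0^d keeps r in the range where the density bound holds. *)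
Lemma integral_outside_ge (Om E : set X) (c r0 k a : R) x :
  measurable Om -> measurable E -> 0 < c -> 0 < r0 -> 0 <= k -> (0 < d)%N ->
  (forall r, 0 < r <= r0 -> ((c * r ^+ d)%:E <= mu (Om `&` eball x r))%E) ->
  mu E = a%:E -> 0 < a -> 2 * a <= c * r0 ^+ d -> E x ->
  (((2 / c) `^ (- ((d%:R + k) / d%:R)) * a `^ (- (k / d%:R)))%:E <=
   \int[mu]_(y in Om) (enorm (x - y) `^ (- (d%:R + k)) * \1_(~` E) y)%:E)%E.
Proof.
move=> mOm mE c0 r00 k0 d0 dens muE a0 ar Ex.
pose r := (2 * a / c) `^ d%:R^-1.
have dR : 0 < d%:R :> R by rewrite ltr0n.
have ac0 : 0 < 2 * a / c by rewrite divr_gt0// mulr_gt0.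
have r_gt0 : 0 < r by rewrite powR_gt0.
have rd : r ^+ d = 2 * a / c.
  by rewrite -powR_mulrn ?powR_ge0// -powRrM mulVf ?gt_eqF// powRr1// ltW.
have rr0 : r <= r0.
  rewrite -(@ler_pXn2r _ d)// ?nnegrE ?(ltW r00) ?(ltW r_gt0)//.
  by rewrite rd ler_pdivrMr// [leRHS]mulrC.
pose S := (Om `&` eball x r) `\` E.
have mS : measurable S.
  by apply: measurableD => //; apply: measurableI => //; exact: measurable_eball.
have aS : (a%:E <= mu S)%E.
  have := dens r; rewrite r_gt0 rr0 => /(_ isT).
  rewrite rd mulrC divfK ?gt_eqF// => h.
  have : (mu (Om `&` eball x r) <= mu S + mu E)%E.
    rewrite (le_trans _ (measureU2 _ _ _))// le_measure ?inE//.
    - by apply: measurableI => //; exact: measurable_eball.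
    - exact: measurableU.
    - by move=> y yr; have [Ey|Ey] := pselect (E y); [right|left].
  move=> /(le_trans h); rewrite muE -leeBlDr//.
  by apply: le_trans; rewrite -EFinB lee_fin; lra.
apply: (@le_trans _ _ (\int[mu]_(y in Om) (r `^ (- (d%:R + k)) * \1_S y)%:E)%E).
  rewrite integral_Zindic ?powR_ge0//; last by move=> y [[]].
  apply: (@le_trans _ _ ((r `^ (- (d%:R + k)))%:E * a%:E)%E); last first.
    by rewrite lee_wpmul2l// lee_fin powR_ge0.
  rewrite -EFinM lee_fin; apply: eq_ler.
  have -> : r `^ (- (d%:R + k)) =
      (2 / c) `^ (- ((d%:R + k) / d%:R)) * a `^ (- ((d%:R + k) / d%:R)).
    rewrite -powRM ?divr_ge0 ?(ltW a0) ?(ltW c0)// /r -powRrM.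
    by congr (_ `^ _); [ring|field; rewrite gt_eqF].
  rewrite -mulrA; congr (_ * _).
  rewrite -[X in _ = _ * X]powRr1 ?(ltW a0)// -powRD; last first.
    by rewrite (gt_eqF a0) implybT.
  by congr (_ `^ _); field; rewrite gt_eqF.
have m1 (f : X -> R) : measurable_fun [set: X] f ->
    measurable_fun Om (fun y => (f y)%:E).
  by move=> mf; apply/measurable_EFinP; exact: measurable_funS mf.
have mk : measurable_fun [set: X] (fun y => enorm (x - y) `^ (- (d%:R + k))).
  apply: (measurableT_comp (measurable_powR _)).
  by under eq_fun do rewrite enormB; exact: measurable_enorm_sub.
apply: ge0_le_integral => //.
- by move=> y _; rewrite lee_fin mulr_ge0 ?powR_ge0.
- by apply: m1; apply: measurable_funM => //; exact: measurable_indic.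
- apply: m1; apply: measurable_funM => //; apply: measurable_indic.
  exact: measurableC.
move=> y Oy; rewrite lee_fin !indicE.
have [|] := boolP (y \in S); last by rewrite mulr0 mulr_ge0 ?powR_ge0.
rewrite inE => -[[_ yr] yE]; rewrite mem_set// !mulr1 !powRN.
have xy : 0 < enorm (x - y).
  rewrite lt_neqAle enorm_ge0 andbT eq_sym; apply/eqP => /enorm0_eq0/subr0_eq xy.
  by apply: yE; rewrite -xy.
rewrite lef_pV2 ?posrE ?powR_gt0//.
rewrite ge0_ler_powR ?nnegrE ?addr_ge0 ?(ltW xy) ?(ltW r_gt0) ?(ltW dR)//.
by rewrite enormB ltW.
Qed.


Lemma ex_dyadic_scale (L t : R) : 0 < L -> L < t ->
  exists i, L * 2 ^+ i < t <= L * 2 ^+ i.+1.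
Proof.
move=> L0 Lt.
have ex : exists i, t <= L * 2 ^+ i.
  exists (Num.truncn (t / L)).+1; rewrite mulrC -ler_pdivrMr//.
  rewrite (le_trans (ltW (truncnS_gt _)))// -natrX ler_nat.
  exact/ltnW/ltn_expl.
case: (ex_minnP ex) => -[|i] ti mini; first by move: ti; rewrite expr0 mulr1 leNgt Lt.
exists i; rewrite ti andbT ltNge; apply/negP => /mini.
by rewrite ltnn.
Qed.

(* With A_i = {|u| > L 2^i} and a_i = |A_i|, testing the seminorm on A_(i+1) and
   the complement of A_i gives [2^(ip) a_(i+1) a_i^(-k/d) <= g_i] with
   [sum g_i] bounded, that is [x_(i+1) <= C x_i^(k/d) g_i] for
   [x_i = 2^(iq) a_i]; a sequence satisfying this is summable. *)
Theorem sobolev_embedding (Om : set X) (c r0 p : R) (k : nat) :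
  measurable Om -> 0 < c -> 0 < r0 -> (0 < k < d)%N -> 0 < p ->
  (forall x r, Om x -> 0 < r <= r0 ->
    ((c * r ^+ d)%:E <= mu (Om `&` eball x r))%E) ->
  exists2 M : R, 0 < M & forall u, sobolev_unit_ball p (d%:R + k%:R) Om u ->
    (\int[mu]_(x in Om) (`|u x| `^ (d%:R * p / (d%:R - k%:R)))%:E <= M%:E)%E.
Proof.
move=> mOm c0 r00 /andP[k0 kd] p0 dens.
set D := d%:R + k%:R; set q := d%:R * p / (d%:R - k%:R).
have d0 : (0 < d)%N by exact: leq_ltn_trans kd.
have dR : 0 < d%:R :> R by rewrite ltr0n.
have kR : 0 < k%:R :> R by rewrite ltr0n.
have dkR : 0 < d%:R - k%:R :> R by rewrite subr_gt0 ltr_nat.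
pose sg : R := k%:R / d%:R.
have sg01 : 0 <= sg < 1.
  by rewrite /sg divr_ge0//= ltr_pdivrMr// mul1r ltr_nat.
(* This identity singles out the Sobolev exponent: it balances the powers of 2 in the recursion for
   x_i. *)
have qsg : q * sg + p = q by rewrite /q /sg; field; rewrite !gt_eqF.
have q0 : 0 < q by rewrite divr_gt0// mulr_gt0.
have pq : p <= q by rewrite -qsg lerDr mulr_ge0 ?(ltW q0)//; case/andP: sg01.
(* By Chebyshev's inequality a_0 <= L^(-p) = 1 / (1 + 1/eta), which is below both 1 and eta: the
   first bounds x_0, the second is the smallness 2 a <= c r0^d required by [integral_outside_ge]. *)
pose eta := c * r0 ^+ d / 2.
have eta0 : 0 < eta by rewrite !mulr_gt0// exprn_gt0.
pose L := (1 + eta^-1) `^ p^-1.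
have Lp : L `^ p = 1 + eta^-1.
  by rewrite -powRrM mulVf ?gt_eqF// powRr1// addr_ge0// invr_ge0 ltW.
have L1 : 1 <= L.
  rewrite -[leLHS](powRr0 (1 + eta^-1)) ler_powR ?invr_ge0 ?(ltW p0)//.
  by rewrite lerDl invr_ge0 ltW.
have L0 : 0 < L by exact: lt_le_trans L1.
have eta1 : 0 < 1 + eta^-1 by rewrite addr_gt0// invr_gt0.
have Lp0 : 0 < L `^ p by rewrite Lp.
pose r : R := 2 `^ p.
have r1 : 1 < r.
  by rewrite /r -[ltLHS](powRr0 2) /powR gt_eqF// ltr_expR ltr_pM2r// ln_gt0// ltr1n.
have r_gt0 : 0 < r by exact: lt_trans r1.
pose K := r / (r - 1).
have K0 : 0 < K by rewrite divr_gt0 ?subr_gt0.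
pose c1 := (2 / c) `^ (- (D / d%:R)).
have c10 : 0 < c1 by rewrite powR_gt0// divr_gt0.
pose Q : R := 2 `^ q.
have Q0 : 0 < Q by rewrite powR_gt0.
have [M M0 HM] := @sublinear_recursion_sum R Q (K / c1) sg 1 (ltW Q0)
  (divr_ge0 (ltW K0) (ltW c10)) ler01 sg01.
exists (L `^ (q - p) + (2 * L) `^ q * M).
  apply: addr_gt0; first exact: powR_gt0.
  by rewrite mulr_gt0// powR_gt0// mulr_gt0.
move=> u [mf Np Ng].
have mD (f : X -> R) : measurable_fun [set: X] f ->
    measurable_fun Om (fun y => (f y)%:E).
  by move=> mf'; apply/measurable_EFinP; exact: measurable_funS mf'.
have mup : measurable_fun [set: X] (fun x => `|u x| `^ p).
  exact: measurable_abs_powR.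
pose A i := Om `&` [set x | L * 2 ^+ i < `|u x|].
have mA i : measurable (A i).
  apply: measurableI => //; rewrite -[X in measurable X]setTI.
  have := (measurableT_comp (@normr_measurable R setT) mf) measurableT
    `]L * 2 ^+ i, +oo[%classic (measurable_itv _).
  by congr (measurable (_ `&` _)); apply/seteqP; split => x /=; rewrite in_itv/= andbT.
have AOm i : A i `<=` Om by move=> x [].
have Adec i : A i.+1 `<=` A i.
  move=> x [Ox xi]; split=> //=; apply: le_lt_trans xi.
  by rewrite exprS ler_wpM2l ?(ltW L0)// ler_peMl ?exprn_ge0// ler1n.
have A0 i : A i `<=` A 0%N by elim: i => // i IH x /Adec; exact: IH.
have markov i : (mu (A i) <= ((L `^ p)^-1)%:E)%E.
  apply: (@le_trans _ _ (mu (A 0%N))); first by rewrite le_measure ?inE//.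
  rewrite -[leRHS]mule1 lee_pdivlMl//.
  apply: le_trans Np; rewrite -(@integral_Zindic _ _ Om mOm)// ?powR_ge0//.
  apply: ge0_le_integral => //.
  - by move=> x _; rewrite lee_fin mulr_ge0 ?powR_ge0.
  - by apply: mD; apply: measurable_funM => //; exact: measurable_indic.
  - exact: mD.
  move=> x Ox; rewrite lee_fin indicE; have [|_] := boolP (x \in A 0%N).
    rewrite inE => -[_ /=]; rewrite expr0 mulr1 => xL.
    by rewrite mulr1 ge0_ler_powR ?nnegrE ?(ltW p0) ?(ltW L0)// ltW.
  by rewrite mulr0 powR_ge0.
pose a i := fine (mu (A i)).
have muA i : mu (A i) = (a i)%:E.
  by rewrite fineK// ge0_fin_numE// (le_lt_trans (markov i))// ltry.
have a_ge0 i : 0 <= a i by rewrite fine_ge0.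
have aL i : a i <= (1 + eta^-1)^-1 by rewrite -lee_fin -muA -Lp.
have a1 i : a i <= 1.
  by rewrite (le_trans (aL i))// invf_le1// lerDl invr_ge0 ltW.
have aeta i : 2 * a i <= c * r0 ^+ d.
  have : a i <= eta; last by rewrite /eta; lra.
  rewrite (le_trans (aL i))// -[leRHS]invrK lef_pV2 ?posrE ?addr_gt0 ?invr_gt0//.
  by rewrite lerDr.
have adec i : a i.+1 <= a i by rewrite -lee_fin -!muA le_measure ?inE.
pose g i := r ^+ i * a i.+1 * a i `^ (- sg).
have g0 i : 0 <= g i by rewrite !mulr_ge0 ?exprn_ge0 ?powR_ge0 ?(ltW r_gt0).
have gB n : \sum_(i < n) g i <= K / c1.
  rewrite ler_pdivlMr// mulrC mulr_sumr -lee_fin -sumEFin.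
  pose h i z := r ^+ i * (\1_(A i.+1) z.1 *
    (enorm (z.1 - z.2) `^ (- D) * \1_(~` A i) z.2)).
  have mh2 i : measurable_fun [set: X * X]
      (fun z => enorm (z.1 - z.2) `^ (- D) * \1_(~` A i) z.2).
    apply: measurable_funM.
      by apply: (measurableT_comp (measurable_powR _)); exact: measurable_enorm2.
    apply: (@measurableT_comp _ _ _ _ _ _ (\1_(~` A i) : X -> R) _ snd) => //.
    by apply: measurable_indic; exact: measurableC.
  have mh i : measurable_fun [set: X * X] (h i).
    apply: measurable_funM => //; apply: measurable_funM => //.
    by apply: (@measurableT_comp _ _ _ _ _ _ (\1_(A i.+1) : X -> R) _ fst).
  have h0 i z : 0 <= h i z by rewrite !mulr_ge0 ?exprn_ge0 ?powR_ge0 ?(ltW r_gt0).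
  (* If |u x| > L 2^(i+1) and |u y| <= L 2^i, then |u x - u y| > L 2^i >= 2^i. Only such levels i
     contribute, and their weights 2^(ip) sum to a multiple of |u x - u y|^p. *)
  have hH z : Om z.1 -> Om z.2 -> \sum_(i < n) h i z <= K * gagliardo_kernel p D u z.
    case: z => x y /= Ox Oy; rewrite /gagliardo_kernel/=.
    apply: (@le_trans _ _ ((\sum_(i < n | 2 ^+ i <= `|u x - u y|) r ^+ i) *
        enorm (x - y) `^ (- D))).
      rewrite [X in _ <= X * _]big_mkcond/= mulr_suml ler_sum// => i _.
      rewrite /h/= !indicE in_setC; case: (boolP (x \in A i.+1)) => xA; last first.
        by rewrite mul0r mulr0 mulr_ge0 ?powR_ge0//; case: ifP => // _; rewrite exprn_ge0// ltW.
      case: (boolP (y \in A i)) => yA /=.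
        by rewrite !mulr0 mulr_ge0 ?powR_ge0//; case: ifP => // _; rewrite exprn_ge0// ltW.
      rewrite mul1r mulr1 ifT// (@le_trans _ _ (L * 2 ^+ i))//.
        by rewrite ler_peMl ?exprn_ge0.
      move: xA yA; rewrite inE notin_setE => -[_ /= xA] yA.
      have {}yA : `|u y| <= L * 2 ^+ i.
        by rewrite leNgt; apply/negP => yA'; apply: yA; split.
      rewrite (le_trans _ (lerB_dist _ _))// lerBrDr; move: xA.
      by rewrite exprS; lra.
    rewrite powRN mulrA ler_wpM2r ?invr_ge0 ?powR_ge0//.
    exact: dyadic_sum_le.
  have := sum_double_integral_le mOm mh h0 (measurable_gagliardo_kernel p D mf)
    (gagliardo_kernel_ge0 p D u) (ltW K0) hH.
  move=> /le_trans; move=> /(_ K%:E) hK.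
  apply: le_trans (hK _); last first.
    by rewrite -[leRHS]mule1 lee_wpmul2l// lee_fin ltW.
  apply: lee_sum => i _.
  rewrite (_ : c1 * g i = r ^+ i * c1 * a i `^ (- sg) * a i.+1); last by rewrite /g; ring.
  rewrite EFinM -muA -(@integral_Zindic _ _ Om mOm)//; last first.
    by rewrite !mulr_ge0 ?exprn_ge0 ?powR_ge0 ?(ltW r_gt0) ?(ltW c10).
  apply: ge0_le_integral => //.
  - by move=> x _; rewrite lee_fin !mulr_ge0 ?exprn_ge0 ?powR_ge0 ?(ltW r_gt0) ?(ltW c10).
  - by apply: mD; apply: measurable_funM => //; exact: measurable_indic.
  - by apply: measurable_funS (measurable_inner_integral mOm (mh i) (h0 i)).
  move=> x Ox; rewrite indicE; have [|_] := boolP (x \in A i.+1); last first.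
    by rewrite mulr0 integral_ge0// => y _; rewrite lee_fin.
  rewrite inE mulr1 => xA.
  have [ai0|ai0] := eqVneq (a i) 0.
    (* Here 0 to any nonzero power is 0, even a negative one, so the left side vanishes. *)
    rewrite ai0 powR0 ?mulr0; last by rewrite oppr_eq0 gt_eqF// divr_gt0.
    by apply: integral_ge0 => y _; rewrite lee_fin.
  have aip : 0 < a i by rewrite lt_neqAle eq_sym ai0 a_ge0.
  have xAi := Adec _ _ xA.
  have := integral_outside_ge mOm (mA i) c0 r00 (ltW kR) d0
    (fun r => dens x r Ox) (muA i) aip (aeta i) xAi.
  rewrite -/D -/sg -/c1 => H.
  rewrite -mulrA EFinM (le_trans (lee_wpmul2l _ H))//.
    by rewrite lee_fin exprn_ge0// ltW.
  rewrite -ge0_integralZl_EFin ?exprn_ge0 ?(ltW r_gt0)//; last 2 first.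
  - by move=> y _; rewrite lee_fin mulr_ge0 ?powR_ge0.
  - apply/measurable_EFinP; apply: measurable_funS (measurableT) (@subsetT _ _) _.
    exact: (measurableT_comp (mh2 i) (measurable_pair1 x)).
  rewrite (@eq_integral _ _ _ _ _ (fun y => (h i (x, y))%:E))// => y _.
  by rewrite /h/= [\1_(A i.+1) x]indicE (mem_set xA) mul1r EFinM.
have xrec i : Q ^+ i.+1 * a i.+1 <= Q * (Q ^+ i * a i) `^ sg * g i.
  have [ai0|ai0] := eqVneq (a i) 0.
    have -> : a i.+1 = 0 by apply/eqP; rewrite eq_le a_ge0 andbT -ai0.
    by rewrite mulr0 mulr_ge0// mulr_ge0 ?powR_ge0// ltW.
  have aip : 0 < a i by rewrite lt_neqAle eq_sym ai0 a_ge0.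
  apply: eq_ler; rewrite powRM ?exprn_ge0 ?(ltW Q0)// /g powRN.
  have E : (Q ^+ i) `^ sg * r ^+ i = Q ^+ i.
    rewrite -!powR_mulrn ?(ltW Q0) ?(ltW r_gt0)// powRAC -powRM ?powR_ge0//.
    congr (_ `^ _); rewrite /Q /r -powRrM -powRD ?qsg//.
    by rewrite pnatr_eq0 implybT.
  by rewrite exprS -[in LHS]E; field; rewrite gt_eqF ?powR_gt0.
have x0 i : 0 <= Q ^+ i * a i by rewrite mulr_ge0 ?exprn_ge0// ltW.
have xM := HM (fun i => Q ^+ i * a i) g x0 g0 _ gB xrec.
have {}xM n : \sum_(i < n) Q ^+ i * a i <= M by apply: xM; rewrite expr0 mul1r.
have W0 : 0 <= (2 * L) `^ q by exact: powR_ge0.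
(* The factor is (L 2^(i+1))^q, which bounds |u|^q on the layer L 2^i < |u| <= L 2^(i+1). Where |u|
   <= L, the bound L^(q-p) |u|^p is used instead. *)
pose f i x := (2 * L) `^ q * Q ^+ i * \1_(A i) x.
have f0 i x : 0 <= f i x by rewrite !mulr_ge0 ?exprn_ge0// ltW.
have mfi i : measurable_fun [set: X] (f i).
  by apply: measurable_funM => //; exact: measurable_indic.
apply: (@le_trans _ _ (\int[mu]_(x in Om) ((L `^ (q - p) * `|u x| `^ p)%:E +
    \sum_(i <oo) (f i x)%:E))%E).
  apply: ge0_le_integral => //.
  - by apply: mD; exact: measurable_abs_powR.
  - apply: emeasurable_funD; first by apply: mD; exact: measurable_funM.
    by apply: ge0_emeasurable_sum => [i x _ _|i _]; rewrite ?lee_fin//; exact: mD.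
  move=> x Ox; have fx i : (0 <= (f i x)%:E)%E by rewrite lee_fin.
  have [uL|uL] := leP `|u x| L.
    rewrite -[leLHS]adde0 leeD ?nneseries_ge0// lee_fin.
    rewrite -[in leLHS](subrK p q) powRD; last first.
      by rewrite subrK (gt_eqF q0).
    by rewrite ler_wpM2r ?powR_ge0// ge0_ler_powR ?nnegrE ?subr_ge0 ?(ltW L0).
  have [i /andP[i1 i2]] := ex_dyadic_scale L0 uL.
  rewrite -[leLHS]add0e leeD ?lee_fin ?mulr_ge0 ?powR_ge0//.
  apply: le_trans (nneseries_ge_term i fx); rewrite lee_fin /f indicE mem_set//.
  rewrite mulr1 /Q -powR_mulrn ?powR_ge0// powRAC powR_mulrn// -powRM ?exprn_ge0//; last first.
    by rewrite mulr_ge0 ?(ltW L0).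
  rewrite ge0_ler_powR ?(ltW q0) ?nnegrE//.
    by rewrite !mulr_ge0 ?exprn_ge0 ?(ltW L0).
  by rewrite (le_trans i2)// exprS mulrA (mulrC L).
rewrite ge0_integralD//=; last 4 first.
- by move=> x _; rewrite lee_fin mulr_ge0 ?powR_ge0.
- by apply: mD; exact: measurable_funM.
- by move=> x _; apply: nneseries_ge0 => i _ _; rewrite lee_fin.
- by apply: ge0_emeasurable_sum => [i x _ _|i _]; rewrite ?lee_fin//; exact: mD.
rewrite EFinD leeD//.
  under eq_integral do rewrite EFinM.
  rewrite ge0_integralZl_EFin ?powR_ge0//; last exact: mD.
  by rewrite -[leRHS]mule1 lee_wpmul2l// lee_fin powR_ge0.
rewrite integral_nneseries//; last first.
- by move=> i x _; rewrite lee_fin.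
- by move=> i; exact: mD.
apply: nneseries_le_ub => [i|n].
  by apply: integral_ge0 => x _; rewrite lee_fin.
under eq_bigr => i _.
  rewrite integral_Zindic ?mulr_ge0 ?exprn_ge0 ?(ltW Q0)// muA -EFinM -mulrA.
  over.
by rewrite sumEFin lee_fin -mulr_sumr ler_wpM2l.
Qed.

End FractionalSobolevInequality.

(** * Hardy inequalities on dyadic tubes *)

Section TreeRecursions.
Context {R : realType}.
Variables (I : nat -> finType) (par : forall j, I j.+1 -> I j) (n : nat).
Hypothesis par_fiber : forall j (m : I j),
  (#|[pred m' | par m' == m]| <= n)%N.
Variables (p C B A : R).
Hypotheses (p1 : 1 < p) (C0 : 0 <= C) (n1 : (1 < n)%N).

Lemma sum_par_le j (f : I j -> R) : (forall m, 0 <= f m) ->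
  \sum_m f (par m) <= n%:R * \sum_m f m.
Proof.
move=> f0; rewrite (partition_big (@par j) predT)//= mulr_sumr ler_sum// => m _.
rewrite (eq_bigr (fun=> f m)); last by move=> i /eqP ->.
by rewrite sumr_const -[leLHS]mulr_natl ler_wpM2r// ler_nat par_fiber.
Qed.

(** An abstract form of the estimates on cells: y is a mean already divided by n^j, whence the
    factor 1/n, and o is the energy attached to a child. The recursion is assumed for every t,
    because the two theorems below choose t differently. *)
Definition tree_recursion (y : forall j, I j -> R) (o : forall j, I j.+1 -> R)
    (oo : nat -> R) : Prop :=
  [/\ (forall j m, 0 <= y j m) /\ (forall j m, 0 <= o j m),
      forall j (m : I j.+1) (t : R), 0 < t < 1 -> y j.+1 m <=
        n%:R^-1 * (1 - t) `^ (1 - p) * y j (par m) + C * t `^ (1 - p) * o j m,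
      forall j, \sum_m o j m <= oo j,
      forall N, \sum_(j < N) oo j <= B &
      \sum_m y 0%N m <= A].

Let nR : 0 < n%:R :> R.
Proof. by rewrite ltr0n ltnW. Qed.

(** Summed over a generation, the n children of a parent cancel the factor 1/n, and what remains is
    the scalar recursion of [discrete_hardy]. *)
Lemma tree_hardy : exists2 H : R, 0 < H & forall y o oo,
  tree_recursion y o oo ->
  forall N, \sum_(j < N) j.+1%:R `^ (- p) * \sum_m y j m <= H.
Proof.
pose K := (p - 1) / (4 * p).
have K0 : 0 < K by rewrite divr_gt0 ?subr_gt0// mulr_gt0// (lt_trans _ p1).
exists ((`|A| + C * 2^-1 `^ (1 - p) * `|B|) / K + 1).
  by rewrite ltr_wpDl// divr_ge0 ?(ltW K0)// addr_ge0// !mulr_ge0 ?powR_ge0.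
move=> y o oo [[y0 o0] yrec oo_le ooB yA] N.
have oo0 j : 0 <= oo j by apply: le_trans (oo_le j); exact: sumr_ge0.
have a0 j : 0 <= \sum_m y j m by exact: sumr_ge0.
have step j (t : R) : 0 < t < 1 -> \sum_m y j.+1 m <=
    (1 - t) `^ (1 - p) * (\sum_m y j m) + C * t `^ (1 - p) * oo j.
  move=> t01; rewrite (le_trans (ler_sum _ (fun m _ => yrec j m t t01)))//.
  rewrite big_split/= -!mulr_sumr lerD//; last by rewrite ler_wpM2l ?mulr_ge0 ?powR_ge0.
  rewrite -[leLHS]mulrA [leLHS]mulrCA ler_wpM2l ?powR_ge0//.
  by rewrite mulrC ler_pdivrMr// mulrC; exact: sum_par_le.
have := discrete_hardy p1 C0 a0 oo0 step N.
rewrite -/K mulrC -ler_pdivlMr// => /le_trans; apply.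
rewrite ler_wpDr// ler_wpM2r ?invr_ge0 ?(ltW K0)// lerD//.
  by rewrite (le_trans yA)// ler_norm.
by rewrite ler_wpM2l ?mulr_ge0 ?powR_ge0// (le_trans (ooB N))// ler_norm.
Qed.

(** After raising to the power q, a child carries n^(-q) and the n children n^(1 - q) < 1. This gain
    is large enough to pay for a fixed t and for the power of a sum. *)
Lemma tree_contraction (q : R) : 1 < q -> exists2 H : R, 0 < H &
  forall y o oo, tree_recursion y o oo ->
  forall N, \sum_(j < N) \sum_m y j m `^ q <= H.
Proof.
move=> q1; have q0 : 0 < q by exact: lt_trans q1.
(* A factor s is spent twice: on (1 - t)^(1 - p) = s, which defines t, and on absorbing the
   oscillation into the main term. The exponent leaves the contraction factor k = n (s^2 / n)^q =
   n^(-(q - 1) / 2). *)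
pose s : R := n%:R `^ ((q - 1) / (4 * q)).
have e0 : 0 < (q - 1) / (4 * q) by rewrite divr_gt0 ?subr_gt0// mulr_gt0.
have n1R : 1 < n%:R :> R by rewrite ltr1n.
have powR_gt1 (a b : R) : 1 < a -> 0 < b -> 1 < a `^ b.
  move=> a1 b0; rewrite -[ltLHS](powRr0 a) /powR gt_eqF ?(lt_trans _ a1)//.
  by rewrite ltr_expR ltr_pM2r// ln_gt0.
have s1 : 1 < s by exact: powR_gt1.
have s0 : 0 < s by exact: lt_trans s1.
pose t := 1 - s `^ (1 - p)^-1.
have p10 : 1 - p < 0 by rewrite subr_lt0.
have t01 : 0 < t < 1.
  rewrite /t subr_gt0 gtrBl powR_gt0// andbT.
  rewrite -[ltRHS]invr1 -[X in X < _]invrK ltf_pV2 ?posrE ?invr_gt0 ?powR_gt0//.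
  by rewrite -powRN; apply: powR_gt1 => //; rewrite -invrN invr_gt0 opprB subr_gt0.
have ts : (1 - t) `^ (1 - p) = s.
  rewrite /t opprB addrCA subrr addr0 -powRrM mulVf ?powRr1 ?(ltW s0)//.
  by rewrite lt_eqF.
pose k := n%:R * (s ^+ 2 / n%:R) `^ q.
have k1 : k < 1.
  have -> : k = n%:R `^ (- ((q - 1) / 2)).
    have sE : s ^+ 2 = n%:R `^ ((q - 1) / (2 * q)).
      rewrite -powR_mulrn ?(ltW s0)// /s -powRrM.
      by congr (_ `^ _); field; rewrite gt_eqF.
    rewrite /k sE -(powR_inv1 (ltW nR)) -powRD; last by rewrite (gt_eqF nR) implybT.
    rewrite -powRrM -[X in X * _](powRr1 (ltW nR)) -powRD; last first.
      by rewrite (gt_eqF nR) implybT.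
    by congr (_ `^ _); field; rewrite gt_eqF.
  rewrite powRN invf_lt1 ?powR_gt0//; apply: powR_gt1 => //.
  by rewrite divr_gt0 ?subr_gt0.
pose W := (1 + (s - 1)^-1) * (C * t `^ (1 - p)).
have W0 : 0 <= W.
  by rewrite !mulr_ge0 ?powR_ge0// addr_ge0// invr_ge0 subr_ge0 ltW.
(* From o^q = o o^(q - 1) <= B^(q - 1) o: the source stays linear in o, hence summable, at the price
   of the absolute bound B. *)
pose K := W `^ q * `|B| `^ (q - 1).
have K0 : 0 <= K by rewrite mulr_ge0 ?powR_ge0.
exists ((`|A| `^ q * #|I 0%N|%:R + K * `|B|) / (1 - k) + 1).
  by rewrite ltr_wpDl// divr_ge0 ?subr_ge0 ?(ltW k1)// addr_ge0 ?mulr_ge0 ?powR_ge0.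
move=> y o oo [[y0 o0] yrec oo_le ooB yA] N.
have oo0 j : 0 <= oo j by apply: le_trans (oo_le j); exact: sumr_ge0.
have ooB1 j : oo j <= B.
  by apply: le_trans (ooB j.+1); rewrite big_ord_recr/= lerDr sumr_ge0.
have oB j m : o j m <= B.
  apply: le_trans (ooB1 j); apply: le_trans (oo_le j).
  by rewrite (bigD1 m)//= lerDl sumr_ge0.
have step j m : y j.+1 m `^ q <= (s ^+ 2 / n%:R) `^ q * y j (par m) `^ q + K * o j m.
  have := yrec j m t t01; rewrite ts.
  set a := n%:R^-1 * s * y j (par m); set b := C * t `^ (1 - p) * o j m.
  have a0 : 0 <= a by rewrite !mulr_ge0 ?invr_ge0 ?(ltW nR) ?(ltW s0).
  have b0 : 0 <= b by rewrite !mulr_ge0 ?powR_ge0.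
  move=> yab.
  (* Either b <= (s - 1) a and a + b <= s a, or a < b / (s - 1) and a + b is at most a multiple of
     b. Taking the larger term avoids a constant in front of the main one, which would ruin the
     contraction. *)
  have y_le : y j.+1 m <= s * a \/ y j.+1 m <= W * o j m.
    have [ab|ab] := leP b ((s - 1) * a); [left|right].
      by rewrite (le_trans yab)//; move: ab; lra.
    rewrite (le_trans yab)// /W -mulrA -/b mulrDl mul1r addrC lerD2l.
    by rewrite mulrC ler_pdivlMr ?subr_gt0// mulrC ltW.
  case: y_le => h.
    apply: ler_wpDr; first exact: mulr_ge0.
    have sn0 : 0 <= s ^+ 2 / n%:R by rewrite divr_ge0 ?exprn_ge0 ?(ltW s0) ?(ltW nR).
    rewrite -(powRM _ sn0 (y0 _ _)).
    apply: ge0_ler_powR; rewrite ?nnegrE ?(ltW q0)//; first exact: mulr_ge0.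
    by rewrite (le_trans h)// /a; apply: eq_ler; ring.
  apply: ler_wpDl; first by rewrite mulr_ge0 ?powR_ge0.
  apply: (@le_trans _ _ ((W * o j m) `^ q)).
    by apply: ge0_ler_powR; rewrite ?nnegrE ?(ltW q0)//; exact: mulr_ge0.
  rewrite powRM// /K -mulrA ler_wpM2l ?powR_ge0// mulrC -(mulr_powRB1 (o0 _ _) q0).
  rewrite ler_wpM2l// ge0_ler_powR ?nnegrE ?subr_ge0 ?(ltW q1)//.
  by rewrite (le_trans (oB j m))// ler_norm.
pose Y j := \sum_m y j m `^ q.
have Y0 j : 0 <= Y j by apply: sumr_ge0 => m _; exact: powR_ge0.
have Ystep j : Y j.+1 <= k * Y j + K * oo j.
  rewrite /Y (le_trans (ler_sum _ (fun m _ => step j m)))// big_split/= lerD//.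
    rewrite -mulr_sumr /k -[leRHS]mulrA [leRHS]mulrCA ler_wpM2l ?powR_ge0//.
    by apply: (sum_par_le (f := fun m => y j m `^ q)) => m; exact: powR_ge0.
  by rewrite -mulr_sumr ler_wpM2l.
have := contraction_sum Y0 Ystep N.
rewrite -mulr_sumr => h.
suff : (1 - k) * (\sum_(j < N) Y j) <= `|A| `^ q * #|I 0%N|%:R + K * `|B|.
  rewrite mulrC -ler_pdivlMr ?subr_gt0// => /le_trans; apply.
  by rewrite lerDl.
rewrite (le_trans h)// lerD//; last first.
  by rewrite ler_wpM2l// (le_trans (ooB N))// ler_norm.
rewrite /Y mulr_natr -sumr_const ler_sum// => m _.
rewrite ge0_ler_powR ?(ltW q0) ?nnegrE// (le_trans _ (ler_norm A))//.
by rewrite (le_trans _ yA)// (bigD1 m)//= lerDl sumr_ge0.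
Qed.

End TreeRecursions.

(** The power of L is affine in the exponent of x, so replacing x by L^(-e) x reduces the claim to
    x^q <= x^p + x^r. *)
Lemma powR_interpolate {R : realType} (L x p q r a e : R) : 0 < L -> 0 <= x ->
  0 < p -> p <= q <= r ->
  L `^ (a - e * q) * x `^ q <= L `^ (a - e * p) * x `^ p + L `^ (a - e * r) * x `^ r.
Proof.
move=> L0 x0 p0 pqr.
have E b : L `^ (a - e * b) * x `^ b = L `^ a * (L `^ (- e) * x) `^ b.
  rewrite powRM ?powR_ge0// -powRrM mulrA -powRD; last by rewrite (gt_eqF L0) implybT.
  by rewrite mulNr.
rewrite (E q) (E p) (E r) -mulrDr ler_wpM2l ?powR_ge0//.
by apply: powR_le_maxD => //; rewrite mulr_ge0 ?powR_ge0.
Qed.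

(** * Cells, means and local energies *)

Section DyadicTubes.
Context {R : realType} {d : nat}.
Local Notation X := 'rV[R]_d.
Local Notation mu := (@leb R d).

(* The cells of generation j look like cubes of side 2^-j in R^d, but a cell has
   only 2^(d - k) children: they are nested around a set of dimension d - k. *)
Record dyadic_tube (Om : set X) (k : nat) := DyadicTube {
  idx : nat -> finType ;
  par : forall j, idx j.+1 -> idx j ;
  cell : forall j, idx j -> set X ;
  clo : R ; cup : R ; cdiam : R ;
  clo_gt0 : 0 < clo ; cup_gt0 : 0 < cup ; cdiam_gt0 : 0 < cdiam ;
  par_fiber : forall j (m : idx j),
    (#|[pred m' | par m' == m]| <= 2 ^ (d - k))%N ;
  measurable_cell : forall j (m : idx j), measurable (cell m) ;
  cell_sub : forall j (m : idx j), cell m `<=` Om ;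
  cell_nested : forall j (m : idx j.+1), cell m `<=` cell (par m) ;
  cell_disjoint : forall j (m m' : idx j) x, cell m x -> cell m' x -> m = m' ;
  leb_cell_ge : forall j (m : idx j),
    ((clo / (2 ^+ d) ^+ j)%:E <= mu (cell m))%E ;
  leb_cell_le : forall j (m : idx j),
    (mu (cell m) <= (cup / (2 ^+ d) ^+ j)%:E)%E ;
  cell_diam : forall j (m : idx j) x y, cell m x -> cell m y ->
    enorm (x - y) * 2 ^+ j <= cdiam }.

Section TubeEstimates.
Variables (Om : set X) (k : nat) (T : dyadic_tube Om k) (p : R).
Hypotheses (mOm : measurable Om) (kd : (0 < k < d)%N) (p1 : 1 < p).
Local Notation D := (d%:R + k%:R : R).
Implicit Types (u : X -> R).

Let p0 : 0 < p. Proof. exact: lt_trans p1. Qed.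
Let clo0 := clo_gt0 T.

(** The truncation at distance [cdiam] 2^-j keeps every y in the same cell of generation j as x, yet
    the expression does not mention the cell. *)
Definition local_energy u j (x : X) : \bar R :=
  (\int[mu]_(y in Om) (`|u x - u y| `^ p * \1_(near_diag (cdiam T) j) (x, y))%:E)%E.

Definition cell_measure j (m : idx T j) : R := fine (mu (cell m)).

Definition cell_mean u j (m : idx T j) : R :=
  fine (\int[mu]_(x in cell m) (`|u x| `^ p)%:E) / cell_measure m.

Let dj0 j : 0 < (2 ^+ d) ^+ j :> R. Proof. by rewrite !exprn_gt0. Qed.

Let muE j (m : idx T j) : mu (cell m) = (cell_measure m)%:E.
Proof.
rewrite fineK// ge0_fin_numE//.
by rewrite (le_lt_trans (leb_cell_le m))// ltry.
Qed.

Let e_ge j (m : idx T j) : clo T / (2 ^+ d) ^+ j <= cell_measure m.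
Proof. by rewrite -lee_fin -muE leb_cell_ge. Qed.

Let e_gt0 j (m : idx T j) : 0 < cell_measure m.
Proof. by apply: lt_le_trans (e_ge m); rewrite divr_gt0. Qed.

Lemma local_energy_ge0 u j x : (0 <= local_energy u j x)%E.
Proof. by apply: integral_ge0 => y _; rewrite lee_fin mulr_ge0 ?powR_ge0. Qed.

Section UnitBall.
Variable u : X -> R.
Hypothesis hu : sobolev_unit_ball p D Om u.

Let mu_ : measurable_fun [set: X] u. Proof. by case: hu. Qed.

Let mup (A : set X) : measurable_fun A (fun x => (`|u x| `^ p)%:E).
Proof.
apply/measurable_EFinP; apply: measurable_funS (measurable_abs_powR p mu_) => //.
Qed.

Let mker j : measurable_fun [set: X * X]
  (fun z => `|u z.1 - u z.2| `^ p * \1_(near_diag (cdiam T) j) z).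
Proof.
apply: measurable_funM; last by apply: measurable_indic; exact: measurable_near_diag.
by apply: measurable_abs_powR; exact: measurable_diff.
Qed.

Let ker0 j z : 0 <= `|u z.1 - u z.2| `^ p * \1_(near_diag (cdiam T) j) z :> R.
Proof. by rewrite mulr_ge0 ?powR_ge0. Qed.

Lemma measurable_local_energy j (A : set X) : measurable_fun A (local_energy u j).
Proof.
apply: measurable_funS (measurable_inner_integral mOm (mker j) (ker0 j)) => //.
Qed.

Let UE j (m : idx T j) :
  (\int[mu]_(x in cell m) (`|u x| `^ p)%:E = (cell_mean u m * cell_measure m)%:E)%E.
Proof.
rewrite /cell_mean divfK ?gt_eqF// fineK// ge0_fin_numE.
  case: hu => _ + _; move=> h; apply: le_lt_trans (ltry 1); apply: le_trans h.
  apply: ge0_subset_integral => //; first exact: measurable_cell.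
  exact: cell_sub.
by apply: integral_ge0 => x _; rewrite lee_fin powR_ge0.
Qed.

Lemma cell_mean_ge0 j (m : idx T j) : 0 <= cell_mean u m.
Proof.
rewrite divr_ge0 ?(ltW (e_gt0 m))// fine_ge0//.
by apply: integral_ge0 => x _; rewrite lee_fin powR_ge0.
Qed.

Lemma cell_mean0_le (m : idx T 0) : cell_mean u m <= (clo T)^-1.
Proof.
have : cell_mean u m * cell_measure m <= 1.
  rewrite -lee_fin -UE; case: hu => _ + _; apply: le_trans.
  apply: ge0_subset_integral => //; first exact: measurable_cell.
  exact: cell_sub.
rewrite -ler_pdivlMr// mul1r => /le_trans; apply.
by rewrite lef_pV2 ?posrE// (le_trans _ (e_ge m))// expr0 divr1.
Qed.

(** The inequality |u x| <= |u y| + |u x - u y| is split by convexity and averaged over y in the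
    cell, whose diameter places (x, y) near the diagonal. *)
Lemma powR_le_cell_mean j (m : idx T j) x (t : R) : 0 < t < 1 -> cell m x ->
  ((`|u x| `^ p)%:E <= ((1 - t) `^ (1 - p) * cell_mean u m)%:E +
    (t `^ (1 - p) * (2 ^+ d) ^+ j / clo T)%:E * local_energy u j x)%E.
Proof.
move=> t01 mx; have [t0 t1] := andP t01.
set a := (1 - t) `^ (1 - p); set b := t `^ (1 - p).
have a0 : 0 <= a by exact: powR_ge0.
have b0 : 0 <= b by exact: powR_ge0.
have mE := measurable_cell m.
have msec : measurable_fun (cell m) (fun y => (`|u x - u y| `^ p)%:E).
  apply/measurable_EFinP; apply: (@measurable_funS _ _ _ _ [set: X]) => //.
  by apply: measurable_abs_powR; exact: measurable_funB.
have step : ((cell_measure m * `|u x| `^ p)%:E <=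
    (a * (cell_mean u m * cell_measure m))%:E + b%:E * local_energy u j x)%E.
  apply: (@le_trans _ _ (\int[mu]_(y in cell m)
      ((a%:E * (`|u y| `^ p)%:E) + (b%:E * (`|u x - u y| `^ p)%:E)))%E).
    rewrite mulrC EFinM -muE -integral_cst//.
    apply: ge0_le_integral => //.
    - by move=> y _; rewrite lee_fin powR_ge0.
    - by apply: emeasurable_funD; apply: measurable_funeM.
    move=> y _; rewrite -!EFinM -EFinD lee_fin.
    apply: le_trans (powRDsplit (ltW p1) t01 (normr_ge0 (u y)) (normr_ge0 (u x - u y))).
    rewrite ge0_ler_powR ?nnegrE ?addr_ge0 ?(ltW p0)//.
    by rewrite (le_trans _ (ler_normD _ _))// addrCA subrr addr0.
  rewrite ge0_integralD//=; last 4 first.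
  - by move=> y _; rewrite mule_ge0// lee_fin// powR_ge0.
  - exact: measurable_funeM.
  - by move=> y _; rewrite mule_ge0// lee_fin// powR_ge0.
  - exact: measurable_funeM.
  rewrite !ge0_integralZl_EFin//.
  rewrite UE -EFinM leeD// lee_wpmul2l//.
  rewrite (@eq_integral _ _ _ _ _
    (fun y => (`|u x - u y| `^ p * \1_(near_diag (cdiam T) j) (x, y))%:E)); last first.
    move=> y; rewrite inE => my; rewrite indicE mem_set ?mulr1//.
    exact: (cell_diam mx my).
  apply: ge0_subset_integral => //; last exact: cell_sub.
  apply/measurable_EFinP; apply: (@measurable_funS _ _ _ _ [set: X]) => //.
  exact: (measurableT_comp (mker j) (measurable_pair1 x)).
have e0 := e_gt0 m.
have [->|] := eqVneq (local_energy u j x) +oo%E.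
  rewrite gt0_muley ?addey ?leey// lte_fin !mulr_gt0 ?powR_gt0 ?invr_gt0//.
have := local_energy_ge0 u j x; move: step; case: (local_energy u j x) => // w.
rewrite lee_fin -!EFinM -!EFinD !lee_fin => step w0 _.
have : `|u x| `^ p <= a * cell_mean u m + b / cell_measure m * w.
  rewrite -(ler_pM2l e0) (le_trans step)//; apply: eq_ler; field.
  by rewrite gt_eqF.
move=> /le_trans; apply; rewrite lerD2l ler_wpM2r// -mulrA ler_wpM2l//.
rewrite -[leRHS]invrK lef_pV2 ?posrE ?invr_gt0 ?divr_gt0//.
by rewrite invf_div e_ge.
Qed.

(** A cell has measure about 2^(-jd), so this is comparable to 2^(jk) times the integral of |u|^p
    over the cell. *)
Definition tree_mean j (m : idx T j) : R :=
  cell_mean u m / ((2 ^ (d - k))%N%:R) ^+ j.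

(** The cell has generation j + 1 but the scale is that of its parent, since points of the child are
    compared with the mean over the parent. *)
Definition tree_energy j (m : idx T j.+1) : R :=
  (2 ^+ (d + k)) ^+ j * fine (\int[mu]_(x in cell m) local_energy u j x)%E.

Definition total_energy j : R :=
  (2 ^+ (d + k)) ^+ j * fine (\int[mu]_(x in Om) local_energy u j x)%E.

Lemma sum_disjoint_cells j (f : X -> \bar R) :
  measurable_fun Om f -> (forall x, 0 <= f x)%E ->
  (\sum_(m : idx T j) \int[mu]_(x in cell m) f x <= \int[mu]_(x in Om) f x)%E.
Proof.
move=> mf f0.
rewrite (eq_bigr (fun m => \int[mu]_(x in Om) (f \_ (cell m)) x)%E); last first.
  move=> m _; rewrite -integral_mkcondr; congr (integral _ _ _).
  by rewrite setIidr//; exact: cell_sub.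
have mfm m : measurable_fun Om (f \_ (cell (j := j) m)).
  apply/(measurable_restrict _ (measurable_cell m) mOm).
  by apply: measurable_funS mf => // x [].
have fm0 m x : (0 <= (f \_ (cell (j := j) m)) x)%E.
  by rewrite patchE; case: ifP.
rewrite -ge0_integral_sum//; apply: ge0_le_integral => //.
- by move=> x _; exact: sume_ge0.
- exact: emeasurable_sum.
move=> x Ox.
have [[m mx]|nx] := pselect (exists m : idx T j, cell m x).
  rewrite (bigD1 m)//= big1 ?adde0; first by rewrite patchE mem_set.
  move=> m' mm'; rewrite patchE memNset// => m'x.
  by move/eqP: mm'; apply; exact: cell_disjoint m'x mx.
rewrite big1// => m _; rewrite patchE memNset// => mx.
by apply: nx; exists m.
Qed.

(** The bound on partial sums forces each weighted energy to be finite, after which they can be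
    treated as a sequence of reals. *)
Lemma integral_local_energyE B :
  (forall n, (\sum_(j < n) \int[mu]_(x in Om) \int[mu]_(y in Om)
      ((2 `^ D) ^+ j * (`|u x - u y| `^ p * \1_(near_diag (cdiam T) j) (x, y)))%:E
     <= B%:E)%E) ->
  (forall j, ((2 ^+ (d + k)) ^+ j)%:E * \int[mu]_(x in Om) local_energy u j x =
     (total_energy j)%:E)%E /\ (forall n, \sum_(j < n) total_energy j <= B).
Proof.
move=> hB.
have I0 j : (0 <= \int[mu]_(x in Om) local_energy u j x)%E.
  by apply: integral_ge0 => x _; exact: local_energy_ge0.
have E j : (\int[mu]_(x in Om) \int[mu]_(y in Om)
      ((2 `^ D) ^+ j * (`|u x - u y| `^ p * \1_(near_diag (cdiam T) j) (x, y)))%:E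
    = ((2 ^+ (d + k)) ^+ j)%:E * \int[mu]_(x in Om) local_energy u j x)%E.
  have -> : 2 `^ D = 2 ^+ (d + k) :> R by rewrite -natrD powR_mulrn.
  have c0 : 0 <= (2 ^+ (d + k)) ^+ j :> R by rewrite !exprn_ge0.
  rewrite -(ge0_integralZl_EFin _ mOm (fun x _ => local_energy_ge0 u j x)
    (@measurable_local_energy j Om) c0).
  apply: eq_integral => x _; rewrite /local_energy.
  rewrite -(ge0_integralZl_EFin _ mOm _ _ c0)//.
  apply/measurable_EFinP; apply: (@measurable_funS _ _ _ _ [set: X]) => //.
  exact: (measurableT_comp (mker j) (measurable_pair1 x)).
have fin j : (\int[mu]_(x in Om) local_energy u j x < +oo)%E.
  have := hB j.+1; rewrite big_ord_recr/= E => h.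
  have {}h : (((2 ^+ (d + k)) ^+ j)%:E * \int[mu]_(x in Om) local_energy u j x <= B%:E)%E.
    apply: le_trans h; rewrite leeDr// sume_ge0// => i _; by rewrite E mule_ge0.
  rewrite ltey; apply/eqP => ey; by move: h; rewrite ey gt0_muley.
have EE j : (((2 ^+ (d + k)) ^+ j)%:E * \int[mu]_(x in Om) local_energy u j x =
     (total_energy j)%:E)%E.
  by rewrite EFinM fineK// ge0_fin_numE.
split=> // n; rewrite -lee_fin -sumEFin; apply: le_trans (hB n).
by apply: lee_sum => j _; rewrite E EE.
Qed.

(** One 1 / [clo] comes from averaging over the parent, the other, with 2^d, from dividing by the
    measure of the child one generation below; the last factor is the extra n in the normalisation
    n^(j+1). *)
Definition tree_const : R := 2 ^+ d / clo T ^+ 2 / (2 ^ (d - k))%N%:R.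

Lemma tree_recursion_cells B :
  (forall j, ((2 ^+ (d + k)) ^+ j)%:E * \int[mu]_(x in Om) local_energy u j x =
     (total_energy j)%:E)%E -> (forall n, \sum_(j < n) total_energy j <= B) ->
  tree_recursion (@par _ _ T) (2 ^ (d - k)) p tree_const B
    (#|idx T 0|%:R / clo T) tree_mean tree_energy total_energy.
Proof.
move=> EE hB.
have w_ge0 j (m : idx T j.+1) : (0 <= \int[mu]_(x in cell m) local_energy u j x)%E.
  by apply: integral_ge0 => x _; exact: local_energy_ge0.
have wle j (m : idx T j.+1) : (\int[mu]_(x in cell m) local_energy u j x <=
    \int[mu]_(x in Om) local_energy u j x)%E.
  apply: ge0_subset_integral => //; [exact: measurable_cell|..].
  - exact: measurable_local_energy.
  - by move=> x _; exact: local_energy_ge0.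
  - exact: cell_sub.
have finO j : (\int[mu]_(x in Om) local_energy u j x < +oo)%E.
  rewrite ltey; apply/eqP => ey; by have := EE j; rewrite ey gt0_muley.
have wfin j (m : idx T j.+1) :
    ((fine (\int[mu]_(x in cell m) local_energy u j x))%:E =
     \int[mu]_(x in cell m) local_energy u j x)%E.
  by rewrite fineK// ge0_fin_numE// (le_lt_trans (wle _ _)).
have n0 : 0 < (2 ^ (d - k))%N%:R :> R by rewrite ltr0n expn_gt0.
split=> //.
- split=> j m; first by rewrite divr_ge0 ?cell_mean_ge0 ?exprn_ge0 ?(ltW n0).
  by rewrite mulr_ge0 ?fine_ge0 ?exprn_ge0.
- move=> j m t t01.
  set a := (1 - t) `^ (1 - p); set b := t `^ (1 - p).
  have a0 : 0 <= a by exact: powR_ge0.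
  have b0 : 0 <= b by exact: powR_ge0.
  have C0 : 0 <= b * (2 ^+ d) ^+ j / clo T.
    by rewrite divr_ge0 ?mulr_ge0 ?(ltW clo0) ?(ltW (dj0 j)).
  have e0 := e_gt0 m.
  have V0 := cell_mean_ge0 (par m).
  have mE := measurable_cell m.
  have h : cell_mean u m * cell_measure m <= a * cell_mean u (par m) * cell_measure m +
      b * (2 ^+ d) ^+ j / clo T * fine (\int[mu]_(x in cell m) local_energy u j x).
    rewrite -lee_fin -UE EFinD [X in (_ <= _ + X)%E]EFinM wfin.
    rewrite [X in (_ <= X + _)%E]EFinM -muE -integral_cst//.
    rewrite -(ge0_integralZl_EFin _ mE (fun x _ => local_energy_ge0 u j x)
      (@measurable_local_energy j _) C0).
    have me : measurable_fun (cell m)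
        (fun x => (b * (2 ^+ d) ^+ j / clo T)%:E * local_energy u j x)%E.
      by apply: measurable_funeM; exact: measurable_local_energy.
    rewrite -(ge0_integralD _ mE _ _ _ me)//; last 2 first.
    - by move=> x _; rewrite lee_fin mulr_ge0.
    - by move=> x _; rewrite mule_ge0// local_energy_ge0.
    apply: ge0_le_integral => //.
    - by apply: emeasurable_funD => //; apply: measurable_funeM; exact: measurable_local_energy.
    by move=> x /cell_nested mx; exact: powR_le_cell_mean.
  have w0 : 0 <= fine (\int[mu]_(x in cell m) local_energy u j x) by rewrite fine_ge0.
  have {}h : cell_mean u m <= a * cell_mean u (par m) +
      b * (2 ^+ d) ^+ j / clo T * fine (\int[mu]_(x in cell m) local_energy u j x) *
      ((2 ^+ d) ^+ j.+1 / clo T).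
    rewrite -(ler_pM2r e0) (le_trans h)// [leRHS]mulrDl lerD2l.
    rewrite -[leRHS]mulrA -[leLHS]mulr1 ler_wpM2l ?(mulr_ge0 C0 w0)//.
    rewrite -ler_pdivrMl ?divr_gt0// mulr1 invf_div.
    exact: e_ge.
  rewrite /tree_mean ler_pdivrMr ?exprn_gt0// (le_trans h)//; apply: eq_ler.
  rewrite /tree_const /tree_energy mulrDl; congr (_ + _).
    by rewrite exprS; field; rewrite ?expf_neq0 ?gt_eqF.
  (* The measures of parent and child give 2^(2jd) and the normalisation n^(-j); their product
     2^(j(d + k)) is exactly the weight of the kernel. This is where the relation sp = k is felt. *)
  have -> : (2 ^+ (d + k)) ^+ j = ((2 ^+ d) ^+ j) ^+ 2 / ((2 ^ (d - k))%N%:R) ^+ j :> R.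
    have hb : 2 ^+ (d + k) * (2 ^ (d - k))%N%:R = (2 ^+ d) ^+ 2 :> R.
      rewrite natrX -exprD -exprM; congr (_ ^+ _).
      by case/andP: kd => _ /ltnW kd'; rewrite -addnA subnKC// muln2 addnn.
    rewrite -[X in _ = X / _]exprM mulnC [X in _ = X / _]exprM -hb exprMn.
    by rewrite mulfK ?expf_neq0 ?gt_eqF.
  rewrite !exprS; field; rewrite ?expf_neq0 ?gt_eqF//.
- move=> j; rewrite -mulr_sumr /total_energy ler_wpM2l ?exprn_ge0// -lee_fin -sumEFin.
  under eq_bigr do rewrite wfin.
  rewrite fineK ?ge0_fin_numE//; last first.
    by apply: integral_ge0 => x _; exact: local_energy_ge0.
  apply: sum_disjoint_cells; first exact: measurable_local_energy.
  exact: local_energy_ge0.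
- rewrite mulr_natl -sumr_const ler_sum// => m _.
  by rewrite /tree_mean expr0 divr1 cell_mean0_le.
Qed.

End UnitBall.
End TubeEstimates.
End DyadicTubes.

Lemma powR_exprn {R : realType} (a q : R) n : 0 <= a ->
  (a ^+ n) `^ q = (a `^ q) ^+ n.
Proof. by move=> a0; rewrite -!powR_mulrn ?powR_ge0// powRAC. Qed.

(** * Weighted bounds on a dyadic tube *)

Section TubeBounds.
Context {R : realType} {d : nat}.
Local Notation X := 'rV[R]_d.
Local Notation mu := (@leb R d).
Variables (Om : set X) (k : nat) (T : dyadic_tube Om k) (p : R).
Hypotheses (mOm : measurable Om) (kd : (0 < k < d)%N) (p1 : 1 < p).
Local Notation D := (d%:R + k%:R : R).

Let p0 : 0 < p. Proof. exact: lt_trans p1. Qed.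

(** A single function that serves all cells: it dominates each nonnegative [f] on its cell, and its
    integral is the sum of the integrals over the cells. *)
Definition cell_series (f : forall j, idx T j -> X -> \bar R) (x : X) : \bar R :=
  (\sum_(j <oo) \sum_(m : idx T j) (@f j m \_ (cell m)) x)%E.

Section CellSeries.
Variable f : forall j, idx T j -> X -> \bar R.
Hypotheses (mf : forall j m, measurable_fun Om (@f j m))
  (f0 : forall j m x, (0 <= @f j m x)%E).

Let mfc j (m : idx T j) : measurable_fun Om (@f j m \_ (cell m)).
Proof.
apply/(measurable_restrict _ (measurable_cell m) mOm).
by apply: measurable_funS (mf m) => // x [].
Qed.

Let fc0 j (m : idx T j) x : (0 <= (@f j m \_ (cell m)) x)%E.
Proof. by rewrite patchE; case: ifP. Qed.

Lemma cell_series_ge0 x : (0 <= cell_series f x)%E.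
Proof. by apply: nneseries_ge0 => j _ _; exact: sume_ge0. Qed.

Lemma measurable_cell_series : measurable_fun Om (cell_series f).
Proof.
apply: ge0_emeasurable_sum => [j x _ _|j _]; first exact: sume_ge0.
exact: emeasurable_sum.
Qed.

Lemma cell_series_ge j (m : idx T j) x : cell m x -> (@f j m x <= cell_series f x)%E.
Proof.
move=> mx.
apply: le_trans (nneseries_ge_term (f := fun j => \sum_(m : idx T j)
  (@f j m \_ (cell m)) x)%E j _); last by move=> i; exact: sume_ge0.
rewrite (bigD1 m)//= patchE mem_set// leeDl// sume_ge0// => i _.
Qed.

Lemma integral_cell_series_le (M : \bar R) :
  (forall N, \sum_(j < N) \sum_(m : idx T j) \int[mu]_(x in cell m) @f j m x <= M)%E ->
  (\int[mu]_(x in Om) cell_series f x <= M)%E.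
Proof.
move=> hM; rewrite integral_nneseries//; last 2 first.
- by move=> j; exact: emeasurable_sum.
- by move=> j x _; exact: sume_ge0.
apply: nneseries_le_ub => [j|N].
  by apply: integral_ge0 => x _; exact: sume_ge0.
apply: le_trans (hM N); apply: lee_sum => j _.
rewrite ge0_integral_sum//; apply: lee_sum => m _.
rewrite -integral_mkcondr setIidr//; exact: cell_sub.
Qed.

End CellSeries.

Let n := (2 ^ (d - k))%N.
Let n0 : 0 < n%:R :> R. Proof. by rewrite ltr0n expn_gt0. Qed.
Let n1 : (1 < n)%N.
Proof. by rewrite -{1}(expn0 2) ltn_exp2l// subn_gt0; case/andP: kd. Qed.

Let C0 : 0 <= tree_const T.
Proof. by rewrite !divr_ge0 ?exprn_ge0 ?(ltW (clo_gt0 T)) ?(ltW n0). Qed.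

Let cell_measure_le j (m : idx T j) : cell_measure m <= cup T / (2 ^+ d) ^+ j.
Proof.
rewrite -lee_fin fineK ?leb_cell_le// ge0_fin_numE//.
by rewrite (le_lt_trans (leb_cell_le m))// ltry.
Qed.

Let tree : exists2 B : R, 0 < B & forall u, sobolev_unit_ball p D Om u ->
  (forall j, ((2 ^+ (d + k)) ^+ j)%:E * \int[mu]_(x in Om) local_energy T p u j x =
     (total_energy T p u j)%:E)%E /\
  (forall n, \sum_(j < n) total_energy T p u j <= B) /\
  tree_recursion (@par _ _ _ _ T) n p (tree_const T) B
    (#|idx T 0|%:R / clo T) (tree_mean p u) (tree_energy p u) (total_energy T p u).
Proof.
have D0 : 0 < D by rewrite -natrD ltr0n addn_gt0; case/andP: kd => ->; rewrite orbT.
have [B B0 hB] := sum_near_diag_le mOm p0 D0 (cdiam_gt0 T).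
exists B => // u hu.
have [E1 E2] := integral_local_energyE mOm hu (hB u hu).
split=> //; split=> //.
by apply: tree_recursion_cells.
Qed.

Let expn_dk j : (2 ^+ k) ^+ j / (2 ^+ d) ^+ j = (n%:R ^+ j)^-1 :> R.
Proof.
have -> : (2 ^+ d) ^+ j = (2 ^+ k) ^+ j * n%:R ^+ j :> R.
  rewrite -exprMn /n natrX -exprD subnKC//.
  by case/andP: kd => _ /ltnW.
by field; rewrite !expf_neq0 ?gt_eqF.
Qed.

Let integral_cellE u j (m : idx T j) : sobolev_unit_ball p D Om u ->
  (\int[mu]_(x in cell m) (`|u x| `^ p)%:E = (cell_mean p u m * cell_measure m)%:E)%E.
Proof.
move=> hu; have mfu : measurable_fun [set: X] u by case: hu.
have e0 : 0 < cell_measure m.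
  apply: lt_le_trans (_ : clo T / (2 ^+ d) ^+ j <= _).
    by rewrite divr_gt0 ?clo_gt0// !exprn_gt0.
  rewrite -lee_fin fineK ?leb_cell_ge// ge0_fin_numE//.
  by rewrite (le_lt_trans (leb_cell_le m))// ltry.
rewrite /cell_mean divfK ?gt_eqF// fineK// ge0_fin_numE.
  case: hu => _ + _; move=> h; apply: le_lt_trans (ltry 1); apply: le_trans h.
  apply: ge0_subset_integral => //; first exact: measurable_cell.
  - apply/measurable_EFinP; apply: (@measurable_funS _ _ _ _ [set: X]) => //.
    exact: measurable_abs_powR.
  - exact: cell_sub.
by apply: integral_ge0 => x _; rewrite lee_fin powR_ge0.
Qed.

(** On a cell, the integral of 2^(jk) |u|^p is at most [cup] times [tree_mean], so [tree_hardy]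
    bounds the weighted sum over all generations. *)
Theorem tube_bound_critical : exists2 M : R, 0 < M &
  forall u, sobolev_unit_ball p D Om u -> exists Psi : X -> \bar R,
  [/\ measurable_fun Om Psi, forall x, (0 <= Psi x)%E,
      (\int[mu]_(x in Om) Psi x <= M%:E)%E &
      forall j (m : idx T j) x, cell m x ->
        (((2 ^+ k) ^+ j * j.+1%:R `^ (- p) * `|u x| `^ p)%:E <= Psi x)%E].
Proof.
have [B B0 hB] := tree.
have [H H0 hH] := tree_hardy (@par_fiber _ _ _ _ T) B
  (#|idx T 0|%:R / clo T) p1 C0 n1.
exists (cup T * H); first by rewrite mulr_gt0 ?cup_gt0.
move=> u hu; have [_ [_ hT]] := hB u hu.
have mfu : measurable_fun [set: X] u by case: hu.
have mup (A : set X) : measurable_fun A (fun x => (`|u x| `^ p)%:E).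
  apply/measurable_EFinP; apply: (@measurable_funS _ _ _ _ [set: X]) => //.
  exact: measurable_abs_powR.
pose w j : R := (2 ^+ k) ^+ j * j.+1%:R `^ (- p).
have w0 j : 0 <= w j by rewrite mulr_ge0 ?powR_ge0 ?exprn_ge0.
pose f j (m : idx T j) (x : X) := ((w j)%:E * (`|u x| `^ p)%:E)%E.
have f0 j (m : idx T j) x : (0 <= f j m x)%E.
  by rewrite /f -EFinM lee_fin mulr_ge0 ?powR_ge0.
have mf j (m : idx T j) : measurable_fun Om (f j m) by exact: measurable_funeM.
exists (cell_series f); split.
- exact: measurable_cell_series.
- exact: cell_series_ge0.
- apply: integral_cell_series_le => // N.
  apply: (@le_trans _ _ (\sum_(j < N) (cup T *
      (j.+1%:R `^ (- p) * \sum_(m : idx T j) tree_mean p u m))%:E)%E); last first.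
    by rewrite sumEFin lee_fin -mulr_sumr ler_wpM2l ?(ltW (cup_gt0 T)) ?(hH _ _ _ hT).
  apply: lee_sum => j _; rewrite !mulr_sumr -sumEFin; apply: lee_sum => m _.
  rewrite /f ge0_integralZl_EFin//; last exact: measurable_cell.
  rewrite integral_cellE// -EFinM lee_fin.
  have V0 := cell_mean_ge0 p u m.
  rewrite (le_trans (ler_wpM2l (w0 j) (ler_wpM2l V0 (cell_measure_le m))))//.
  apply: eq_ler; rewrite /w /tree_mean -expn_dk; ring.
- move=> j m x mx; apply: le_trans (cell_series_ge f0 mx).
  by rewrite /f -EFinM.
Qed.

(** The majorant has three terms, for the three ways in which |u| can be large at a point of a cell:
    a large mean, a large oscillation at the scale of the cell, or a large Sobolev power. The
    contraction of the tree bounds the first. *)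
Theorem tube_bound_supercritical (tau S : R) : 0 <= S ->
  p < tau <= d%:R * p / (d%:R - k%:R) ->
  (forall u, sobolev_unit_ball p D Om u ->
    (\int[mu]_(x in Om) (`|u x| `^ (d%:R * p / (d%:R - k%:R)))%:E <= S%:E)%E) ->
  exists2 M : R, 0 < M &
  forall u, sobolev_unit_ball p D Om u -> exists Psi : X -> \bar R,
  [/\ measurable_fun Om Psi, forall x, (0 <= Psi x)%E,
      (\int[mu]_(x in Om) Psi x <= M%:E)%E &
      forall j (m : idx T j) x, cell m x ->
        (((2 `^ (d%:R + (k%:R - d%:R) * (tau / p))) ^+ j * `|u x| `^ tau)%:E
          <= Psi x)%E].
Proof.
move=> S0 /andP[pt tq]; set qs := d%:R * p / (d%:R - k%:R) in tq *.
set al := d%:R + (k%:R - d%:R) * (tau / p) => hS.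
have kdR : (k%:R : R) < d%:R by rewrite ltr_nat; case/andP: kd.
have dk0 : 0 < d%:R - k%:R :> R by rewrite subr_gt0.
pose q := tau / p.
have q1 : 1 < q by rewrite ltr_pdivlMr// mul1r.
have q0 : 0 < q by exact: lt_trans q1.
have [B B0 hB] := tree.
have [H H0 hH] := tree_contraction (@par_fiber _ _ _ _ T) B
  (#|idx T 0|%:R / clo T) p1 C0 n1 q1.
have clo0 := clo_gt0 T.
(* The power of 1/2 comes from the splitting at t = 1/2, and the factor 2 from keeping only the
   larger of mean and oscillation. *)
pose h : R := 2 * 2^-1 `^ (1 - p).
have h0 : 0 < h by rewrite mulr_gt0// powR_gt0// invr_gt0.
pose W1 := h `^ q; pose W2 := h / clo T.
have W10 : 0 < W1 by rewrite powR_gt0.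
have W20 : 0 < W2 by rewrite divr_gt0.
exists (W1 * (cup T * H) + W2 * B + S).
  rewrite ltr_wpDr//; apply: addr_gt0; last exact: mulr_gt0.
  exact: (mulr_gt0 W10 (mulr_gt0 (cup_gt0 T) H0)).
move=> u hu; have [EE [oB hT]] := hB u hu.
have mfu : measurable_fun [set: X] u by case: hu.
have mupE (r : R) : measurable_fun Om (fun x => (`|u x| `^ r)%:E).
  apply/measurable_EFinP; apply: (@measurable_funS _ _ _ _ [set: X]) => //.
  exact: measurable_abs_powR.
pose f j (m : idx T j) (x : X) := (((2 `^ al) ^+ j * cell_mean p u m `^ q)%:E)%E.
have f0 j (m : idx T j) x : (0 <= f j m x)%E.
  by rewrite lee_fin mulr_ge0 ?exprn_ge0 ?powR_ge0.
have mf j (m : idx T j) : measurable_fun Om (f j m) by exact: measurable_cst.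
pose g j (x : X) := (((2 ^+ (d + k)) ^+ j)%:E * local_energy T p u j x)%E.
have g0 j x : (0 <= g j x)%E.
  by rewrite mule_ge0 ?local_energy_ge0// lee_fin !exprn_ge0.
have mw j : measurable_fun Om (local_energy T p u j).
  exact: (measurable_local_energy T mOm hu j).
have mg j : measurable_fun Om (g j) by exact: measurable_funeM.
pose G x := (\sum_(j <oo) g j x)%E.
have G0 x : (0 <= G x)%E by apply: nneseries_ge0.
have mG : measurable_fun Om G by apply: ge0_emeasurable_sum.
have mF := measurable_cell_series mf f0.
have F0 := cell_series_ge0 f0.
have IG : (\int[mu]_(x in Om) G x <= B%:E)%E.
  rewrite integral_nneseries//; apply: nneseries_le_ub => [j|N].
    by apply: integral_ge0.
  apply: le_trans (_ : (\sum_(j < N) total_energy T p u j)%:E <= _)%E; last first.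
    by rewrite lee_fin.
  rewrite -sumEFin; apply: lee_sum => j _.
  rewrite -EE ge0_integralZl_EFin ?exprn_ge0//.
  by move=> x _; exact: local_energy_ge0.
have IF : (\int[mu]_(x in Om) cell_series f x <= (cup T * H)%:E)%E.
  apply: integral_cell_series_le => // N.
  apply: (@le_trans _ _ (\sum_(j < N) (cup T *
      (\sum_(m : idx T j) tree_mean p u m `^ q))%:E)%E); last first.
    by rewrite sumEFin lee_fin -mulr_sumr ler_wpM2l ?(ltW (cup_gt0 T)) ?(hH _ _ _ hT).
  apply: lee_sum => j _; rewrite !mulr_sumr -sumEFin; apply: lee_sum => m _.
  have V0 := cell_mean_ge0 p u m.
  rewrite integral_cst; last exact: measurable_cell.
  have muE : mu (cell m) = (cell_measure m)%:E.
    rewrite fineK// ge0_fin_numE//.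
    by rewrite (le_lt_trans (leb_cell_le m))// ltry.
  rewrite [X in (_ * X <= _)%E]muE -EFinM lee_fin.
  have f0' : 0 <= (2 `^ al) ^+ j * cell_mean p u m `^ q.
    by rewrite mulr_ge0 ?exprn_ge0 ?powR_ge0.
  rewrite (le_trans (ler_wpM2l f0' (cell_measure_le m)))//; apply: eq_ler.
  have -> : tree_mean p u m `^ q =
      cell_mean p u m `^ q * ((2 `^ al) ^+ j / (2 ^+ d) ^+ j).
    rewrite /tree_mean powRM ?invr_ge0 ?exprn_ge0 ?(ltW n0)//; congr (_ * _).
    have -> : (2 `^ al) ^+ j / (2 ^+ d) ^+ j = (2 `^ (al - d%:R)) ^+ j.
      rewrite -expr_div_n -(powR_mulrn d)// -powRB//.
      by rewrite pnatr_eq0 implybT.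
    rewrite /n natrX -[in LHS](powR_mulrn (d - k)) ?natrB//; last first.
      by case/andP: kd => _ /ltnW.
    rewrite -exprVn -powRN powR_exprn ?powR_ge0// -powRrM.
    by congr (_ `^ _ ^+ _); rewrite /al /q; ring.
  by ring.
exists (fun x => W1%:E * cell_series f x + W2%:E * G x + (`|u x| `^ qs)%:E)%E; split.
- apply: emeasurable_funD => //; apply: emeasurable_funD; exact: measurable_funeM.
- by move=> x; rewrite !adde_ge0 ?mule_ge0 ?lee_fin ?powR_ge0 ?(ltW W10) ?(ltW W20).
- have m1 : measurable_fun Om (fun x => W1%:E * cell_series f x)%E.
    exact: measurable_funeM.
  have m2 : measurable_fun Om (fun x => W2%:E * G x)%E by exact: measurable_funeM.
  have P1 x : Om x -> (0 <= W1%:E * cell_series f x)%E.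
    by rewrite mule_ge0 ?lee_fin ?(ltW W10).
  have P2 x : Om x -> (0 <= W2%:E * G x)%E.
    by rewrite mule_ge0 ?lee_fin ?(ltW W20).
  rewrite (ge0_integralD _ mOm _ _ _ (mupE qs)); last 3 first.
  - by move=> x Ox; rewrite adde_ge0 ?P1 ?P2.
  - exact: emeasurable_funD.
  - by move=> x _; rewrite lee_fin powR_ge0.
  rewrite (ge0_integralD _ mOm P1 m1 P2 m2) !EFinD leeD ?hS// leeD//.
    rewrite (ge0_integralZl_EFin _ mOm (fun x _ => F0 x) mF (ltW W10)) EFinM.
    by rewrite lee_wpmul2l// lee_fin ltW.
  rewrite (ge0_integralZl_EFin _ mOm (fun x _ => G0 x) mG (ltW W20)) (EFinM W2).
  by rewrite lee_wpmul2l// lee_fin ltW.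
move=> j m x mx.
have half : 0 < (2^-1 : R) < 1 by rewrite invr_gt0 ltr0n/= invf_lt1 ?ltr1n.
have := powR_le_cell_mean mOm p1 hu half mx.
have -> : 1 - 2^-1 = 2^-1 :> R by field.
have V0 := cell_mean_ge0 p u m.
have Fx := cell_series_ge f0 mx.
have Gx : (g j x <= G x)%E by exact: (nneseries_ge_term j (fun i => g0 i x)).
move: Gx; rewrite /g.
have := local_energy_ge0 T p u j x.
case: (local_energy T p u j x) => [w||]//; last first.
  move=> _; rewrite gt0_muley ?lte_fin ?exprn_gt0// leye_eq => /eqP -> _.
  rewrite gt0_muley ?lte_fin// addey ?addye ?leey// -ltNye.
    by rewrite (lt_le_trans (ltNyr 0))// mule_ge0 ?lee_fin ?(ltW W10).
rewrite lee_fin -!EFinM -EFinD lee_fin => w0 Gx ux.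
have {}ux : `|u x| `^ p <= h / 2 * cell_mean p u m + h / 2 * ((2 ^+ d) ^+ j / clo T * w).
  by rewrite (le_trans ux)//; apply: eq_ler; rewrite /h; field; rewrite gt_eqF.
have al0 : 0 <= (2 `^ al) ^+ j :> R by rewrite exprn_ge0// powR_ge0.
(* If the mean dominates, |u|^p <= h V can be raised to the power tau/p. If the oscillation
   dominates, that would produce a power of the energy; instead |u|^tau is interpolated so that the
   energy enters linearly. *)
have [wV|Vw] := leP ((2 ^+ d) ^+ j / clo T * w) (cell_mean p u m).
  apply: (@le_trans _ _ (W1%:E * cell_series f x)%E); last first.
    by rewrite -addeA leeDl// adde_ge0 ?lee_fin ?powR_ge0// mule_ge0// lee_fin ltW.
  apply: (@le_trans _ _ (W1%:E * f j m x)%E); last by rewrite lee_wpmul2l// lee_fin ltW.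
  rewrite /f -EFinM lee_fin mulrCA ler_wpM2l//.
  have -> : `|u x| `^ tau = (`|u x| `^ p) `^ q.
    by rewrite -powRrM; congr (_ `^ _); rewrite /q; field; rewrite gt_eqF.
  rewrite /W1 -powRM ?(ltW h0)// ge0_ler_powR ?(ltW q0) ?nnegrE ?powR_ge0//.
    by rewrite mulr_ge0// ltW.
  rewrite (le_trans ux)// [leRHS](_ : _ = h / 2 * cell_mean p u m + h / 2 * cell_mean p u m).
    by rewrite lerD2l ler_wpM2l// divr_ge0// ltW.
  by field.
apply: (@le_trans _ _ ((W2 * ((2 ^+ (d + k)) ^+ j * w))%:E + (`|u x| `^ qs)%:E)%E); last first.
  rewrite leeD2r// (@le_trans _ _ (W2%:E * G x)%E)//.
    by rewrite EFinM lee_wpmul2l// lee_fin ltW.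
  by rewrite leeDr// mule_ge0 ?lee_fin// ltW.
rewrite -EFinD lee_fin.
have L0 : 0 < 2 ^+ j :> R by rewrite exprn_gt0.
have ptq : p <= tau <= qs by rewrite tq ltW.
(* With L = 2^j the weight exponents at p, tau and d p / (d - k) are k, alpha and 0: the energy
   controls the first, the Sobolev inequality the last. *)
have := powR_interpolate d%:R ((d%:R - k%:R) / p) L0 (normr_ge0 (u x)) p0 ptq.
have -> : d%:R - (d%:R - k%:R) / p * tau = al by rewrite /al; field; rewrite gt_eqF.
have -> : d%:R - (d%:R - k%:R) / p * p = k%:R :> R by field; rewrite gt_eqF.
have -> : d%:R - (d%:R - k%:R) / p * qs = 0.
  by rewrite /qs; field; rewrite !gt_eqF.
rewrite (powR_exprn al j (ler0n R 2)).
rewrite powRr0 mul1r powR_mulrn ?(ltW L0)// => /le_trans; apply.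
rewrite lerD2r (le_trans (ler_wpM2l _ ux)) ?exprn_ge0 ?(ltW L0)//.
have -> : (2 ^+ j) ^+ k = (2 ^+ k) ^+ j :> R by rewrite -!exprM mulnC.
apply: (@le_trans _ _ ((2 ^+ k) ^+ j * (h * ((2 ^+ d) ^+ j / clo T * w)))).
  rewrite ler_wpM2l ?exprn_ge0// [leRHS](_ : _ =
    h / 2 * ((2 ^+ d) ^+ j / clo T * w) + h / 2 * ((2 ^+ d) ^+ j / clo T * w)).
    by rewrite lerD2r ler_wpM2l ?divr_ge0 ?(ltW h0)// ltW.
  by field; rewrite gt_eqF.
by apply: eq_ler; rewrite /W2 exprD exprMn; field; rewrite gt_eqF.
Qed.

End TubeBounds.

(** * Compactness, Lipschitz domains and charts *)

Section Compactness.
Context {R : realType} {d : nat}.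
Local Notation X := 'rV[R]_d.

(** Induction along a finite subcover by balls. It yields uniform radii on compact sets as well as
    the final gluing of majorants. *)
Lemma compact_local_to_global (P : set X -> Prop) (K : set X) : compact K ->
  P set0 -> (forall A B, P A -> P B -> P (A `|` B)) ->
  (forall A B, A `<=` B -> P B -> P A) ->
  (forall x, K x -> exists2 r, 0 < r & P (eball x r)) -> P K.
Proof.
rewrite compact_cover => cK P0 PU PS loc.
have /choice[rad hrad] : forall x, exists r : R, K x -> 0 < r /\ P (eball x r).
  move=> x; have [Kx|nKx] := pselect (K x); last by exists 0.
  by have [r r0 Pr] := loc x Kx; exists r.
have [|x Kx|D DK KD] := cK X K (fun x => eball x (rad x)).
- by move=> x _; exact: open_eball.
- by exists x => //; apply: eball_center; case: (hrad x Kx).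
pose cov (s : seq X) := [set y | exists2 x, x \in s & eball x (rad x) y].
suff covP (s : seq X) : (forall x, x \in s -> K x) -> P (cov s).
  apply: (PS _ (cov (finmap.enum_fset D))); first by move=> y /KD[x xD xy]; exists x.
  by apply: covP => x /DK; rewrite inE.
elim: s => [|x s IH] sK.
  by apply: PS P0 => y [].
apply: (PS _ (eball x (rad x) `|` cov s)).
  move=> y [z]; rewrite inE => /orP[/eqP ->|zs] zy; first by left.
  by right; exists z.
apply: PU; first by case: (hrad x _) => //; apply: sK; rewrite mem_head.
by apply: IH => z zs; apply: sK; rewrite inE zs orbT.
Qed.

Lemma compact_uniform (K : set X) (Q : R -> X -> Prop) : compact K ->
  (forall e e' y, 0 < e' <= e -> Q e y -> Q e' y) ->
  (forall x, K x -> exists2 e, 0 < e & forall y, eball x e y -> Q e y) ->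
  exists2 e, 0 < e & forall y, K y -> Q e y.
Proof.
move=> cK mono loc.
have := @compact_local_to_global
  (fun A => exists2 e, 0 < e & forall y, A y -> Q e y) K cK.
apply.
- by exists 1.
- move=> A B [e1 e10 Q1] [e2 e20 Q2]; exists (Num.min e1 e2).
    by rewrite lt_min e10 e20.
  move=> y [/Q1|/Q2]; apply: mono; first by rewrite lt_min e10 e20 ge_min lexx.
  by rewrite lt_min e10 e20 ge_min lexx orbT.
- by move=> A B AB [e e0 h]; exists e => // y /AB; exact: h.
- by move=> x /loc[e e0 h]; exists e => //; exists e.
Qed.

Lemma closure_compact (A : set X) : bounded_set A -> compact (closure A).
Proof.
move=> bA; apply: bounded_closed_compact; last exact: closed_closure.
have [M [Mr hM]] := bA; exists M; split=> // N MN x Ax.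
rewrite /= leNgt; apply/negP => Nx.
have e0 : 0 < `|x| - N by rewrite subr_gt0.
have [y [Ay]] := Ax _ (nbhsx_ballx x _ e0).
rewrite -ball_normE/= => xy.
have yN : `|y| <= N by exact: hM N MN y Ay.
by have := lerB_dist x y; move: xy yN; lra.
Qed.

End Compactness.

Section DistanceToSet.
Context {R : realType} {d : nat}.
Local Notation X := 'rV[R]_d.
Implicit Types (K : set X) (x y : X).

Lemma dist_to_le K x y : K y -> dist_to K x <= enorm (x - y).
Proof.
move=> Ky; apply: ge_inf; last by exists y.
by exists 0 => _ [z _ <-]; exact: enorm_ge0.
Qed.

Lemma dist_to_ge K x c : K !=set0 -> (forall y, K y -> c <= enorm (x - y)) ->
  c <= dist_to K x.
Proof.
move=> [z Kz] h; apply: lb_le_inf; first by exists (enorm (x - z)), z.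
by move=> _ [y Ky <-]; exact: h.
Qed.

Lemma dist_to_ge0 K x : 0 <= dist_to K x.
Proof.
have [->|/set0P K0] := eqVneq K set0; first by rewrite /dist_to image_set0 inf0.
by apply: dist_to_ge => // y _; exact: enorm_ge0.
Qed.

Lemma le_dist_to K K1 x : K1 !=set0 -> K1 `<=` K -> dist_to K x <= dist_to K1 x.
Proof.
by move=> K10 K1K; apply: dist_to_ge => // y /K1K; exact: dist_to_le.
Qed.

Lemma measurable_dist_to K : K !=set0 -> measurable_fun [set: X] (dist_to K).
Proof.
move=> K0; apply: measurable_cont_real => a; apply/open_eballP => x /= ax.
pose e := (dist_to K x - a) / 2.
have e0 : 0 < e by rewrite divr_gt0// subr_gt0.
exists e => // y xy; apply: (@lt_le_trans _ _ (dist_to K x - e)).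
  by rewrite /e; lra.
apply: dist_to_ge => // z Kz.
have := dist_to_le x Kz; have := ler_enorm_trans y x z.
by move: xy; rewrite /eball/= (enormB y x); lra.
Qed.

End DistanceToSet.

Section InteriorCorkscrew.
Context {R : realType} {d : nat}.
Local Notation X := 'rV[R]_d.
Implicit Types (Om : set X).

(** Near the boundary, y is pushed by r/2 in the direction e away from the graph. A perturbation h
    moves the projection to the hyperplane by at most 2 |h| and the height by at most |h|, so the
    point stays above the graph if (2 |L| + 1) |h| < r/2. *)
Lemma lipschitz_domain_corkscrew Om : bounded_lipschitz_domain Om ->
  exists2 c : R, 0 < c & forall y r, Om y -> 0 < r <= c ->
    exists z, eball z (c * r) `<=` Om `&` eball y r.
Proof.
move=> [Om0 oOm _ bOm bd].
have cOm : compact (closure Om) by exact: closure_compact.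
have [|x clx|c c0 h] := compact_uniform (Q := fun c y => Om y -> forall r,
    0 < r <= c -> exists z, eball z (c * r) `<=` Om `&` eball y r) cOm; last first.
- by exists c => // y r Oy rc; apply: h => //; exact: subset_closure.
- have [Ox|nOx] := pselect (Om x).
    have [e e0 eOm] := (open_eballP Om).1 oOm x Ox.
    pose c := Num.min 1 (e / 2).
    have c0 : 0 < c by rewrite lt_min ltr01 divr_gt0.
    have c1 : c <= 1 by rewrite ge_min lexx.
    have ce : c <= e / 2 by rewrite ge_min lexx orbT.
    exists c => // y xy Oy r /andP[r0 rc]; exists y => z yz.
    have yr : eball y r z.
      by apply: lt_le_trans yz _; rewrite ler_piMl// ltW.
    split=> //; apply: eOm; rewrite /eball/=.
    have := ler_enorm_trans y z x; move: xy yr; rewrite /eball/=; lra.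
  have [r0 [e [phi [L [r00 e1 lip hOm]]]]] := bd x (conj clx nOx).
  have L0 : 0 <= `|L| by [].
  (* The first bound gives (2 |L| + 1) c < 1/2, the second keeps the ball about y inside the region
     described by the graph. The absolute value is there because the sign of L is not prescribed. *)
  pose c := Num.min (4 * (`|L| + 1))^-1 (r0 / 2).
  have c0 : 0 < c by rewrite lt_min invr_gt0 divr_gt0// andbT mulr_gt0// ltr_wpDl.
  have ce : c <= r0 / 2 by rewrite ge_min lexx orbT.
  have c1 : c * (4 * (`|L| + 1)) <= 1.
    rewrite -ler_pdivlMr ?mulr_gt0 ?ltr_wpDl// mul1r.
    by rewrite ge_min lexx.
  have c14 : c <= 4^-1.
    by have := mulr_ge0 (ltW c0) L0; move: c1; lra.
  exists c => // y xy Oy r /andP[rp rc].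
  have yB : phi (y - edot y e *: e) < edot y e.
    apply/hOm => //; apply: lt_trans xy _.
    by rewrite (le_lt_trans ce)// ltr_pdivrMr// ltr_pMr// ltr1n.
  exists (y + (r / 2) *: e) => w; rewrite /eball/= => hw.
  pose h := w - (y + (r / 2) *: e).
  have wE : w = y + (r / 2) *: e + h by rewrite /h addrC subrK.
  have hc : enorm h < c * r by [].
  have yw : enorm (w - y) < r.
    have -> : w - y = (r / 2) *: e + h.
      by rewrite wE; apply/rowP => i; rewrite !mxE; ring.
    rewrite (le_lt_trans (ler_enormD _ _))// enormZ e1 mulr1 gtr0_norm ?divr_gt0//.
    nra.
  split=> //; apply/hOm.
    apply: le_lt_trans (ler_enorm_trans y w x) _.
    move: xy; rewrite /eball/=; lra.
  have ee : edot e e = 1 by rewrite -sqr_enorm e1 expr1n.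
  have we : edot w e = edot y e + r / 2 + edot h e.
    by rewrite wE !edotDl edotZl ee mulr1.
  have he : `|edot h e| <= enorm h.
    rewrite ler_norml; apply/andP; split.
      rewrite lerNl -edotNl (le_trans (edot_le_enorm _ _))// enormN e1 mulr1//.
    by rewrite (le_trans (edot_le_enorm _ _))// e1 mulr1.
  have proj : enorm (w - edot w e *: e - (y - edot y e *: e)) <= 2 * enorm h.
    have -> : w - edot w e *: e - (y - edot y e *: e) = h - edot h e *: e.
      rewrite we wE !scalerDl; apply/rowP => i; rewrite !mxE; ring.
    rewrite (le_trans (ler_enormD _ _))// enormN enormZ e1 mulr1.
    by move: he; lra.
  have hp : phi (w - edot w e *: e) <= phi (y - edot y e *: e) + `|L| * (2 * enorm h).
    rewrite -lerBlDl (le_trans (ler_norm _))// (le_trans (lip _ _))//.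
    rewrite (le_trans (ler_wpM2r (enorm_ge0 _) (ler_norm L)))//.
    by rewrite ler_wpM2l.
  have he' : - enorm h <= edot h e by move: he; rewrite ler_norml => /andP[].
  have key : (2 * `|L| + 1) * enorm h < r / 2.
    have h0 := enorm_ge0 h.
    apply: (@le_lt_trans _ _ ((2 * `|L| + 1) * (c * r))).
      by rewrite ler_wpM2l// ?ltW// addr_ge0 ?mulr_ge0.
    nra.
  rewrite (le_lt_trans hp)// we; lra.
- move=> e e' y /andP[e'0 e'e] h Oy r /andP[r0 re'].
  have [|z hz] := h Oy r; first by rewrite r0 (le_trans re').
  exists z => w wz; apply: hz; apply: lt_le_trans wz _.
  by rewrite ler_wpM2r// ltW.
Qed.

Lemma lipschitz_domain_density Om : bounded_lipschitz_domain Om ->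
  exists2 c : R, 0 < c & exists2 r0 : R, 0 < r0 & forall y r, Om y -> 0 < r <= r0 ->
    ((c * r ^+ d)%:E <= leb (Om `&` eball y r))%E.
Proof.
move=> hOm; have [c c0 h] := lipschitz_domain_corkscrew hOm.
exists ((2 / d.+1%:R) ^+ d * c ^+ d).
  by rewrite mulr_gt0 ?exprn_gt0// divr_gt0.
exists c => // y r Oy /andP[r0 rc]; have [|z hz] := h y r Oy; first by rewrite r0.
have cr0 : 0 < c * r by rewrite mulr_gt0.
rewrite -mulrA -exprMn (le_trans (leb_eball_ge z cr0))// le_measure ?inE//.
- exact: measurable_eball.
- apply: measurableI; last exact: measurable_eball.
  by apply: measurable_open; case: hOm.
Qed.

(** Moving y towards the centre by the fraction s / (2 r) displaces it by less than s/2 and leaves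
    room s/2 to the boundary of the ball. *)
Lemma ball_corkscrew (x y : X) (r s : R) : eball x r y -> 0 < s <= r ->
  exists z, eball z (s / 2) `<=` eball x r `&` eball y s.
Proof.
move=> xy /andP[s0 sr]; have r0 : 0 < r by exact: lt_le_trans sr.
pose t := s / (2 * r).
have t0 : 0 < t by rewrite divr_gt0// mulr_gt0.
have tr : t * r = s / 2 by rewrite /t; field; rewrite gt_eqF.
have t1 : t < 1 by rewrite ltr_pdivrMr ?mulr_gt0// mul1r; lra.
exists (y + t *: (x - y)) => w; rewrite /eball/= => hw.
move: xy; rewrite /eball/= => xy.
split.
- rewrite (le_lt_trans (ler_enorm_trans (y + t *: (x - y)) _ _))//.
  have -> : y + t *: (x - y) - x = (1 - t) *: (y - x).
    by apply/rowP => i; rewrite !mxE; ring.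
  rewrite enormZ gtr0_norm ?subr_gt0//.
  have u0 : 0 < 1 - t by rewrite subr_gt0.
  have : (1 - t) * enorm (y - x) <= (1 - t) * r by rewrite (ler_pM2l u0) ltW.
  have -> : (1 - t) * r = r - s / 2 by rewrite mulrBl mul1r tr.
  lra.
- rewrite (le_lt_trans (ler_enorm_trans (y + t *: (x - y)) _ _))//.
  have -> : y + t *: (x - y) - y = t *: (x - y) by rewrite addrC addKr.
  rewrite enormZ gtr0_norm// (enormB x y).
  have : t * enorm (y - x) <= t * r by rewrite ler_pM2l// ltW.
  rewrite tr; lra.
Qed.

End InteriorCorkscrew.

Section FirstCoordinates.
Context {R : realType} {d : nat}.
Local Notation X := 'rV[R]_d.
Implicit Types (xi eta : X).

Let fst_part (k : nat) xi : X := \row_i (if (i < k)%N then xi ord0 i else 0).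

Let norm_fstE k xi : norm_fst k xi = enorm (fst_part k xi).
Proof.
congr Num.sqrt; rewrite /edot big_mkcond; apply: eq_bigr => i _.
by rewrite !mxE; case: ifP => _; rewrite ?mulr0 ?expr2.
Qed.

Lemma norm_fst_ge0 k xi : 0 <= norm_fst k xi.
Proof. exact: sqrtr_ge0. Qed.

Lemma norm_fst_le_enorm k xi : norm_fst k xi <= enorm xi.
Proof.
rewrite /norm_fst /enorm ler_sqrt ?edot_ge0// big_mkcond/= ler_sum// => i _.
by case: ifP => _; rewrite -expr2 ?sqr_ge0.
Qed.

Lemma norm_fst_triangle k xi eta : norm_fst k xi <= norm_fst k eta + enorm (xi - eta).
Proof.
apply: (@le_trans _ _ (norm_fst k eta + norm_fst k (xi - eta))); last first.
  by rewrite lerD2l norm_fst_le_enorm.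
rewrite !norm_fstE; have -> : fst_part k xi = fst_part k eta + fst_part k (xi - eta).
  by apply/rowP => i; rewrite !mxE; case: ifP => _; rewrite ?addr0// addrC subrK.
exact: ler_enormD.
Qed.

Lemma norm_fst_eq0 k xi : (forall i : 'I_d, (i < k)%N -> xi ord0 i = 0) ->
  norm_fst k xi = 0.
Proof.
move=> h; rewrite /norm_fst big1 ?sqrtr0// => i ik; by rewrite h// expr0n.
Qed.

Lemma coord_le_norm_fst k xi (i : 'I_d) : (i < k)%N -> `|xi ord0 i| <= norm_fst k xi.
Proof.
move=> ik; rewrite norm_fstE; have := coord_le_enorm (fst_part k xi) i.
by rewrite mxE ik.
Qed.

End FirstCoordinates.

Section LipschitzOnOpen.
Context {R : realType} {d : nat}.
Local Notation X := 'rV[R]_d.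
Variables (B : set X) (f : X -> R) (C : R).
Hypotheses (oB : open B) (C0 : 0 < C)
  (lip : forall y z, B y -> B z -> `|f y - f z| <= C * enorm (y - z)).

Lemma measurable_lipschitz_lt a : measurable (B `&` [set y | f y < a]).
Proof.
apply: measurable_open; apply/open_eballP => y [By /= ya].
have [e e0 eB] := (open_eballP B).1 oB y By.
have h0 : 0 < (a - f y) / C by rewrite divr_gt0// subr_gt0.
exists (Num.min e ((a - f y) / C)); first by rewrite lt_min e0.
move=> z; rewrite /eball/= lt_min => /andP[ze zf].
have Bz : B z by exact: eB.
split=> //=; have := lip Bz By; rewrite ltr_pdivlMr// in zf.
by rewrite ler_norml => /andP[_]; move: zf; rewrite mulrC; lra.
Qed.

Lemma measurable_lipschitz_ge a : measurable (B `&` [set y | a <= f y]).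
Proof.
rewrite (_ : _ `&` _ = B `\` (B `&` [set y | f y < a])).
  apply: measurableD; [exact: measurable_open|exact: measurable_lipschitz_lt].
apply/seteqP; split=> y /=.
  by move=> [By ay]; split=> // -[_]; rewrite ltNge ay.
by move=> [By ny]; split=> //; rewrite leNgt; apply/negP => ya; apply: ny.
Qed.

End LipschitzOnOpen.

(** * The dyadic tube carried by a chart of K *)

Section ChartTube.
Context {R : realType} {d : nat}.
Local Notation X := 'rV[R]_d.
Local Notation mu := (@leb R d).
Variables (Om K : set X) (k : nat) (x0 : X) (r C rho0 : R) (T S : X -> X).
Local Notation B := (eball x0 r).
Local Notation Q := (@cylinder R d k).
Hypotheses (r0 : 0 < r) (C0 : 0 < C) (rho00 : 0 < rho0)
  (QT : forall xi, Q xi -> B (T xi)) (BS : forall y, B y -> Q (S y))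
  (TK : forall xi, Q xi -> S (T xi) = xi) (SK : forall y, B y -> T (S y) = y)
  (lipT : forall xi eta, Q xi -> Q eta -> enorm (T xi - T eta) <= C * enorm (xi - eta))
  (lipS : forall y z, B y -> B z -> enorm (S y - S z) <= C * enorm (y - z))
  (SBK : S @` (B `&` K) = [set xi | Q xi /\ forall i : 'I_d, (i < k)%N -> xi ord0 i = 0])
  (KOm : forall y z, K z -> enorm (y - z) < rho0 -> Om y).

(** The bound rho0 / C keeps the cells inside Om. The bound 1/2 makes the points whose chart
    coordinates are within rho 2^-j of the centre of a cube stay in that cube. *)
Let rho := Num.min 2^-1 (rho0 / C).
Let rho_gt0 : 0 < rho. Proof. by rewrite lt_min invr_gt0 ltr0n divr_gt0. Qed.
Let rho_half : rho <= 2^-1. Proof. by rewrite ge_min lexx. Qed.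
Let rhoC : C * rho <= rho0.
Proof. by rewrite mulrC -ler_pdivlMr// ge_min lexx orbT. Qed.

Let J := {i : 'I_d | (k <= i)%N}.
Let tidx (j : nat) := {ffun J -> 'I_(2 ^ j)}.

Let half_ltn j (a : 'I_(2 ^ j.+1)) : (a./2 < 2 ^ j)%N.
Proof. by rewrite ltn_half_double -mul2n -expnS. Qed.

Let tpar j (m : tidx j.+1) : tidx j := [ffun i => Ordinal (half_ltn (m i))].

(** In chart coordinates: a dyadic cube of side 2^-j in the d - k tangential directions times the
    ball |xi_k| < rho 2^-j. The normal ball shrinks instead of being subdivided, so a cell does not
    equal the union of its children. *)
Let tcell j (m : tidx j) : set X := [set y | [/\ B y,
  norm_fst k (S y) * 2 ^+ j < rho &
  forall i : J, (m i)%:R <= S y ord0 (val i) * 2 ^+ j < (m i)%:R + 1]].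

Let cardJ : #|{: J}| = (d - k)%N.
Proof.
rewrite card_sig -sum1_card.
transitivity (\sum_(k <= i < d) 1)%N; last by rewrite sum_nat_const_nat muln1.
by rewrite big_geq_mkord; apply: eq_bigl => i; rewrite inE.
Qed.

(** A child is determined by its parent and the parities of its d - k indices. *)
Let tfiber j (m : tidx j) : (#|[pred m' | tpar m' == m]| <= 2 ^ (d - k))%N.
Proof.
pose o (m' : tidx j.+1) : {ffun J -> bool} := [ffun i => odd (m' i)].
have oinj : {in [pred m' | tpar m' == m] &, injective o}.
  move=> m1 m2; rewrite !inE => /eqP h1 /eqP h2 h.
  apply/ffunP => i; apply: val_inj => /=.
  have := congr1 (fun g : tidx j => val (g i)) (etrans h1 (esym h2)).
  have := congr1 (fun g : {ffun J -> bool} => g i) h.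
  rewrite !ffunE/= => e1 e2.
  by rewrite -(odd_double_half (m1 i)) -(odd_double_half (m2 i)) e1 e2.
rewrite -(card_in_imset oinj); apply: leq_trans (max_card _) _.
by rewrite card_ffun card_bool cardJ.
Qed.

Let pow_gt0 j : 0 < 2 ^+ j :> R. Proof. by rewrite exprn_gt0. Qed.

Let lip_fst y z : B y -> B z -> `|norm_fst k (S y) - norm_fst k (S z)| <= C * enorm (y - z).
Proof.
move=> By Bz; have := norm_fst_triangle k (S y) (S z).
have := norm_fst_triangle k (S z) (S y).
by rewrite (enormB (S z)) ler_norml; have := lipS By Bz; lra.
Qed.

Let lip_coord i y z : B y -> B z -> `|S y ord0 i - S z ord0 i| <= C * enorm (y - z).
Proof.
move=> By Bz; apply: le_trans (lipS By Bz).
by have := coord_le_enorm (S y - S z) i; rewrite !mxE.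
Qed.

Let mcell j (m : tidx j) : measurable (tcell m).
Proof.
have oB := @open_eball R d x0 r.
rewrite (_ : tcell m = (B `&` [set y | norm_fst k (S y) < rho / 2 ^+ j]) `&`
  \bigcap_(i in [set: J])
    ((B `&` [set y | (m i)%:R / 2 ^+ j <= S y ord0 (val i)]) `&`
     (B `&` [set y | S y ord0 (val i) < ((m i)%:R + 1) / 2 ^+ j]))).
  apply: measurableI; first exact: (measurable_lipschitz_lt oB C0 lip_fst).
  apply: fin_bigcap_measurable => [|i _].
    by apply: (@sub_finite_set _ _ [set` {: J}]) => //; exact: finite_finpred.
  apply: measurableI; first exact: (measurable_lipschitz_ge oB C0 (lip_coord (val i))).
  exact: (measurable_lipschitz_lt oB C0 (lip_coord (val i))).
apply/seteqP; split=> y.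
  move=> [By fy cy]; split; first by split=> //=; rewrite ltr_pdivlMr.
  move=> i _; have /andP[c1 c2] := cy i.
  by split; split=> //=; rewrite ?ler_pdivrMr ?ltr_pdivlMr.
move=> [[By /= fy] cy]; split=> //; first by rewrite -ltr_pdivlMr.
move=> i; have [[_ /= c1] [_ /= c2]] := cy i I.
by rewrite -ler_pdivrMr// c1 -ltr_pdivlMr.
Qed.

(** Setting the first k chart coordinates to 0 gives a point of K at distance less than C rho <=
    rho0. *)
Let subcell j (m : tidx j) : tcell m `<=` Om.
Proof.
move=> y [By fy _].
pose eta : X := \row_i (if (i < k)%N then 0 else S y ord0 i).
have [Qf Qc] := BS By.
have Qeta : [set xi | Q xi /\ forall i : 'I_d, (i < k)%N -> xi ord0 i = 0] eta.
  split; last by move=> i ik; rewrite mxE ik.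
  split; last by move=> i ki; rewrite mxE ltnNge ki/=; exact: Qc.
  by rewrite norm_fst_eq0// => i ik; rewrite mxE ik.
move: (Qeta); rewrite -SBK => -[z [Bz Kz] Sz].
apply: (KOm Kz).
rewrite -(SK By) -(SK Bz) (le_lt_trans (lipT (BS By) (BS Bz)))//.
apply: lt_le_trans rhoC; rewrite ltr_pM2l// Sz.
have -> : enorm (S y - eta) = norm_fst k (S y).
  rewrite /enorm /norm_fst /edot [in RHS]big_mkcond; congr Num.sqrt.
  apply: eq_bigr => i _; rewrite !mxE; case: ifP => _; last by rewrite subrr mulr0.
  by rewrite subr0 expr2.
apply: le_lt_trans fy; rewrite ler_peMr ?norm_fst_ge0// exprn_ege1// ler1n//.
Qed.

Let nested j (m : tidx j.+1) : tcell m `<=` tcell (tpar m).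
Proof.
move=> y [By fy cy]; split=> //.
  apply: le_lt_trans fy; rewrite ler_wpM2l ?norm_fst_ge0//.
  by rewrite exprS ler_peMl ?(ltW (pow_gt0 j))// ler1n.
move=> i; have := cy i; rewrite ffunE/= exprS.
rewrite -[in X in X -> _](odd_double_half (m i)) natrD -mul2n natrM.
set h : R := (m i)./2%:R; set s := S y ord0 (val i).
have o0 : 0 <= (odd (m i))%:R :> R by [].
have o1 : (odd (m i))%:R <= 1 :> R by case: (odd _); rewrite ?lexx ?ler01.
rewrite (_ : s * (2 * 2 ^+ j) = 2 * (s * 2 ^+ j)); last by ring.
by set w := s * _ => /andP[h1 h2]; apply/andP; split; lra.
Qed.

Let disj j (m m' : tidx j) y : tcell m y -> tcell m' y -> m = m'.
Proof.
move=> [_ _ c] [_ _ c']; apply/ffunP => i; apply: val_inj; apply/eqP.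
have /andP[h1 h2] := c i; have /andP[h3 h4] := c' i.
rewrite eqn_leq -ltnS -[X in _ && X]ltnS -!(ltr_nat R) -!natr1.
by rewrite (le_lt_trans h1 h4) (le_lt_trans h3 h2).
Qed.

Let diamS j (m : tidx j) y z : tcell m y -> tcell m z ->
  enorm (S y - S z) <= d%:R * (2 / 2 ^+ j).
Proof.
move=> [_ fy cy] [_ fz cz]; apply: enorm_le_coord => i; rewrite !mxE ler_pdivlMr//.
rewrite -[X in _ * X](gtr0_norm (pow_gt0 j)) -normrM mulrBl.
have [ik|ki] := ltnP i k; last first.
  have /andP[a1 a2] := cy (exist _ i ki); have /andP[b1 b2] := cz (exist _ i ki).
  by rewrite ler_norml/=; apply/andP; split; lra.
have hy := coord_le_norm_fst (S y) ik; have hz := coord_le_norm_fst (S z) ik.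
rewrite (le_trans (ler_normB _ _))// !normrM (gtr0_norm (pow_gt0 j)).
have := ler_wpM2r (ltW (pow_gt0 j)) hy; have := ler_wpM2r (ltW (pow_gt0 j)) hz.
move: fy fz rho_half; lra.
Qed.

Let cd := C * (d%:R * 2) + 1.
Let cd0 : 0 < cd.
Proof. by rewrite ltr_wpDl// mulr_ge0 ?(ltW C0)// mulr_ge0. Qed.

Let diam j (m : tidx j) y z : tcell m y -> tcell m z -> enorm (y - z) * 2 ^+ j <= cd.
Proof.
move=> my mz; have [By _ _] := my; have [Bz _ _] := mz.
rewrite -(SK By) -(SK Bz) -ler_pdivlMr// (le_trans (lipT (BS By) (BS Bz)))//.
rewrite (le_trans (ler_wpM2l (ltW C0) (diamS my mz)))// ler_pdivlMr//.
rewrite [leLHS](_ : _ = C * (d%:R * 2)); first by rewrite lerDl.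
by field; rewrite gt_eqF.
Qed.

Let cu := (4 * cd) ^+ d.
Let cu0 : 0 < cu. Proof. by rewrite exprn_gt0// mulr_gt0. Qed.

Let measure_le j (m : tidx j) : (mu (tcell m) <= (cu / (2 ^+ d) ^+ j)%:E)%E.
Proof.
have [->|/set0P[y my]] := eqVneq (tcell m) set0.
  by rewrite measure0 lee_fin divr_ge0 ?(ltW cu0) ?exprn_ge0.
have rj : 0 <= 2 * cd / 2 ^+ j by rewrite divr_ge0 ?mulr_ge0 ?(ltW cd0).
apply: (@le_trans _ _ (mu (eball y (2 * cd / 2 ^+ j)))).
  apply: le_measure; rewrite ?inE; [exact: mcell|exact: measurable_eball|].
  move=> z mz; rewrite /eball/= ltr_pdivlMr// (le_lt_trans (diam mz my))//.
  by rewrite ltr_pMl// ltr1n.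
rewrite (le_trans (leb_eball_le y rj))// lee_fin; apply: eq_ler.
rewrite -exprM mulnC exprM -expr_div_n; congr (_ ^+ _).
by field; rewrite gt_eqF.
Qed.

Let kap := Num.min r (rho / (2 * C)).
Let kap0 : 0 < kap. Proof. by rewrite lt_min r0 divr_gt0// mulr_gt0. Qed.
Let cl := (2 / d.+1%:R) ^+ d * (kap / 2) ^+ d.
Let cl0 : 0 < cl.
Proof. by rewrite mulr_gt0// exprn_gt0// divr_gt0. Qed.

(** T sends the centre of the cube, with xi_k = 0, into B but possibly close to its boundary.
    [ball_corkscrew] then supplies a ball of radius kap 2^-j / 2 inside B and within kap 2^-j of the
    image; since C kap <= rho / 2, S sends it close enough to the centre for it to lie in the
    cell. *)
Let measure_ge j (m : tidx j) : ((cl / (2 ^+ d) ^+ j)%:E <= mu (tcell m))%E.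
Proof.
pose xi : X := \row_i (if insub i is Some i' then ((m i')%:R + 2^-1) / 2 ^+ j else 0).
have xiE (i : J) : xi ord0 (val i) = ((m i)%:R + 2^-1) / 2 ^+ j.
  by rewrite mxE valK.
have xi0 (i : 'I_d) : (i < k)%N -> xi ord0 i = 0.
  by move=> ik; rewrite mxE insubN// -ltnNge.
have Qxi : Q xi.
  split; first by rewrite norm_fst_eq0.
  move=> i ki; have -> : i = val (exist _ i ki : J) by [].
  rewrite xiE divr_gt0 ?ltr_wpDl ?invr_gt0//= ltr_pdivrMr// mul1r.
  apply: (@lt_le_trans _ _ ((m (exist _ i ki))%:R + 1)).
    by rewrite ltrD2l invf_lt1// ltr1n.
  by rewrite natr1 -natrX ler_nat.
pose delta := kap / 2 ^+ j.
have delta0 : 0 < delta by rewrite divr_gt0.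
have dr : delta <= r.
  rewrite ler_pdivrMr// (@le_trans _ _ r)//; first by rewrite ge_min lexx.
  by rewrite ler_peMr ?(ltW r0)// exprn_ege1// ler1n.
have [|z hz] := ball_corkscrew (s := delta) (QT Qxi); first by rewrite delta0.
have sub : eball z (delta / 2) `<=` tcell m.
  move=> y /hz[By]; rewrite /eball/= => yd.
  have Sd : enorm (S y - xi) * 2 ^+ j < rho.
    rewrite -(TK Qxi) -ltr_pdivlMr// (le_lt_trans (lipS By (QT Qxi)))//.
    rewrite mulrC -ltr_pdivlMr// (lt_le_trans yd)// /delta.
    rewrite ler_pdivrMr// [leRHS](_ : _ = rho / C); last by field; rewrite !gt_eqF.
    rewrite (@le_trans _ _ (rho / (2 * C)))//; first by rewrite ge_min lexx orbT.
    by rewrite ler_pM2l// lef_pV2 ?posrE ?mulr_gt0// ler_peMl ?(ltW C0)// ler1n.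
  split=> //.
    apply: le_lt_trans Sd; rewrite ler_wpM2r ?(ltW (pow_gt0 j))//.
    by rewrite (le_trans (norm_fst_triangle k _ xi))// norm_fst_eq0// add0r.
  move=> i; have := coord_le_enorm (S y - xi) (val i).
  move=> /(ler_wpM2r (ltW (pow_gt0 j))) h.
  have {h}Sd := le_lt_trans h Sd.
  move: Sd; rewrite -[X in _ * X < _](gtr0_norm (pow_gt0 j)) -normrM.
  rewrite !mxE -[X in X - _]/(S y ord0 (val i)).
  have := xiE i; rewrite mxE => ->; rewrite mulrBl divfK ?gt_eqF// ltr_norml.
  by move=> /andP[h1 h2]; have rh := rho_half; apply/andP; split; lra.
have d20 : 0 < delta / 2 by rewrite divr_gt0.
apply: (@le_trans _ _ (mu (eball z (delta / 2)))); last first.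
  by apply: le_measure; rewrite ?inE; [exact: measurable_eball|exact: mcell|exact: sub].
apply: le_trans (leb_eball_ge z d20); rewrite lee_fin; apply: eq_ler.
rewrite /cl -mulrA; congr (_ * _).
rewrite -exprM mulnC exprM -expr_div_n; congr (_ ^+ _).
by rewrite /delta; field; rewrite gt_eqF.
Qed.

Lemma chart_tube : exists (Tb : dyadic_tube Om k) (e : R), 0 < e /\
  forall j y, B y -> norm_fst k (S y) * 2 ^+ j < e ->
    exists m : idx Tb j, cell m y.
Proof.
exists (DyadicTube cl0 cu0 cd0 tfiber mcell subcell nested disj measure_ge
  measure_le diam), rho; split=> //= j y By fy.
have [_ Qc] := BS By.
have lt2 (i : J) : (Num.truncn (S y ord0 (val i) * 2 ^+ j) < 2 ^ j)%N.
  have /andP[s0 s1] := Qc (val i) (valP i).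
  rewrite -(ltr_nat R) natrX.
  apply: (@le_lt_trans _ _ (S y ord0 (val i) * 2 ^+ j)).
    by rewrite truncn_le mulr_ge0 ?(ltW s0) ?(ltW (pow_gt0 j)).
  by rewrite gtr_pMl.
exists [ffun i => Ordinal (lt2 i)]; split=> // i; rewrite ffunE/=.
have /andP[s0 s1] := Qc (val i) (valP i).
rewrite natr1 truncnS_gt andbT.
by rewrite truncn_le mulr_ge0 ?(ltW s0) ?(ltW (pow_gt0 j)).
Qed.

End ChartTube.

(** * Local bounds on the weighted integrand *)

Lemma log_weight_le {R : realType} (alpha beta t w c L : R) j :
  0 <= alpha -> 0 <= beta -> 0 < w -> 0 < c -> w / 2 ^+ j <= t ->
  c * j.+1%:R <= L ->
  (t `^ alpha * L `^ beta)^-1 <=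
  (w `^ alpha * c `^ beta)^-1 * ((2 `^ alpha) ^+ j * j.+1%:R `^ (- beta)).
Proof.
move=> al0 be0 w0 c0 wt cL.
have wj0 : 0 < w / 2 ^+ j by rewrite divr_gt0// exprn_gt0.
have j0 : 0 < j.+1%:R :> R by rewrite ltr0n.
have cj0 : 0 < c * j.+1%:R by rewrite mulr_gt0.
have -> : (w `^ alpha * c `^ beta)^-1 * ((2 `^ alpha) ^+ j * j.+1%:R `^ (- beta)) =
    ((w / 2 ^+ j) `^ alpha * (c * j.+1%:R) `^ beta)^-1.
  have -> : w `^ alpha = (w / 2 ^+ j) `^ alpha * (2 `^ alpha) ^+ j.
    by rewrite -powR_exprn// -powRM ?exprn_ge0 ?(ltW wj0)// divfK.
  rewrite powRN (powRM _ (ltW c0) (ltW j0)).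
  have := powR_gt0 alpha wj0; have := powR_gt0 beta c0; have := powR_gt0 beta j0.
  have := exprn_gt0 j (powR_gt0 alpha (ltr0n R 2)).
  move: (_ `^ alpha) (c `^ beta) (_.+1%:R `^ beta) (_ ^+ j) => x y z v v0 z0 y0 x0.
  by field; rewrite !gt_eqF.
have a0 := powR_gt0 alpha wj0; have b0 := powR_gt0 beta cj0.
have h : (w / 2 ^+ j) `^ alpha * (c * j.+1%:R) `^ beta <= t `^ alpha * L `^ beta.
  apply: ler_pM; rewrite ?powR_ge0//.
    by apply: ge0_ler_powR; rewrite ?nnegrE ?(ltW wj0)// (le_trans (ltW wj0)).
  by apply: ge0_ler_powR; rewrite ?nnegrE ?(ltW cj0)// (le_trans (ltW cj0)).
have ab0 := mulr_gt0 a0 b0.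
by rewrite lef_pV2 ?posrE// (lt_le_trans ab0).
Qed.

(** If w / t > 1, j is its dyadic scale and ln (b / t) >= j ln 2; otherwise j = 0, and the logarithm
    is bounded below because t <= r1 < b. The case j = 0 is kept apart: a point can be far from K1
    and still close to K, where generation 0 is enough. *)
Lemma ex_log_scale {R : realType} (w r1 b : R) : 0 < w <= b -> r1 < b ->
  exists2 c, 0 < c & forall t, 0 < t <= r1 -> exists j : nat,
    [/\ j = 0%N \/ 2 ^+ j < w / t, w / 2 / 2 ^+ j <= t &
        c * j.+1%:R <= ln (b / t)].
Proof.
move=> /andP[w0 wb] r1b.
have [r10|r10] := leP r1 0.
  by exists 1 => // t /andP[t0 tr]; move: (lt_le_trans t0 tr); rewrite ltNge r10.
have b0 : 0 < b by exact: lt_le_trans wb.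
have ln20 : 0 < ln 2 :> R by rewrite ln_gt0// ltr1n.
have lr0 : 0 < ln (b / r1) by rewrite ln_gt0// ltr_pdivlMr// mul1r.
(* The first entry handles j = 0; the second is halved since j ln 2 is compared with j + 1, and j >=
   (j + 1) / 2 for j >= 1. *)
pose c := Num.min (ln (b / r1)) (ln 2 / 2).
have c0 : 0 < c by rewrite lt_min lr0 divr_gt0.
exists c => // t /andP[t0 tr].
have L0 : c <= ln (b / t).
  rewrite (@le_trans _ _ (ln (b / r1))) ?ge_min ?lexx//.
  by rewrite ler_ln ?posrE ?divr_gt0// ler_pM2l// lef_pV2.
have [wt|wt] := leP (w / t) 1.
  exists 0%N; rewrite expr0 divr1 mulr1; split=> //; first by left.
  by move: wt; rewrite ler_pdivrMr// mul1r; lra.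
have [j] := ex_dyadic_scale (ltr01 : 0 < 1 :> R) wt; rewrite !mul1r => /andP[j1 j2].
have pj0 : 0 < 2 ^+ j :> R by rewrite exprn_gt0.
exists j; split; first by right.
  rewrite ler_pdivrMr//; move: j2; rewrite ler_pdivrMr// exprS; lra.
case: j => [|j] in j1 {j2} pj0 *; first by rewrite mulr1.
have c2 : c <= ln 2 / 2 by rewrite ge_min lexx orbT.
have : ln (2 ^+ j.+1) <= ln (b / t).
  rewrite ler_ln ?posrE ?divr_gt0//; apply: (le_trans (ltW j1)).
  by rewrite ler_pM2r ?invr_gt0.
rewrite lnXn// -[ln 2 *+ _]mulr_natl => h; apply: le_trans h.
have n1 : 1 <= j.+1%:R :> R by rewrite ler1n.
rewrite -natr1; apply: (@le_trans _ _ (ln 2 / 2 * (j.+1%:R + 1))).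
  by rewrite ler_wpM2r ?addr_ge0.
have : 0 <= ln 2 * (j.+1%:R - 1) :> R by rewrite mulr_ge0 ?subr_ge0// ltW.
lra.
Qed.

Lemma c01_norm_ge0 {R : realType} {d : nat} (D : set 'rV[R]_d) f : D !=set0 ->
  (0 <= c01_norm D f)%E.
Proof.
move=> [x Dx]; apply: adde_ge0.
  apply: (@le_trans _ _ (enorm (f x))%:E); first by rewrite lee_fin enorm_ge0.
  by apply: ereal_sup_ubound; exists x.
apply: (@le_trans _ _ (enorm (f x - f x) / enorm (x - x))%:E).
  by rewrite lee_fin divr_ge0 ?enorm_ge0.
by apply: ereal_sup_ubound; exists (x, x).
Qed.

Lemma c01_norm_lipschitz {R : realType} {d : nat} (D : set 'rV[R]_d) f C x y :
  (c01_norm D f <= C%:E)%E -> D x -> D y -> enorm (f x - f y) <= C * enorm (x - y).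
Proof.
move=> fC Dx Dy; have [xy|xy] := eqVneq (enorm (x - y)) 0.
  have /eqP := enorm0_eq0 xy; rewrite subr_eq0 => /eqP ->.
  by rewrite !subrr enorm0 mulr0.
rewrite -ler_pdivrMr; last by rewrite lt_neqAle eq_sym xy enorm_ge0.
rewrite -lee_fin; apply: le_trans fC; rewrite /c01_norm -[leLHS]add0e.
apply: leeD; last by apply: ereal_sup_ubound; exists (x, y).
apply: (@le_trans _ _ (enorm (f x))%:E); first by rewrite lee_fin enorm_ge0.
by apply: ereal_sup_ubound; exists x.
Qed.

Section LocalBounds.
Context {R : realType} {d : nat}.
Local Notation X := 'rV[R]_d.
Local Notation mu := (@leb R d).
Variables (Om K K1 : set X) (k : nat) (p tau alpha beta b r1 S : R).
Local Notation pstar := (d%:R * p / (d%:R - k%:R)).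

Definition hardy_integrand (u : X -> R) (x : X) : R :=
  `|u x| `^ tau / (dist_to K1 x `^ alpha * ln (b / dist_to K1 x) `^ beta).

(** [Psi] is integrated over the whole of [Om] but has to dominate on [A] only, so [A] may be any
    set and unions of pieces call for neither measurability nor disjointness. The bound [M] is
    uniform in [u]. *)
Definition majorized (A : set X) : Prop := exists2 M : R, 0 < M &
  forall u, sobolev_unit_ball p (d%:R + k%:R) Om u -> exists Psi : X -> \bar R,
  [/\ measurable_fun Om Psi, forall x, (0 <= Psi x)%E,
      (\int[mu]_(x in Om) Psi x <= M%:E)%E &
      forall y, A y -> Om y -> ((hardy_integrand u y)%:E <= Psi y)%E].

Hypothesis oOm : open Om.
Let mOm : measurable Om. Proof. exact: measurable_open. Qed.

Lemma majorized0 : majorized set0.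
Proof.
exists 1 => // u _; exists (cst 0%E); split=> //.
by rewrite integral0 lee_fin.
Qed.

Lemma majorizedS A B : A `<=` B -> majorized B -> majorized A.
Proof.
move=> AB [M M0 h]; exists M => // u /h[Psi [? ? ? hPsi]]; exists Psi; split=> //.
by move=> y /AB; exact: hPsi.
Qed.

Lemma majorizedU A B : majorized A -> majorized B -> majorized (A `|` B).
Proof.
move=> [M M0 h] [N N0 g]; exists (M + N) => [|u uB]; first exact: addr_gt0.
have [P [mP P0 PM hP]] := h u uB; have [Q [mQ Q0 QN hQ]] := g u uB.
exists (fun x => P x + Q x)%E; split.
- exact: emeasurable_funD.
- by move=> x; exact: adde_ge0.
- by rewrite ge0_integralD// EFinD leeD.
- move=> y [Ay|By] Oy; first by apply: le_trans (hP y Ay Oy) _; rewrite leeDl.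
  by apply: le_trans (hQ y By Oy) _; rewrite leeDr.
Qed.

Hypotheses (kd : (1 < k < d)%N) (p1 : 1 < p) (al0 : 0 <= alpha) (be0 : 0 <= beta)
  (alE : alpha = d%:R + (k%:R - d%:R) * (tau / p))
  (tauE : tau = p /\ beta = p \/ p < tau <= pstar) (S0 : 0 <= S)
  (sob : forall u, sobolev_unit_ball p (d%:R + k%:R) Om u ->
    (\int[mu]_(x in Om) (`|u x| `^ pstar)%:E <= S%:E)%E).

Let kd0 : (0 < k < d)%N.
Proof. by move/andP: kd => [k1 ->]; rewrite andbT (ltn_trans _ k1). Qed.

Let p0 : 0 < p. Proof. exact: lt_trans p1. Qed.

Let dk0 : 0 < d%:R - k%:R :> R.
Proof. by rewrite subr_gt0 ltr_nat; case/andP: kd. Qed.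

Let ptau : p <= tau <= pstar.
Proof.
case: tauE => [[-> _]|/andP[/ltW -> ->]//]; rewrite lexx/= ler_pdivlMr//.
by rewrite mulrC ler_pM2r// gerBl.
Qed.

Let power_majorant (u : X -> R) (x : X) : \bar R :=
  (`|u x| `^ p + `|u x| `^ pstar)%:E.

Let power_majorant_ge0 u x : (0 <= power_majorant u x)%E.
Proof. by rewrite lee_fin addr_ge0 ?powR_ge0. Qed.

Let powR_tau_le u x : ((`|u x| `^ tau)%:E <= power_majorant u x)%E.
Proof. by rewrite lee_fin powR_le_maxD. Qed.

Let measurable_power_majorant u : measurable_fun [set: X] u ->
  measurable_fun Om (power_majorant u).
Proof.
move=> mu_; apply/measurable_EFinP; apply: (@measurable_funS _ _ _ _ setT) => //.
by apply: measurable_funD; exact: measurable_abs_powR.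
Qed.

Let integral_power_majorant_le u : sobolev_unit_ball p (d%:R + k%:R) Om u ->
  (\int[mu]_(x in Om) power_majorant u x <= (1 + S)%:E)%E.
Proof.
move=> uB; have [mU Lp _] := uB.
have mf q : measurable_fun Om (fun x => (`|u x| `^ q)%:E).
  apply/measurable_EFinP; apply: (@measurable_funS _ _ _ _ setT) => //.
  exact: measurable_abs_powR.
rewrite /power_majorant; under eq_integral do rewrite EFinD.
rewrite ge0_integralD//; [|by move=> x _; rewrite lee_fin powR_ge0..].
by rewrite EFinD leeD// sob.
Qed.

Lemma majorized_bounded_weight A c : 0 < c ->
  (forall y, A y -> Om y ->
    (dist_to K1 y `^ alpha * ln (b / dist_to K1 y) `^ beta)^-1 <= c) ->
  majorized A.
Proof.
move=> c0 hc; exists (c * (1 + S)) => [|u uB]; first by rewrite mulr_gt0// ltr_wpDr.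
have [mU _ _] := uB; have mP := measurable_power_majorant mU.
exists (fun x => c%:E * power_majorant u x)%E; split.
- exact: measurable_funeM.
- by move=> x; rewrite mule_ge0// lee_fin ltW.
- rewrite (ge0_integralZl_EFin _ mOm (fun x _ => power_majorant_ge0 u x) mP (ltW c0)).
  by rewrite EFinM lee_pmul2l// integral_power_majorant_le.
- move=> y Ay Oy; apply: (@le_trans _ _ (c%:E * (`|u y| `^ tau)%:E)%E).
    by rewrite -EFinM lee_fin /hardy_integrand mulrC ler_wpM2r ?powR_ge0// hc.
  by rewrite lee_pmul2l// powR_tau_le.
Qed.

(** Common form of the two regimes: when tau = p, alpha = k; when tau > p the factor (j + 1)^(-beta)
    is at most 1, as beta >= 0, and is inserted for free. *)
Lemma tube_bound (T : dyadic_tube Om k) : exists2 M : R, 0 < M &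
  forall u, sobolev_unit_ball p (d%:R + k%:R) Om u -> exists Psi : X -> \bar R,
  [/\ measurable_fun Om Psi, forall x, (0 <= Psi x)%E,
      (\int[mu]_(x in Om) Psi x <= M%:E)%E &
      forall j (m : idx T j) x, cell m x ->
        (((2 `^ alpha) ^+ j * j.+1%:R `^ (- beta) * `|u x| `^ tau)%:E <= Psi x)%E].
Proof.
case: tauE => [[tE ->]|tau1].
  have aE : alpha = k%:R by rewrite alE tE divff ?gt_eqF// mulr1 subrKC.
  by rewrite aE tE powR_mulrn//; exact: tube_bound_critical.
have [M M0 h] := tube_bound_supercritical T mOm kd0 p1 S0 tau1 sob.
exists M => // u /h[Psi [? ? ? hP]]; exists Psi; split=> // j m x mx.
apply: le_trans (hP j m x mx); rewrite lee_fin alE -mulrA.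
rewrite ler_wpM2l ?exprn_ge0 ?powR_ge0// ler_piMl ?powR_ge0// powRN invf_le1.
  have n1 : 1 <= j.+1%:R :> R by rewrite ler1n.
  by have := @ge0_ler_powR R beta be0 1 j.+1%:R; rewrite !nnegrE powR1; exact.
by rewrite powR_gt0.
Qed.

Hypotheses (K10 : K1 !=set0) (K1K : K1 `<=` K) (b0 : 0 < b) (r1b : r1 < b)
  (distr1 : forall x, Om x -> dist_to K1 x <= r1)
  (cK : compact K) (KOm : K `<=` Om).

Lemma majorized_surface x0 : class_C01 k Om K -> K x0 ->
  exists2 r, 0 < r & majorized (eball x0 r).
Proof.
move=> [C C0 hK] Kx0.
have [r [T [S' [r0 [QT BS TK SK] cTS SBK [C1 [C2 [C10 _ hC1]]]]]]] := hK x0 Kx0.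
have Bx0 : eball x0 r x0 by exact: eball_center.
have TK' xi : cylinder k xi -> S' (T xi) = xi by move=> Qxi; apply: TK; rewrite inE.
have SK' y : eball x0 r y -> T (S' y) = y by move=> By; apply: SK; rewrite inE.
have lipT xi eta : cylinder k xi -> cylinder k eta ->
    enorm (T xi - T eta) <= C * enorm (xi - eta).
  move=> Qxi Qeta; apply: c01_norm_lipschitz;
    [|exact: subset_closure Qxi|exact: subset_closure Qeta].
  apply: le_trans cTS; rewrite leeDl// c01_norm_ge0//.
  by exists x0; exact: subset_closure.
have lipS y z : eball x0 r y -> eball x0 r z ->
    enorm (S' y - S' z) <= C * enorm (y - z).
  move=> By Bz; apply: c01_norm_lipschitz; [|exact: subset_closure By|exact: subset_closure Bz].
  apply: le_trans cTS; rewrite leeDr// c01_norm_ge0//.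
  by exists (S' x0); apply: subset_closure; exact: BS.
have [|x Kx|rho0 rho00 hrho] := compact_uniform (Q := fun e y => forall z,
    enorm (z - y) < e -> Om z) cK.
- by move=> e e' y /andP[_ ee] h z ze; apply: h; exact: lt_le_trans ee.
- have /open_eballP/(_ x (KOm Kx))[e e0 eOm] := oOm.
  exists (e / 2); first by rewrite divr_gt0.
  move=> y xy z zy; apply: eOm; rewrite /eball/=.
  by have := ler_enorm_trans y z x; move: xy; rewrite /eball/=; lra.
have [Tb [e [e0 he]]] := chart_tube r0 C0 rho00 QT BS TK' SK' lipT lipS SBK
  (fun y z Kz => hrho z Kz y).
have fst0 y : eball x0 r y -> K y -> norm_fst k (S' y) = 0.
  move=> By Ky; apply: norm_fst_eq0.
  have : [set xi | cylinder k xi /\ forall i : 'I_d, (i < k)%N -> xi ord0 i = 0] (S' y).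
    by rewrite -SBK; exists y.
  by case.
have fst_dist y : eball x0 r y -> Om y -> C1 * norm_fst k (S' y) <= dist_to K1 y.
  move=> By Oy; have [Ky|nKy] := pselect (K y).
    by rewrite fst0// mulr0 dist_to_ge0.
  have := hC1 (S' y) (BS _ By); rewrite SK'// => /(_ (conj Oy nKy))/andP[h _].
  exact: le_trans h (le_dist_to _ K10 K1K).
(* S is C-Lipschitz and the normal part of S x0 is 0, so this radius forces |xi_k| < e: every point
   considered lies in a cell of generation 0. *)
pose eps := Num.min r (e / (2 * C)).
have eps0 : 0 < eps by rewrite lt_min r0 divr_gt0// mulr_gt0.
exists eps => //.
have fst_lt y : eball x0 eps y -> norm_fst k (S' y) < e.
  move=> By; have Bry : eball x0 r y.
    by move: By; rewrite /eball/= lt_min => /andP[].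
  have := norm_fst_triangle k (S' y) (S' x0).
  rewrite (fst0 _ Bx0 Kx0) add0r.
  have := lipS y x0 Bry Bx0; move: By; rewrite /eball/= lt_min => /andP[_].
  by rewrite ltr_pdivlMr ?mulr_gt0//; have := enorm_ge0 (y - x0); nra.
(* With t the distance to K1, 2^j < e C1 / (2 t) gives |xi_k| 2^j < e, that is membership in a cell
   of generation j; the bound b is what makes ln (b / t) >= ln (w / t). *)
pose w := Num.min (e * C1 / 2) b.
have w0 : 0 < w by rewrite lt_min b0 divr_gt0// mulr_gt0.
have [|c c0 hc] := @ex_log_scale R w r1 b _ r1b; first by rewrite w0 ge_min lexx orbT.
have [M M0 hM] := tube_bound Tb.
pose c' := ((w / 2) `^ alpha * c `^ beta)^-1.
have c'0 : 0 < c' by rewrite invr_gt0 mulr_gt0 ?powR_gt0// divr_gt0.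
(* At distance 0 the conventions 1/0 = 0 and ln 0 = 0 give the weight the value 0 or 1, according to
   whether the exponents vanish. *)
have [N N0 hN] : majorized (eball x0 eps `&` [set y | dist_to K1 y = 0]).
  apply: (@majorized_bounded_weight _ 1) => // y [_ ->] _.
  rewrite invr0 mulr0 ln0// /powR eqxx.
  by case: (alpha == 0); case: (beta == 0); rewrite ?mulr0 ?mul0r ?mulr1 ?invr0 ?invr1.
exists (c' * M + N) => [|u uB]; first by rewrite addr_gt0// mulr_gt0.
have [P [mP P0 PM hP]] := hM u uB; have [P' [mP' P'0 P'N hP']] := hN u uB.
have mcP : measurable_fun Om (fun x => c'%:E * P x)%E by exact: measurable_funeM.
have cP0 x : (0 <= c'%:E * P x)%E by rewrite mule_ge0// lee_fin ltW.
exists (fun x => c'%:E * P x + P' x)%E; split.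
- exact: emeasurable_funD.
- by move=> x; exact: adde_ge0.
- rewrite ge0_integralD// (ge0_integralZl_EFin _ mOm (fun x _ => P0 x) mP (ltW c'0)).
  by rewrite EFinD EFinM leeD// lee_pmul2l.
move=> y yeps Oy; have yr : eball x0 r y.
  by move: yeps; rewrite /eball/= lt_min => /andP[].
have [t0|t0] := eqVneq (dist_to K1 y) 0.
  by apply: (le_trans (hP' y (conj yeps t0) Oy)); rewrite leeDr.
have {}t0 : 0 < dist_to K1 y by rewrite lt_neqAle eq_sym t0 dist_to_ge0.
have [|j [jw wt cj]] := hc (dist_to K1 y); first by rewrite t0 distr1.
have [|m ym] := he j y yr.
  case: jw => [->|jw]; first by rewrite mulr1 fst_lt.
  have we : w <= e * C1 / 2 by rewrite ge_min lexx.
  have := fst_dist y yr Oy; move: jw; rewrite ltr_pdivlMr// => jw h.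
  have j0 : 0 < 2 ^+ j :> R by rewrite exprn_gt0.
  have h2 : C1 * norm_fst k (S' y) * 2 ^+ j <= dist_to K1 y * 2 ^+ j by rewrite ler_pM2r.
  by rewrite -(ltr_pM2l C10) mulrA; have := mulr_gt0 e0 C10; lra.
apply: (@le_trans _ _ (c'%:E * P y)%E); last by rewrite leeDl.
apply: (@le_trans _ _ (c'%:E *
  ((2 `^ alpha) ^+ j * j.+1%:R `^ (- beta) * `|u y| `^ tau)%:E)%E); last first.
  by rewrite lee_pmul2l//; exact: hP ym.
rewrite -EFinM lee_fin /hardy_integrand mulrC mulrA ler_wpM2r ?powR_ge0//.
by apply: log_weight_le => //; rewrite divr_gt0.
Qed.

Lemma majorized_off_surface x0 : ~ K x0 -> exists2 r, 0 < r & majorized (eball x0 r).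
Proof.
move=> nK; have oK : open (~` K).
  by rewrite openC; apply: compact_closed => //; exact: norm_hausdorff.
have /open_eballP/(_ x0 nK)[e e0 eK] := oK.
exists (e / 2); first by rewrite divr_gt0.
have te y : eball x0 (e / 2) y -> e / 2 <= dist_to K1 y.
  move=> y0; apply: dist_to_ge => // z /K1K Kz; rewrite leNgt; apply/negP => yz.
  have : eball x0 e z.
    rewrite /eball/=; have := ler_enorm_trans y z x0.
    by rewrite (enormB z y); move: y0 yz; rewrite /eball/=; lra.
  by move/eK.
(* If r1 < e / 2, no point of Om lies in the ball and the bound is vacuous. *)
have [r1e|er1] := ltP r1 (e / 2).
  apply: (@majorized_bounded_weight _ 1) => // y /te h /distr1 h'.
  by have := le_lt_trans (le_trans h h') r1e; rewrite ltxx.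
have e20 : 0 < e / 2 by rewrite divr_gt0.
have r10 : 0 < r1 by exact: lt_le_trans er1.
have l0 : 0 < ln (b / r1) by rewrite ln_gt0// ltr_pdivlMr// mul1r.
have w0 : 0 < (e / 2) `^ alpha * ln (b / r1) `^ beta by rewrite mulr_gt0 ?powR_gt0.
apply: (@majorized_bounded_weight _ ((e / 2) `^ alpha * ln (b / r1) `^ beta)^-1).
  by rewrite invr_gt0.
move=> y /te ty Oy; have t0 : 0 < dist_to K1 y by exact: lt_le_trans ty.
have ll : ln (b / r1) <= ln (b / dist_to K1 y).
  by rewrite ler_ln ?posrE ?divr_gt0// ler_pM2l// lef_pV2// distr1.
have ww : (e / 2) `^ alpha * ln (b / r1) `^ beta <=
    dist_to K1 y `^ alpha * ln (b / dist_to K1 y) `^ beta.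
  apply: ler_pM; rewrite ?powR_ge0// ge0_ler_powR ?nnegrE// ?(ltW e20) ?(ltW t0) ?(ltW l0)//.
  exact: le_trans (ltW l0) ll.
by rewrite lef_pV2 ?posrE// (lt_le_trans w0).
Qed.

(** The cover is taken over the closure of Om. Its boundary points are off K, since K lies in the
    open set Om, and there the weight is bounded. *)
Lemma majorized_domain : bounded_set Om -> class_C01 k Om K -> majorized Om.
Proof.
move=> bOm hK; apply: (majorizedS (@subset_closure _ Om)).
apply: compact_local_to_global (closure_compact bOm) _ _ _ _.
- exact: majorized0.
- exact: majorizedU.
- exact: majorizedS.
- move=> x _; have [Kx|nKx] := pselect (K x); first exact: majorized_surface.
  exact: majorized_off_surface.
Qed.

End LocalBounds.

(** * Scaling *)

Section GlobalBound.
Context {R : realType} {d : nat}.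
Local Notation X := 'rV[R]_d.
Local Notation mu := (@leb R d).
Variables (Om K1 : set X) (k : nat) (p tau alpha beta b : R).
Hypotheses (mOm : measurable Om) (p0 : 0 < p) (tau0 : 0 < tau) (K10 : K1 !=set0).
Local Notation F := (hardy_integrand K1 tau alpha beta b).

Lemma hardy_integrand_ge0 u x : 0 <= F u x.
Proof. by rewrite /hardy_integrand divr_ge0 ?mulr_ge0 ?powR_ge0. Qed.

Lemma measurable_hardy_integrand u : measurable_fun [set: X] u ->
  measurable_fun [set: X] (F u).
Proof.
move=> mU; apply: measurable_funM; first exact: measurable_abs_powR.
have mt := measurable_dist_to K10.
apply: (eq_measurable_fun (fun x => (dist_to K1 x `^ alpha *
    ln (b * dist_to K1 x `^ (-1)) `^ beta) `^ (-1))) => [x _|].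
  by rewrite !powR_inv1 ?mulr_ge0 ?powR_ge0 ?dist_to_ge0.
apply: (measurableT_comp (measurable_powR _)); apply: measurable_funM.
  exact: (measurableT_comp (measurable_powR _)).
apply: (measurableT_comp (measurable_powR _)).
apply: (measurableT_comp (@measurable_ln R)); apply: measurable_funM => //.
exact: (measurableT_comp (measurable_powR _)).
Qed.

Lemma hardy_integrandZ c u x : 0 <= c ->
  F (fun y => c * u y) x = c `^ tau * F u x.
Proof. by move=> c0; rewrite /hardy_integrand normrM powRM// ger0_norm// mulrA. Qed.

Let measurable_EFin_sub (f : X -> R) : measurable_fun [set: X] f ->
  measurable_fun Om (fun x => (f x)%:E).
Proof.
move=> mf; apply/measurable_EFinP.
exact: (measurable_funS measurableT (@subsetT _ Om) mf).
Qed.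

Lemma sobolev_unit_ball_scale D (u : X -> R) n l : measurable_fun [set: X] u ->
  (\int[mu]_(x in Om) \int[mu]_(y in Om) (gagliardo_kernel p D u (x, y))%:E +
   \int[mu]_(x in Om) (`|u x| `^ p)%:E <= n%:E)%E ->
  0 < l -> n <= l `^ p -> sobolev_unit_ball p D Om (fun x => l^-1 * u x).
Proof.
move=> mU un l0 nl.
have li0 : 0 <= l^-1 by rewrite invr_ge0 ltW.
have lp0 : 0 < l `^ p by rewrite powR_gt0.
have lpi0 : 0 <= (l `^ p)^-1 by rewrite invr_ge0 ltW.
have lE : l^-1 `^ p = (l `^ p)^-1.
  by rewrite -powRN -powR_inv1 ?(ltW l0)// -powRrM mulN1r.
have mUp : measurable_fun Om (fun x => (`|u x| `^ p)%:E).
  exact: (measurable_EFin_sub (measurable_abs_powR p mU)).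
have Up0 x : (0 <= (`|u x| `^ p)%:E)%E by rewrite lee_fin powR_ge0.
have I1 : (\int[mu]_(x in Om) (`|l^-1 * u x| `^ p)%:E =
    (l `^ p)^-1%:E * \int[mu]_(x in Om) (`|u x| `^ p)%:E)%E.
  rewrite -(ge0_integralZl_EFin _ mOm (fun x _ => Up0 x) mUp lpi0).
  apply: eq_integral => x _; rewrite -EFinM normrM powRM//.
  by rewrite (ger0_norm li0) lE.
have mG := measurable_gagliardo_kernel p D mU.
have G0 := gagliardo_kernel_ge0 p D u.
have G0' x y : (0 <= (gagliardo_kernel p D u (x, y))%:E)%E by rewrite lee_fin.
have mGy x : measurable_fun Om (fun y => (gagliardo_kernel p D u (x, y))%:E).
  by apply: measurable_EFin_sub; exact: (measurableT_comp mG (measurable_pair1 x)).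
have mGx : measurable_fun Om
    (fun x => \int[mu]_(y in Om) (gagliardo_kernel p D u (x, y))%:E)%E.
  exact: (measurable_funS measurableT (@subsetT _ Om)
    (measurable_inner_integral mOm mG G0)).
have IG0 x : (0 <= \int[mu]_(y in Om) (gagliardo_kernel p D u (x, y))%:E)%E.
  by apply: integral_ge0.
have I2 : (\int[mu]_(x in Om) \int[mu]_(y in Om)
      (gagliardo_kernel p D (fun x => l^-1 * u x) (x, y))%:E =
    (l `^ p)^-1%:E * \int[mu]_(x in Om) \int[mu]_(y in Om)
      (gagliardo_kernel p D u (x, y))%:E)%E.
  rewrite -(ge0_integralZl_EFin _ mOm (fun x _ => IG0 x) mGx lpi0).
  apply: eq_integral => x _.
  rewrite -(ge0_integralZl_EFin _ mOm (fun y _ => G0' x y) (mGy x) lpi0).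
  apply: eq_integral => y _; rewrite /gagliardo_kernel/= -mulrBr normrM powRM//.
  by rewrite (ger0_norm li0) lE -EFinM mulrA.
have g0 := @integral_ge0 _ _ _ mu Om _ (fun x _ => IG0 x).
have h0 := @integral_ge0 _ _ _ mu Om _ (fun x _ => Up0 x).
have scale_le (I : \bar R) : (I <= n%:E -> (l `^ p)^-1%:E * I <= 1)%E.
  move=> In; apply: (@le_trans _ _ ((l `^ p)^-1%:E * n%:E)%E).
    by rewrite lee_wpmul2l// lee_fin.
  by rewrite -EFinM lee_fin mulrC ler_pdivrMr// mul1r.
split; first exact: measurable_funM.
  by rewrite I1; apply: scale_le; apply: le_trans un; rewrite leeDr.
by rewrite I2; apply: scale_le; apply: le_trans un; rewrite leeDl.
Qed.

Lemma hardy_integral_le D M (u : X -> R) n l :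
  (forall v, sobolev_unit_ball p D Om v ->
    (\int[mu]_(x in Om) (F v x)%:E <= M%:E)%E) ->
  measurable_fun Om u ->
  (\int[mu]_(x in Om) \int[mu]_(y in Om) (gagliardo_kernel p D u (x, y))%:E +
   \int[mu]_(x in Om) (`|u x| `^ p)%:E <= n%:E)%E ->
  0 < l -> n <= l `^ p ->
  (\int[mu]_(x in Om) (F u x)%:E <= (M * l `^ tau)%:E)%E.
Proof.
move=> hM mU un l0 nl.
have li0 : 0 <= l^-1 by rewrite invr_ge0 ltW.
have lt0 : 0 <= l `^ tau by rewrite powR_ge0.
have ll : l `^ tau * l^-1 `^ tau = 1.
  by rewrite -(powRM tau (ltW l0) li0) (divff (lt0r_neq0 l0)) powR1.
(* u is measurable on Om only; its extension by 0 has the same integrals over Om. *)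
have [w mw wE] : exists2 w : X -> R, measurable_fun [set: X] w &
    forall x, x \in Om -> u x = w x.
  exists (u \_ Om); first by apply/(measurable_restrictT _ mOm).
  by move=> x Ox; rewrite patchE Ox.
have E1 : (\int[mu]_(x in Om) \int[mu]_(y in Om) (gagliardo_kernel p D u (x, y))%:E =
    \int[mu]_(x in Om) \int[mu]_(y in Om) (gagliardo_kernel p D w (x, y))%:E)%E.
  apply: eq_integral => x Ox; apply: eq_integral => y Oy.
  by rewrite /gagliardo_kernel/= (wE x Ox) (wE y Oy).
have E2 : (\int[mu]_(x in Om) (`|u x| `^ p)%:E =
    \int[mu]_(x in Om) (`|w x| `^ p)%:E)%E.
  by apply: eq_integral => x Ox; rewrite (wE x Ox).
rewrite E1 E2 in un; have wB := sobolev_unit_ball_scale mw un l0 nl.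
have Fv0 x : (0 <= (F (fun y => l^-1 * w y) x)%:E)%E by rewrite lee_fin hardy_integrand_ge0.
have mFv : measurable_fun Om (fun x => (F (fun y => l^-1 * w y) x)%:E).
  by apply: measurable_EFin_sub; case: wB => mv _ _; exact: measurable_hardy_integrand mv.
have FE x : x \in Om -> F u x = l `^ tau * F (fun y => l^-1 * w y) x.
  move=> Ox.
  move: (hardy_integrandZ w x li0); move: (F (fun y => l^-1 * w y) x) => Fv ->.
  by rewrite mulrA ll mul1r /hardy_integrand (wE x Ox).
have -> : (\int[mu]_(x in Om) (F u x)%:E =
    (l `^ tau)%:E * \int[mu]_(x in Om) (F (fun y => l^-1 * w y) x)%:E)%E.
  rewrite -(ge0_integralZl_EFin _ mOm (fun x _ => Fv0 x) mFv lt0).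
  by apply: eq_integral => x /FE ->; rewrite EFinM.
rewrite (mulrC M) EFinM; apply: lee_wpmul2l; first by rewrite lee_fin.
exact: hM wB.
Qed.

(** N may vanish, so division by N^(1/p) is avoided: l exceeds N^(1/p) by e / M^(1/tau), and e tends
    to 0. *)
Lemma hardy_le_homogeneous (I N : \bar R) M : 0 < M -> (0 <= I)%E -> (0 <= N)%E ->
  (N < +oo)%E ->
  (forall l, 0 < l -> (N <= (l `^ p)%:E)%E -> (I <= (M * l `^ tau)%:E)%E) ->
  (poweR I tau^-1 <= (M `^ tau^-1)%:E * poweR N p^-1)%E.
Proof.
move=> M0 I0 N0 Noo h.
have Mt0 : 0 < M `^ tau^-1 by rewrite powR_gt0.
have {}Noo : N \is a fin_num by rewrite ge0_fin_numE.
move: N0 h; rewrite -(fineK Noo); move: (fine N) => n; rewrite lee_fin => n0 h.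
rewrite poweR_EFin; apply/lee_addgt0Pr => e e0.
pose l := n `^ p^-1 + e / M `^ tau^-1.
have l0 : 0 < l by rewrite ltr_wpDl ?powR_ge0// divr_gt0.
have nl : n <= l `^ p.
  rewrite -[leLHS](powRr1 n0) -(@mulVf _ p) ?gt_eqF// powRrM.
  apply: ge0_ler_powR; rewrite ?nnegrE ?(ltW p0) ?powR_ge0 ?(ltW l0)//.
  by rewrite /l lerDl divr_ge0 ?ltW.
have := h l l0; rewrite lee_fin => /(_ nl) Il.
have Ifin : I \is a fin_num by rewrite ge0_fin_numE// (le_lt_trans Il)// ltry.
move: I0 Il; rewrite -(fineK Ifin); move: (fine I) => i; rewrite !lee_fin => i0 il.
rewrite (_ : _ + e = M `^ tau^-1 * l); last by rewrite /l mulrDr mulrCA divff ?mulr1// gt_eqF.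
have -> : M `^ tau^-1 * l = (M * l `^ tau) `^ tau^-1.
  rewrite powRM ?(ltW M0) ?powR_ge0// -powRrM divff ?gt_eqF// powRr1 ?ltW//.
by apply: ge0_ler_powR; rewrite ?nnegrE ?invr_ge0 ?(ltW tau0)// mulr_ge0 ?powR_ge0// ltW.
Qed.

Lemma majorized_integral_le (D := d%:R + k%:R) :
  majorized Om K1 k p tau alpha beta b Om ->
  exists2 M : R, 0 < M & forall v, sobolev_unit_ball p D Om v ->
    (\int[mu]_(x in Om) (F v x)%:E <= M%:E)%E.
Proof.
move=> [M M0 h]; exists M => // v vB; have [mv _ _] := vB.
have [Psi [mPsi Psi0 PsiM FPsi]] := h v vB; apply: le_trans PsiM.
apply: ge0_le_integral => //.
- by move=> x _; rewrite lee_fin hardy_integrand_ge0.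
- exact: (measurable_EFin_sub (measurable_hardy_integrand mv)).
- by move=> x Ox; exact: FPsi.
Qed.

End GlobalBound.

(** * Exponents and conclusion *)

(** The threshold (d p + 1) / (1 - (k - d)) is where tau - 1 and d p + (k - d) tau agree; it lies
    between p and d p / (d - k). In the last range beta = p alpha, so both signs amount to tau <= d
    p / (d - k). *)
Lemma hardy_exponents {R : realFieldType} (d k : nat) (p tau alpha beta : R) :
  1 < p -> (1 < k < d)%N -> alpha = d%:R + (k%:R - d%:R) * (tau / p) ->
  [\/ tau = p /\ beta = p,
      (p < tau <= (d%:R * p + 1) / (1 - (k%:R - d%:R))) /\ beta = tau - 1 |
      ((d%:R * p + 1) / (1 - (k%:R - d%:R)) < tau <= d%:R * p / (d%:R - k%:R)) /\
      beta = d%:R * p + (k%:R - d%:R) * tau] ->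
  [/\ 0 <= alpha, 0 <= beta &
      tau = p /\ beta = p \/ p < tau <= d%:R * p / (d%:R - k%:R)].
Proof.
move=> p1 /andP[k1 kd] aE hcase.
have k1' : 1 < k%:R :> R by rewrite ltr1n.
have kd' : k%:R + 1 <= d%:R :> R by rewrite natr1 ler_nat.
have {k1 kd}dk0 : 0 < d%:R - k%:R :> R by lra.
have dk1 : 0 < 1 - (k%:R - d%:R) :> R by lra.
have p0 : 0 < p by lra.
have hk : 0 <= p * (d%:R - k%:R) by rewrite mulr_ge0 ?ltW.
have al tau' : 0 < tau' <= d%:R * p / (d%:R - k%:R) ->
    0 <= d%:R + (k%:R - d%:R) * (tau' / p).
  move=> /andP[t0]; rewrite ler_pdivlMr// => h.
  have : tau' / p * (d%:R - k%:R) <= d%:R.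
    by rewrite mulrAC ler_pdivrMr.
  lra.
have pq : p <= d%:R * p / (d%:R - k%:R) by rewrite ler_pdivlMr//; nra.
case: hcase => [[tE ->]|[/andP[h1 h2] ->]|[/andP[h1 h2] ->]].
- by split; [rewrite aE al// tE p0 | rewrite ltW | left].
- have h3 : tau <= d%:R * p / (d%:R - k%:R).
    move: h2; rewrite !ler_pdivlMr// => h2.
    have : tau * (d%:R - k%:R) + tau <= d%:R * p + 1 by lra.
    lra.
  by split; [rewrite aE al// h3 andbT; lra | lra | right; rewrite h1 h3].
- have h3 : p < tau.
    apply: le_lt_trans h1; rewrite ler_pdivlMr//; nra.
  have t0 : 0 < tau by lra.
  split; [by rewrite aE al// h2 t0 | | by right; rewrite h3 h2].
  by move: h2; rewrite ler_pdivlMr//; lra.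
Qed.

Theorem corollary1p1 (R : realType) (d k : nat) (s p tau alpha beta rad : R)
  (Om K K1 : set 'rV[R]_d)
  (hs : 0 < s < 1) (hp : 1 < p) (hd : (2 <= d)%N) (hk : (1 < k < d)%N)
  (hOm : bounded_lipschitz_domain Om)
  (hKc : compact K) (hK : class_C01 k Om K) (hKOm : K `<=` Om)
  (hK1 : K1 `<=` K) (hK1n : K1 !=set0)
  (hsp : s * p = k%:R)
  (hrad : 0 < rad) (hKrad : forall x, Om x -> dist_to K x < rad)
  (* the logarithm in the weight is positive, and bounded away from 0;
     automatic if K1 = K, or if dist_to K1 < rad on Om *)
  (hK1rad : exists2 r : R, r < 2 * rad & forall x, Om x -> dist_to K1 x <= r)
  (halpha : alpha = d%:R + (k%:R - d%:R) * (tau / p))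
  (hcase :
    [\/ tau = p /\ beta = p,
        (p < tau <= (d%:R * p + 1) / (1 - (k%:R - d%:R))) /\
        beta = tau - 1 |
        ((d%:R * p + 1) / (1 - (k%:R - d%:R)) < tau
           <= d%:R * p / (d%:R - s * p)) /\
        beta = d%:R * p + (k%:R - d%:R) * tau]) :
  exists2 C : R, 0 < C &
  forall u : 'rV[R]_d -> R, sobolev0 s p Om K u ->
  (poweR (\int[lebesgue_rV d]_(x in Om)
            (`|u x| `^ tau /
             (dist_to K1 x `^ alpha *
              ln (2 * rad / dist_to K1 x) `^ beta))%:E) tau^-1
   <= C%:E *
      poweR (\int[lebesgue_rV d]_(x in Om) \int[lebesgue_rV d]_(y in Om)
               (`|u x - u y| `^ p / enorm (x - y) `^ (d%:R + s * p))%:E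
             + \int[lebesgue_rV d]_(x in Om) (`|u x| `^ p)%:E) p^-1)%E.
Proof.
have [_ oOm _ bOm _] := hOm; have mOm := measurable_open oOm.
rewrite hsp in hcase *.
have [al0 be0 tauE] := hardy_exponents hp hk halpha hcase.
have p0 : 0 < p by exact: lt_trans hp.
have tau0 : 0 < tau.
  by case: tauE => [[-> _]//|/andP[h _]]; exact: lt_trans h.
have kd0 : (0 < k < d)%N by move/andP: hk => [k1 ->]; rewrite andbT (ltn_trans _ k1).
have [c c0 [r0 r00 hc]] := lipschitz_domain_density hOm.
have [S S0 hS] := sobolev_embedding mOm c0 r00 kd0 p0 hc.
have [r1 r1rad distr1] := hK1rad.
have b0 : 0 < 2 * rad by rewrite mulr_gt0.
have := majorized_domain oOm hk hp al0 be0 halpha tauE (ltW S0) hS hK1n hK1 b0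
  r1rad distr1 hKc hKOm bOm hK.
move=> /(majorized_integral_le mOm hK1n)[M M0 hM].
exists (M `^ tau^-1) => [|u [[mU Lu Gu] _]]; first by rewrite powR_gt0.
rewrite /gagliardo /Lp_power hsp in Lu Gu.
have L0 : (0 <= \int[lebesgue_rV d]_(x in Om) (`|u x| `^ p)%:E)%E.
  by apply: integral_ge0 => x _; rewrite lee_fin powR_ge0.
have G0 : (0 <= \int[lebesgue_rV d]_(x in Om) \int[lebesgue_rV d]_(y in Om)
    (`|u x - u y| `^ p / enorm (x - y) `^ (d%:R + k%:R))%:E)%E.
  apply: integral_ge0 => x _; apply: integral_ge0 => y _.
  by rewrite lee_fin divr_ge0 ?powR_ge0.
apply: hardy_le_homogeneous => //.
- by apply: integral_ge0 => x _; rewrite lee_fin divr_ge0 ?mulr_ge0 ?powR_ge0.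
- exact: adde_ge0.
- exact: lte_add_pinfty.
move=> l l0 Nl.
exact: (hardy_integral_le mOm hK1n hM mU Nl l0 (lexx _)).
Qed.
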